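(* Let $D\ge2$ be an integer and let $0<a<b$ be real numbers. Then the following hold. (1) If $D^{-1}b<a$, then there exist a real number $p_D\in(1,\infty)$ and two sets $\Omega_a\in\mathbb{P}^D(a)$ and $\Omega_b\in\mathbb{P}^D(b)$ such that $T(p_D;\Omega_a)<T(p_D;\Omega_b)$. (2) Conversely, if $D^{-1}b\ge a$, then for all $\Omega_a\in\mathbb{P}^D(a)$ and $\Omega_b\in\mathbb{P}^D(b)$ one has $$T(p;\Omega_b)<T(p;\Omega_a)\qquad\text{for all }p\in(1,\infty).$$
   Context: For an integer $D\ge1$, $\mathbb{P}^D$ is the family of (nonempty) open, bounded, convex subsets of $\mathbb{R}^D$. For $\Omega\in\mathbb{P}^D$, $R_\Omega$ denotes its inradius (the radius of the largest ball inscribed in $\Omega$), and for $r>0$, $\mathbb{P}^D(r):=\{\Omega\in\mathbb{P}^D : R_\Omega=r\}$. $|\Omega|$ is Lebesgue measure. For $p>1$ and $\Omega\in\mathbb{P}^D$, let $u_p\in W_0^{1,p}(\Omega)$ be the unique (weak) solution of $-\Delta_p u=1$ in $\Omega$, $u=0$ on $\partial\Omega$, where $\Delta_p u=\operatorname{div}(|\nabla u|^{p-2}\nabla u)$. The $p$-torsional rigidity is $T_p(\Omega):=\int_\Omega u_p\,dx$, and the normalized $p$-torsional rigidity is $T(p;\Omega):=|\Omega|^{p-1}T_p(\Omega)^{1-p}$. Equivalently, $$T(p;\Omega)=\inf_{u\in W_0^{1,p}(\Omega)\setminus\{0\}}\frac{\frac1{|\Omega|}\int_\Omega|\nabla u|^p\,dx}{\left(\frac1{|\Omega|}\int_\Omega|u|\,dx\right)^p}.$$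 *)

(* Defs.v *)
From HB Require Import structures.
From mathcomp Require Import all_boot all_order all_algebra.
From mathcomp Require Import all_classical all_reals all_analysis.

Set Implicit Arguments.
Unset Strict Implicit.
Unset Printing Implicit Defensive.

Import Order.TTheory GRing.Theory Num.Theory.
Import numFieldNormedType.Exports.

Local Open Scope classical_set_scope.
Local Open Scope ring_scope.

(* The product sigma-algebra on row vectors, which for 'rV[R]_n is the Borel
   sigma-algebra of R^n. *)
Definition rV_display : measure_display -> measure_display.
Proof. exact. Qed.

Section measurable_rV.
Context {d : measure_display} {T : measurableType d}.
Variable n : nat.

Let coord : 'I_n -> 'rV[T]_n -> T := fun i x => x ord0 i.

Let rV_set0 : g_sigma_preimage coord set0.
Proof. exact: sigma_algebra0. Qed.

Let rV_setC A : g_sigma_preimage coord A -> g_sigma_preimage coord (~` A).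
Proof. exact: sigma_algebraC. Qed.

Let rV_bigcup (F : (set 'rV[T]_n)^nat) :
  (forall i, g_sigma_preimage coord (F i)) ->
  g_sigma_preimage coord (\bigcup_i (F i)).
Proof. exact: sigma_algebra_bigcup. Qed.

HB.instance Definition _ := @isMeasurable.Build (rV_display d)
  'rV[T]_n (g_sigma_preimage coord) rV_set0 rV_setC rV_bigcup.

End measurable_rV.

Section measurable_rV_theory.
Context {d d' : measure_display} {T : measurableType d} {S : measurableType d'}.
Variable n : nat.

Lemma measurable_coord_rV (i : 'I_n) :
  measurable_fun [set: 'rV[T]_n] (fun x : 'rV[T]_n => x ord0 i).
Proof.
move=> _ Y mY; rewrite setTI; apply: sub_sigma_algebra => /=.
rewrite -bigcup_seq/=; exists i => /=; first by rewrite mem_index_enum.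
by exists Y => //; rewrite setTI.
Qed.

Lemma measurable_fun_rV (f : S -> 'rV[T]_n) :
  (forall i, measurable_fun [set: S] (fun x => f x ord0 i)) ->
  measurable_fun [set: S] f.
Proof.
move=> mf; apply: (@measurability _ _ _ _ _ _ (\big[setU/set0]_(i < n)
    preimage_set_system setT (fun x : 'rV[T]_n => x ord0 i) measurable)) => //.
move=> _ [A + <-]; rewrite -bigcup_seq/= => -[i _ [B mB <-]].
by rewrite setTI; exact: mf.
Qed.

End measurable_rV_theory.

Section lebesgue_rV_succ.
Context {R : realType} {n : nat}.

Definition rV_cons (z : measurableTypeR R * 'rV[R]_n) : 'rV[R]_n.+1 :=
  \row_i oapp (fun j => z.2 ord0 j) z.1 (unlift ord0 i).

Definition rV_uncons (x : 'rV[R]_n.+1) : measurableTypeR R * 'rV[R]_n :=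
  (x ord0 ord0, \row_j x ord0 (lift ord0 j)).

Lemma rV_consK : cancel rV_cons rV_uncons.
Proof.
move=> [t v]; rewrite /rV_uncons mxE unlift_none /=; congr pair.
by apply/rowP => j; rewrite !mxE liftK.
Qed.

Lemma measurable_rV_cons : measurable_fun setT rV_cons.
Proof.
apply: measurable_fun_rV => i; have [j ->|->] := unliftP ord0 i.
  rewrite [X in measurable_fun _ X](_ : _ = (fun x : 'rV[R]_n => x ord0 j) \o snd).
    by apply: measurableT_comp => //; exact: measurable_coord_rV.
  by apply/funext => z /=; rewrite mxE liftK.
rewrite [X in measurable_fun _ X](_ : _ = fst); first exact: measurable_fst.
by apply/funext => z /=; rewrite mxE unlift_none.
Qed.

Lemma measurable_rV_uncons : measurable_fun setT rV_uncons.
Proof.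
apply: measurable_fun_pair; first exact: (measurable_coord_rV (T := R)).
apply: measurable_fun_rV => j.
rewrite [X in measurable_fun _ X](_ : _ = fun x : 'rV[R]_n.+1 => x ord0 (lift ord0 j)).
  exact: measurable_coord_rV.
by apply/funext => z /=; rewrite mxE.
Qed.

Variable m : {sigma_finite_measure set 'rV[R]_n -> \bar R}.
Local Open Scope ereal_scope.

Definition lebesgue_rV_succ (A : set 'rV[R]_n.+1) : \bar R :=
  (@lebesgue_measure R \x m) (rV_cons @^-1` A).

Let mpre A : measurable A -> measurable (rV_cons @^-1` A).
Proof.
by move=> mA; rewrite -[X in measurable X]setTI; exact: measurable_rV_cons.
Qed.

Let succ0 : lebesgue_rV_succ set0 = 0.
Proof. by rewrite /lebesgue_rV_succ preimage_set0 measure0. Qed.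

Let succ_ge0 A : 0 <= lebesgue_rV_succ A.
Proof. exact: integral_ge0. Qed.

Let succ_sigma_additive : semi_sigma_additive lebesgue_rV_succ.
Proof.
move=> F mF tF mUF; rewrite /lebesgue_rV_succ preimage_bigcup.
apply: measure_semi_sigma_additive.
- by move=> k; exact: mpre.
- apply/trivIsetP => /= i j _ _ ij; rewrite -preimage_setI.
  by move/trivIsetP : tF => /(_ _ _ _ _ ij) ->//; rewrite preimage_set0.
- by rewrite -preimage_bigcup; exact: mpre.
Qed.

HB.instance Definition _ := isMeasure.Build _ _ _ lebesgue_rV_succ
  succ0 succ_ge0 succ_sigma_additive.

Let succ_sigma_finite : sigma_finite setT lebesgue_rV_succ.
Proof.
have /sigma_finiteP[F [TF ndF Foo]] := sigma_finiteT (@lebesgue_measure R).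
have /sigma_finiteP[G [TG ndG Goo]] := sigma_finiteT m.
exists (fun k => rV_uncons @^-1` (F k `*` G k)).
  rewrite -preimage_bigcup; apply/esym; rewrite -subTset => x _ /=.
  have [k _ Fk] : (\bigcup_k F k) (rV_uncons x).1 by rewrite -TF.
  have [l _ Gl] : (\bigcup_k G k) (rV_uncons x).2 by rewrite -TG.
  exists (maxn k l) => //; split.
    by move: Fk; exact/subsetPset/ndF/leq_maxl.
  by move: Gl; exact/subsetPset/ndG/leq_maxr.
move=> k; have [mF Fkoo] := Foo k; have [mG Gkoo] := Goo k.
have mFG : measurable (F k `*` G k) by exact: measurableX.
split; first by rewrite -[X in measurable X]setTI; exact: measurable_rV_uncons.
rewrite /lebesgue_rV_succ (_ : _ @^-1` _ = F k `*` G k); last first.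
  by apply/seteqP; split => z; rewrite /preimage /mkset rV_consK.
by rewrite product_measure1E// lte_mul_pinfty// ge0_fin_numE.
Qed.

HB.instance Definition _ := Measure_isSigmaFinite.Build _ _ _
  lebesgue_rV_succ succ_sigma_finite.

End lebesgue_rV_succ.

(* Lebesgue measure on R^n, as the n-fold product of the one-dimensional one. *)
Fixpoint lebesgue_rV {R : realType} (n : nat) :
    {sigma_finite_measure set 'rV[R]_n -> \bar R} :=
  match n with
  | 0 => \d_ (0 : 'rV[R]_0)
  | k.+1 => lebesgue_rV_succ (lebesgue_rV k)
  end.

Lemma lebesgue_rV_box {R : realType} (n : nat) (A : 'I_n -> set R) :
  (forall i, measurable (A i)) ->
  lebesgue_rV n [set x | forall i, A i (x ord0 i)] =
  (\prod_(i < n) lebesgue_measure (A i))%E.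
Proof.
elim: n A => [|n IH] A mA /=.
  rewrite big_ord0 diracE mem_set// => i; by case: i.
rewrite big_ord_recl -IH; last by move=> i; exact: mA.
have mAS : measurable [set x : 'rV[R]_n | forall i, A (lift ord0 i) (x ord0 i)].
  rewrite (_ : [set x | _] =
    \bigcap_(i in [set: 'I_n]) [set x : 'rV[R]_n | A (lift ord0 i) (x ord0 i)]).
    apply: fin_bigcap_measurable => [|i _]; first exact: finite_finset.
    rewrite -[X in measurable X]setTI.
    exact: (measurable_coord_rV _ measurableT (mA _)).
  by apply/seteqP; split => x /= Ax i; [move=> _|]; exact: Ax.
rewrite -(product_measure1E (@lebesgue_measure R) (lebesgue_rV n) (mA ord0) mAS).
rewrite /lebesgue_rV_succ; congr (product_measure1 _ _ _).
apply/seteqP; split => [[t v] /= Atv|[t v] /= [At Av] i].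
  split => [|i]; first by have := Atv ord0; rewrite mxE unlift_none.
  by have := Atv (lift ord0 i); rewrite mxE liftK.
by have [j ->|->] := unliftP ord0 i; rewrite mxE ?liftK ?unlift_none //=.
Qed.

Section torsion.
Context {R : realType} {D : nat}.
Local Notation mu := (@lebesgue_rV R D).
Implicit Types (O : set 'rV[R]_D) (f u phi : 'rV[R]_D -> R).
Implicit Types (g h : 'rV[R]_D -> 'rV[R]_D) (p r : R).

(* The library's norm on 'rV[R]_D is the sup norm, so the Euclidean structure is
   made explicit. *)
Definition dotrV (x y : 'rV[R]_D) : R := \sum_i x ord0 i * y ord0 i.
Definition enorm (x : 'rV[R]_D) : R := Num.sqrt (dotrV x x).
Definition eball (x : 'rV[R]_D) r : set 'rV[R]_D := [set y | enorm (y - x) < r].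

Definition convex_domain : set (set 'rV[R]_D) :=
  [set O | [/\ O !=set0, open O, bounded_set O & convex_set O]].

Definition inradius O : R :=
  sup [set r | 0 < r /\ exists x, eball x r `<=` O].

Definition convex_domain_inradius r : set (set 'rV[R]_D) :=
  [set O | convex_domain O /\ inradius O = r].

Definition partial (i : 'I_D) f : 'rV[R]_D -> R := 'D_(delta_mx ord0 i) f.

Definition smooth f : Prop := forall s : seq 'I_D,
  continuous (foldr partial f s) /\
  forall i x, derivable (foldr partial f s) x (delta_mx ord0 i).

Definition fsupport f : set 'rV[R]_D := closure [set x | f x != 0].

Definition test_function O : set ('rV[R]_D -> R) :=
  [set phi | [/\ smooth phi, compact (fsupport phi) & fsupport phi `<=` O]].

(* Functions on O are encoded as functions on the whole space whose values
   outside O are ignored. *)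
Definition in_Lp p O u : Prop := u \* \1_O \in Lfun mu p%:E.
Definition Lp_norm p O u : \bar R := 'N[mu]_p%:E[EFin \o (u \* \1_O)].

Definition weak_gradient O u g : Prop := forall phi i, test_function O phi ->
  \int[mu]_(x in O) (u x * partial i phi x) =
  - \int[mu]_(x in O) (g x ord0 i * phi x).

Definition W1p p O u g : Prop :=
  [/\ in_Lp p O u, forall i, in_Lp p O (fun x => g x ord0 i) &
      weak_gradient O u g].

(* u belongs to the closure of the test functions in W^{1,p}(O), and g is a
   version of its gradient. *)
Definition W01p p O u g : Prop :=
  W1p p O u g /\
  exists phi : nat -> 'rV[R]_D -> R,
    [/\ forall n, test_function O (phi n),
        Lp_norm p O (fun x => phi n x - u x) @[n --> \oo] --> 0%E &
        forall i, Lp_norm p O (fun x => partial i (phi n) x - g x ord0 i)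
          @[n --> \oo] --> 0%E].

(* u is a weak solution in W_0^{1,p}(O) of - div (|grad u|^(p-2) grad u) = 1.
   Where g x = 0 the scalar 0 `^ (p - 2) is finite, so the integrand is 0 there
   for every p > 1. *)
Definition torsion_solution p O u : Prop :=
  exists2 g, W01p p O u g & forall phi h, W01p p O phi h ->
    \int[mu]_(x in O) (enorm (g x) `^ (p - 2) * dotrV (g x) (h x)) =
    \int[mu]_(x in O) phi x.

(* A chosen representative of the solution, which is unique up to equality
   almost everywhere on O. *)
Definition torsion_function p O : 'rV[R]_D -> R :=
  xget (cst 0) [set u | torsion_solution p O u].

Definition torsional_rigidity p O : R :=
  \int[mu]_(x in O) torsion_function p O x.

Definition normalized_torsional_rigidity p O : R :=
  fine (mu O) `^ (p - 1) * torsional_rigidity p O `^ (1 - p).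

End torsion.

(* Main.v *)
(* Let q = p / (p - 1) and T the torsional rigidity.  The torsion function minimizes the energy
   p^-1 \int |grad u|^p - \int u, which gives two dual bounds: T / q >= \int F - p^-1 \int G^p for every
   F >= 0 vanishing off O whose local Lipschitz constants are bounded by G, and T <= \int |W|^q for every
   field W with div W <= -1 on O.

   For a convex O of inradius r let j be its gauge at an incenter and I = \int_O j^q, which equals
   |O| D / (D + q) by homogeneity.  The function F = k (1 - j^q) gives (r / D)^q I <= T.  Conversely O is
   the intersection of half-spaces, and with F the soft maximum of r minus the distances to their
   boundaries, W = - F grad F (mixed with a small multiple of x / D) gives T < r^q I.  Both together
   give T(Oa) / |Oa| < a^q D / (D + q) <= (b / D)^q D / (D + q) <= T(Ob) / |Ob| whenever a <= b / D.

   If b / D < a, take for Ob the ball, where W = - x / D gives T(Ob) <= (b / D)^q |Ob|, and for Oa the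
   slab |x_0| < a truncated far away in the other directions.  A function of |x_0| which is constant
   near x_0 = 0 and decreases linearly to 0 near the faces gives T(Oa) >= X^q |Oa| with X as close to a
   as wanted for large q, hence with X > b / D. *)

Require Import Defs.
From HB Require Import structures.
From mathcomp Require Import all_boot all_order all_algebra.
From mathcomp Require Import all_classical all_reals all_analysis.
From mathcomp Require Import measurable_realfun ring lra.

Set Implicit Arguments.
Unset Strict Implicit.
Unset Printing Implicit Defensive.

Import Order.TTheory GRing.Theory Num.Theory.
Import numFieldNormedType.Exports.

Local Open Scope classical_set_scope.
Local Open Scope ring_scope.

(** * Lebesgue measure on row vectors *)

(** [torsion_function] is a chosen value, about which nothing can be said before a solution is known
    to exist. Hence the direct method is carried out in full; uniform convexity makes minimizing
    sequences converge strongly, so that weak compactness never enters.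

    The constructions have explicit models. F = k (1 - j^q) is the torsion function of a ball with
    |x| / r replaced by j, and the estimate survives because j is Lipschitz with constant 1 / r. For
    the upper bound the ideal F is r minus the distance to the complement: it is convex with |grad
    F| = 1, so formally div (F grad F) = |grad F|^2 + F Delta F >= 1. The soft maximum turns this
    into a C^1 field, and r - dist <= r j leads to the same moment I, whose value then cancels in
    the comparison. Strictness is the delicate point: on a ball r - dist = r j throughout, and it is
    the share of x / D that gains there.

    Part (1) needs no sharp constants. Letting q grow beats every factor that does not depend on q,
    so crude bounds for the ball and the slab are enough. *)

Section measure_rV.
Context {R : realType} {D : nat}.
Local Notation mu := (@lebesgue_rV R D).
Implicit Types (U A : set 'rV[R]_D) (x y v : 'rV[R]_D).

Lemma coord_ler_norm x i : `|x ord0 i| <= `|x|.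
Proof.
rewrite [leRHS]/Num.norm /= mx_normrE.
exact: (le_bigmax _ (fun ij : 'I_1 * 'I_D => `|x ij.1 ij.2|) (ord0, i)).
Qed.

Lemma rV_norm_ler x (e : R) : 0 <= e -> (forall i, `|x ord0 i| <= e) -> `|x| <= e.
Proof.
move=> e0 xe; rewrite [leLHS]/Num.norm /= mx_normrE; apply/bigmax_leP; split => //.
by move=> [i j] _ /=; rewrite ord1.
Qed.

Lemma rV_norm_ltr x (e : R) : 0 < e -> (forall i, `|x ord0 i| < e) -> `|x| < e.
Proof.
move=> e0 xe; rewrite [ltLHS]/Num.norm /= mx_normrE; apply/bigmax_ltP; split => //.
by move=> [i j] _ /=; rewrite ord1.
Qed.

Definition rbox (A : 'I_D -> set R) : set 'rV[R]_D :=
  [set x | forall i, A i (x ord0 i)].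

Lemma lebesgue_rbox (A : 'I_D -> set R) : (forall i, measurable (A i)) ->
  mu (rbox A) = (\prod_(i < D) lebesgue_measure (A i))%E.
Proof. exact: lebesgue_rV_box. Qed.

Lemma measurable_rbox (A : 'I_D -> set R) : (forall i, measurable (A i)) ->
  measurable (rbox A).
Proof.
move=> mA; rewrite (_ : rbox A =
    \bigcap_(i in [set: 'I_D]) [set x : 'rV[R]_D | A i (x ord0 i)]).
  apply: fin_bigcap_measurable => [|i _]; first exact: finite_finset.
  rewrite -[X in measurable X]setTI.
  exact: (measurable_coord_rV _ measurableT (mA _)).
by apply/seteqP; split => x /= Ax i; [move=> _|]; exact: Ax.
Qed.

(** The sigma-algebra is generated by the coordinates, so boxes are measurable; an open set is the
    countable union of the cubes with rational centre and radius 1 / (k + 1) that it contains. *)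
Lemma measurable_open_rV U : open U -> measurable U.
Proof.
move=> oU.
pose box (q : 'rV[rat]_D) (k : nat) : set 'rV[R]_D :=
  rbox (fun i => ball (ratr (q ord0 i) : R) k.+1%:R^-1).
pose F (q : 'rV[rat]_D) := \bigcup_(k in [set k | box q k `<=` U]) box q k.
have mF q : measurable (F q).
  apply: bigcup_measurable => k _.
  apply: measurable_rbox => i.
  by rewrite ball_itv; exact: measurable_itv.
suff -> : U = \bigcup_q F q by apply: countable_bigcupT_measurable.
apply/seteqP; split => [x Ux|x [q _ [k /= kU] xk]]; last exact: kU.
have : nbhs x U by exact: open_nbhs_nbhs.
move=> /nbhs_ballP[e /= e0 eU].
(* Any cube of this radius that contains x stays in the ball of radius e around x, since its points
   are within twice the radius of x. *)
have [k ke] : exists k : nat, k.+1%:R^-1 + k.+1%:R^-1 < e.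
  have e20 : 0 < e / 2 by rewrite divr_gt0.
  have h : (e / 2)^-1 < (Num.bound (e / 2)^-1)%:R by rewrite archi_boundP// invr_ge0 ltW.
  exists (Num.bound (e / 2)^-1); by rewrite [ltRHS]splitr ltrD// invf_plt ?posrE// (lt_trans h)// ltr_nat.
have k0 : 0 < k.+1%:R^-1 :> R by rewrite invr_gt0.
have /choice[q Hq] (i : 'I_D) : exists q : rat, `|x ord0 i - ratr q| < k.+1%:R^-1.
  have /rat_in_itvoo[q] : x ord0 i - k.+1%:R^-1 < x ord0 i + k.+1%:R^-1.
    by rewrite ltrD2l gtrN.
  by rewrite in_itv/= => h; exists q; rewrite ltr_distlC.
exists (\row_i q i) => //; exists k => /=.
  move=> y yk; apply: eU; rewrite -ball_normE /=.
  apply: rV_norm_ltr => // i; rewrite !mxE.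
  apply: le_lt_trans ke; rewrite [X in `|X|](_ : _ =
    (x ord0 i - ratr (q i)) + (ratr (q i) - y ord0 i)); last by ring.
  apply: (le_trans (ler_normD _ _)); rewrite lerD ?(ltW (Hq i))//.
  by have := yk i; rewrite -ball_normE /= mxE => /ltW.
by move=> i; rewrite -ball_normE /= mxE distrC.
Qed.

Lemma continuous_measurable_rV (f : 'rV[R]_D -> R) :
  continuous f -> measurable_fun setT f.
Proof.
move=> /continuousP cf; apply: (measurability _ (RGenOpens.measurableE R)) => //.
move=> _ [_ [a [b ->]] <-]; rewrite setTI; apply: measurable_open_rV.
by apply: cf; exact: interval_open.
Qed.

Lemma lebesgue_rbox_itv_lty (a b : R) : (mu (rbox (fun=> `[a, b]%classic)) < +oo)%E.
Proof.
rewrite lebesgue_rbox; last by move=> i; exact: measurable_itv.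
rewrite lebesgue_measure_itv/= lte_fin.
by case: ifPn => _; rewrite -?EFinB prodEFin ltry.
Qed.

(** Boxes form a generating pi-system, and the cubes with sides from -k to k exhaust the space with
    finite measure. This identifies the image of [mu] under an affine map. *)
Lemma lebesgue_rV_unique (m : {measure set 'rV[R]_D -> \bar R}) :
  (forall A : 'I_D -> set R, (forall i, measurable (A i)) ->
    m (rbox A) = (\prod_(i < D) lebesgue_measure (A i))%E) ->
  forall X, measurable X -> m X = mu X.
Proof.
move=> mE X mX.
pose G : set (set 'rV[R]_D) :=
  [set B | exists2 A : 'I_D -> set R, (forall i, measurable (A i)) &
           B = rbox A].
pose g (k : nat) : set 'rV[R]_D := rbox (fun=> `[- k%:R, k%:R]%classic).
apply/esym; apply: (@measure_unique _ _ _ G g) => //.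
- apply/seteqP; split => [|B].
    apply: smallest_sub; first exact: smallest_sigma_algebra.
    move=> B; rewrite -bigcup_seq /= => -[i _ [C mC <-]].
    (* A condition on the single coordinate i is the box whose other sides are the whole line. *)
    apply: sub_sigma_algebra; exists (fun j => if j == i then C else setT).
      by move=> j; case: ifP.
    rewrite setTI; apply/seteqP; split => x /= Cx; last by have := Cx i; rewrite eqxx.
    by move=> j; case: eqP => [->|].
  apply: smallest_sub; first exact: sigma_algebra_measurable.
  by move=> _ [A mA ->]; exact: measurable_rbox.
- move=> _ _ [A mA ->] [B mB ->]; exists (fun i => A i `&` B i).
    by move=> i; exact: measurableI.
  apply/seteqP; split => x /=; first by move=> [? ?] i.
  by move=> h; split=> i; have [] := h i.
- move=> k; exists (fun=> `[- k%:R, k%:R]%classic) => // i; exact: measurable_itv.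
- apply/seteqP; split => // x _; exists (Num.truncn `|x|).+1 => // i /=.
  rewrite in_itv/= -ler_norml; apply: (le_trans (coord_ler_norm _ _)).
  by apply: ltW; exact: truncnS_gt.
- by move=> _ [A mA ->]; rewrite mE//; exact: lebesgue_rbox.
- move=> k; exact: lebesgue_rbox_itv_lty.
Qed.

Lemma lebesgue_measure_affine (c v : R) (A : set R) : c != 0 -> measurable A ->
  lebesgue_measure [set x | A (c * x + v)] = (`|c|^-1%:E * lebesgue_measure A)%E.
Proof.
move=> c0 mA; pose phi (x : measurableTypeR R) : measurableTypeR R := c * x + v.
have mphi : measurable_fun setT phi.
  by apply: measurable_funD => //; exact: measurable_funM.
have c0' : 0 <= `|c| by [].
pose m0 := measure_function_pushforward__canonical__measure_function_Measure (@lebesgue_measure R) mphi.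
suff -> : lebesgue_measure A = mscale (NngNum c0') m0 A.
  rewrite /mscale /= muleA -EFinM mulVf ?normr_eq0// mul1e.
  by [].
apply: (@lebesgue_measure_unique R (mscale (NngNum c0') m0)) => // _ [[a b]] _ <-.
suff : lebesgue_measure `]a, b] = (`|c|%:E * lebesgue_measure (phi @^-1` `]a, b]))%E by [].
(* A negative c reverses the interval, so the preimage of a left-open interval is right-open and the
   two signs are computed separately. *)
have [cp|cn] : 0 < c \/ c < 0 by case/orP : (lt_total c0) => ?; [right|left].
  rewrite (_ : _ @^-1` _ = `](a - v)/c, (b - v)/c]%classic); last first.
    apply/seteqP; split => x /=; rewrite !in_itv/= /phi ltr_pdivrMr// ler_pdivlMr//;
     by move=> /andP[? ?]; apply/andP; split; lra.
  rewrite !lebesgue_measure_itv/= !lte_fin ltr_pM2r ?invr_gt0// ltrD2r.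
  case: ifPn => _; last by rewrite mule0.
  rewrite -!EFinB -EFinM gtr0_norm//; congr EFin; by field; rewrite gt_eqF.
rewrite (_ : _ @^-1` _ = `[(b - v)/c, (a - v)/c[%classic); last first.
  apply/seteqP; split => x /=; rewrite !in_itv/= /phi ltr_ndivlMr// ler_ndivrMr//;
   by move=> /andP[? ?]; apply/andP; split; lra.
rewrite !lebesgue_measure_itv/= !lte_fin ltr_nM2r ?invr_lt0// ltrD2r.
case: ifPn => _; last by rewrite mule0.
by rewrite -!EFinB -EFinM ltr0_norm//; congr EFin; field; rewrite lt_eqF.
Qed.

Lemma measurable_affine_rV (c : R) v :
  measurable_fun setT (fun x : 'rV[R]_D => c *: x + v).
Proof.
apply: measurable_fun_rV => i.
rewrite (_ : (fun x => _) = (fun x : 'rV[R]_D => c * x ord0 i + v ord0 i)); last first.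
  by apply/funext => x; rewrite !mxE.
apply: measurable_funD => //; apply: measurable_funM => //.
exact: measurable_coord_rV.
Qed.

Lemma lebesgue_rV_affine (c : R) v A : c != 0 -> measurable A ->
  mu [set x | A (c *: x + v)] = ((`|c| ^- D)%:E * mu A)%E.
Proof.
move=> c0 mA; have mphi := measurable_affine_rV c v.
have c0' : 0 <= `|c| ^+ D by rewrite exprn_ge0.
have := @lebesgue_rV_unique (mscale (NngNum c0') (pushforward mu (fun x : 'rV[R]_D => c *: x + v))) _ A mA.
rewrite /mscale /pushforward /= => <-; last first.
  move=> B mB; rewrite /mscale /= /pushforward.
  rewrite [X in mu X](_ : _ = rbox (fun i => [set t | B i (c * t + v ord0 i)])); last first.
    by apply/seteqP; split => x /= h i; have := h i; rewrite !mxE.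
  rewrite lebesgue_rbox; last first.
    move=> i; rewrite -[X in measurable X]setTI.
    have mf : measurable_fun setT (fun t : R => c * t + v ord0 i).
      by apply: measurable_funD => //; exact: measurable_funM.
    exact: mf.
  rewrite (eq_bigr (fun i => `|c|^-1%:E * lebesgue_measure (B i))%E); last first.
    by move=> i _; exact: lebesgue_measure_affine.
  rewrite big_split/= prodEFin prodr_const card_ord muleA -EFinM.
  by rewrite exprVn divff ?mul1e// expf_neq0// normr_eq0.
by rewrite muleA -EFinM mulVf ?mul1e// expf_neq0// normr_eq0.
Qed.

Section affine_integral.
Variables (c : R) (v : 'rV[R]_D) (f : 'rV[R]_D -> R).
Hypothesis c0 : c != 0.
Let phi (x : 'rV[R]_D) := c *: x + v.
Let mphi : measurable_fun setT phi := measurable_affine_rV c v.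
Let k0 : 0 <= `|c| ^- D. Proof. by rewrite invr_ge0 exprn_ge0. Qed.

Lemma ge0_integral_affine_rV (h : 'rV[R]_D -> \bar R) : measurable_fun setT h ->
  (forall x, 0 <= h x)%E ->
  (\int[mu]_x h (c *: x + v)%R = (`|c| ^- D)%:E * \int[mu]_x h x)%E.
Proof.
move=> mh h0.
have -> : (\int[mu]_x h (c *: x + v)%R = \int[pushforward mu phi]_x h x)%E.
  by rewrite (ge0_integral_pushforward mphi)//= preimage_setT.
rewrite (@eq_measure_integral _ _ _ _ (mscale (NngNum k0) mu)).
  by rewrite ge0_integral_mscale.
by move=> A mA _; exact: lebesgue_rV_affine.
Qed.

Lemma integrable_affine_rV : mu.-integrable setT (EFin \o f) ->
  mu.-integrable setT (fun x => (f (c *: x + v))%:E).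
Proof.
move=> /integrableP[mf fi]; apply/integrableP; split.
  exact: (measurableT_comp mf mphi).
rewrite (ge0_integral_affine_rV (h := fun x => `|(f x)%:E|%E))//.
  by rewrite lte_mul_pinfty// lee_fin.
exact: measurableT_comp.
Qed.

Lemma Rintegral_affine_rV : mu.-integrable setT (EFin \o f) ->
  \int[mu]_x f (c *: x + v) = `|c| ^- D * \int[mu]_x f x.
Proof.
move=> fi; rewrite /Rintegral.
have [mf _] := integrableP _ _ _ fi.
have mp := measurable_funepos mf; have mn := measurable_funeneg mf.
have ip := integrable_funepos measurableT fi.
have ineg := integrable_funeneg measurableT fi.
rewrite [in LHS]integralE [in RHS]integralE.
rewrite [X in fine (X - _) = _](_ : _ = (`|c| ^- D)%:E * \int[mu]_x (EFin \o f)^\+ x)%E; last first.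
  by rewrite -ge0_integral_affine_rV//; apply: eq_integral => x _; rewrite !funeposE.
rewrite [X in fine (_ - X) = _](_ : _ = (`|c| ^- D)%:E * \int[mu]_x (EFin \o f)^\- x)%E; last first.
  by rewrite -ge0_integral_affine_rV//; apply: eq_integral => x _; rewrite !funenegE.
have fp := integrable_fin_num measurableT ip.
have fn := integrable_fin_num measurableT ineg.
rewrite -[X in _ = _ * X]/(fine (\int[mu]_x (EFin \o f)^\+ x - \int[mu]_x (EFin \o f)^\- x)).
by rewrite -(fineK fp) -(fineK fn) -!EFinM -!EFinB /= mulrBr.
Qed.

End affine_integral.

Lemma bounded_lebesgue_rV_lty A : bounded_set A -> measurable A -> (mu A < +oo)%E.
Proof.
move=> [M [Mr bA]] mA; set N := `|M| + 1.
have MN : M < N by rewrite /N (le_lt_trans (ler_norm _))// ltrDl.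
apply: (le_lt_trans _ (lebesgue_rbox_itv_lty (- N) N)).
apply: le_measure; rewrite ?inE//; first by apply: measurable_rbox => i; exact: measurable_itv.
move=> x Ax i /=; rewrite in_itv/= -ler_norml.
exact: le_trans (coord_ler_norm _ _) (bA _ MN _ Ax).
Qed.

Lemma open_lebesgue_rV_gt0 U : open U -> U !=set0 -> (0 < mu U)%E.
Proof.
move=> oU [x Ux].
have /nbhs_ballP[e /= e0 eU] : nbhs x U by exact: open_nbhs_nbhs.
apply: (@lt_le_trans _ _ (mu (rbox (fun i => ball (x ord0 i) e)))).
  rewrite lebesgue_rbox; last by move=> i; rewrite ball_itv; exact: measurable_itv.
  rewrite (eq_bigr (fun=> (e *+ 2)%:E)); last by move=> i _; rewrite lebesgue_measure_ball// ltW.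
  by rewrite prodEFin lte_fin prodr_gt0// => i _; rewrite mulrn_wgt0.
apply: le_measure; rewrite ?inE.
- by apply: measurable_rbox => i; rewrite ball_itv; exact: measurable_itv.
- exact: measurable_open_rV.
- by move=> y ye; apply: eU; split => // i j; rewrite ord1.
Qed.

End measure_rV.

(** * Test functions *)

Section calculus.
Context {R : realType} {D : nat}.
Local Notation V := 'rV[R]_D.
Local Notation mu := (@lebesgue_rV R D).
Local Notation e_ i := (delta_mx ord0 i : V).
Implicit Types (f g phi psi : V -> R) (x y v : V).

Lemma continuous_addR f g : continuous f -> continuous g -> continuous (fun x => f x + g x).
Proof. by move=> cf cg x; exact: cvgD (cf x) (cg x). Qed.

Lemma continuous_mulR f g : continuous f -> continuous g -> continuous (fun x => f x * g x).
Proof. by move=> cf cg x; exact: cvgM (cf x) (cg x). Qed.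

Lemma continuous_cstR (a : R) : continuous (fun _ : V => a).
Proof. exact: cst_continuous. Qed.

Lemma continuous_scaleR (a : R) f : continuous f -> continuous (fun x => a * f x).
Proof. by move=> cf; apply: continuous_mulR => //; exact: continuous_cstR. Qed.

(** Together with [is_derive_line0] this reduces directional derivatives to one real variable, where
    the chain rule, the mean value theorem and differentiation under the integral are available. *)
Lemma is_derive_line f x v t d : is_derive (x + t *: v) v f d ->
  is_derive t 1 (fun s : R => f (x + s *: v)) d.
Proof.
have E : (fun h : R => h^-1 *: (f (h *: v + (x + t *: v)) - f (x + t *: v))) =
    (fun h : R => h^-1 *: ((fun s : R => f (x + s *: v)) (h *: 1%R + t) - f (x + t *: v))).
  apply/funext => h; congr (_ *: (f _ - _)); rewrite scaler1 scalerDl addrCA; congr (_ + _); by rewrite addrC.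
move=> [ex de]; split; first by rewrite /derivable -E.
by rewrite -de /derive -E.
Qed.

Lemma is_derive_line0 f x v d : is_derive (0 : R) 1 (fun s : R => f (x + s *: v)) d ->
  is_derive x v f d.
Proof.
have E : (fun h : R => h^-1 *: (f (h *: v + x) - f x)) =
    (fun h : R => h^-1 *: ((fun s : R => f (x + s *: v)) (h *: 1%R + 0) - f (x + 0 *: v))).
  by apply/funext => h; rewrite scaler1 addr0 scale0r addr0 [_ + x]addrC.
move=> [ex de]; split; first by rewrite /derivable E.
by rewrite -de /derive E.
Qed.

Lemma is_derive_linR f g x v (a b df dg : R) : is_derive x v f df -> is_derive x v g dg ->
  is_derive x v (fun y => a * f y + b * g y) (a * df + b * dg).
Proof. by move=> fd gd; exact: is_deriveD (is_deriveZ a fd) (is_deriveZ b gd). Qed.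

Lemma is_derive_mulR f g x v (df dg : R) : is_derive x v f df -> is_derive x v g dg ->
  is_derive x v (fun y => f y * g y) (df * g x + f x * dg).
Proof.
move=> fd gd; have H := is_deriveM fd gd; apply: (is_derive_eq H).
by rewrite /GRing.scale/= addrC (mulrC _ df).
Qed.

Lemma is_derive_compR (h : R -> R) f x v (dh df : R) : is_derive x v f df ->
  is_derive (f x) 1 h dh -> is_derive x v (fun y => h (f y)) (dh * df).
Proof.
move=> fd hd; apply: is_derive_line0.
have fd' : is_derive (0 : R) 1 (fun s : R => f (x + s *: v)) df.
  by apply: is_derive_line; rewrite scale0r addr0.
have hd' : is_derive (f (x + (0 : R) *: v)) 1 h dh by rewrite scale0r addr0.
have := is_derive1_comp hd' fd'; exact.
Qed.

Lemma is_derive_coord (i j : 'I_D) x :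
  is_derive x (e_ i) (fun y : V => y ord0 j) (i == j)%:R.
Proof.
apply: is_derive_line0.
rewrite [X in is_derive _ _ X _](_ : _ = (fun s : R => x ord0 j + (i == j)%:R * s)); last first.
  by apply/funext => s; rewrite !mxE eqxx /= eq_sym mulrC.
have H := is_deriveD (is_derive_cst (x ord0 j) (0 : R) (1 : R))
  (is_deriveZ (i == j)%:R (is_derive_id (0 : R) (1 : R))).
by apply: (is_derive_eq H); rewrite add0r /GRing.scale/= mulr1.
Qed.

Lemma bounded_supp_integrable f (K M : R) : measurable_fun [set: V] f ->
  (forall x, `|f x| <= K) -> (forall x, M < `|x| -> f x = 0) ->
  mu.-integrable setT (EFin \o f).
Proof.
move=> mf fK fM.
pose B := rbox (fun=> `[- M, M]%classic) : set V.
have mB : measurable B by apply: measurable_rbox => i; exact: measurable_itv.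
apply: (@eq_integrable _ _ _ _ _ measurableT ((EFin \o f) \_ B)) => [x _|].
  rewrite patchE; case: ifPn => //= xB; rewrite fM//.
  rewrite ltNge; apply: contra xB => xM; rewrite inE => i /=.
  by rewrite in_itv/= -ler_norml (le_trans (coord_ler_norm _ _)).
apply/(integrable_mkcond _ mB); apply: measurable_bounded_integrable => //.
- exact: lebesgue_rbox_itv_lty.
- exact: measurable_funTS.
- exists K; split; first by rewrite num_real.
  by move=> k Kk x _; rewrite /= (le_trans (fK x))// ltW.
Qed.

Lemma derive_vanish f v x : (\forall y \near x, f y = 0) -> 'D_v f x = 0.
Proof.
move=> f0; have [->|v0] := eqVneq v 0; first by rewrite derive0.
by rewrite (near_eq_derive _ (g := cst 0))// derive_cst.
Qed.

Lemma open_norm_gt (M : R) : open [set x : V | M < `|x|].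
Proof.
have -> : [set x : V | M < `|x|] = Num.norm @^-1` [set r : R | M < r] by [].
by apply: open_comp; [move=> x _; exact: norm_continuous|exact: open_gt].
Qed.

Lemma is_derive_bounded_supp f g v (M : R) :
  (forall x, is_derive x v f (g x)) -> (forall x, M < `|x| -> f x = 0) ->
  forall x, M < `|x| -> g x = 0.
Proof.
move=> fg fM x Mx; have [_ <-] := fg x; apply: derive_vanish.
by apply: (@filterS _ _ _ [set x : V | M < `|x|]) => //; apply: open_nbhs_nbhs; split => //; exact: open_norm_gt.
Qed.

Lemma Cc_bounded f (M : R) : continuous f -> (forall x, M < `|x| -> f x = 0) ->
  exists2 K, 0 <= K & forall x, `|f x| <= K.
Proof.
move=> cf fM.
pose B := [set x : V | `|x| <= `|M|].
have cB : compact B.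
  apply: bounded_closed_compact.
    by exists `|M|; split => // k /ltW Mk x /= /le_trans; exact.
  have -> : B = Num.norm @^-1` [set r : R | r <= `|M|] by [].
  by apply: closed_comp; [move=> x _; exact: norm_continuous|exact: closed_le].
have B0 : B !=set0 by exists 0; rewrite /B /= normr0.
have cnf : {within B, continuous (fun x => `|f x|)}.
  apply: continuous_subspaceT => x.
  by apply: (@continuous_comp _ _ _ f Num.norm); [exact: cf|exact: norm_continuous].
have [c cB' Hc] := EVT_max_rV B0 cB cnf.
exists `|f c| => // x; have [xM|xM] := leP `|x| `|M|; first by apply: Hc; rewrite inE.
by rewrite fM ?normr0// (le_lt_trans (ler_norm _)).
Qed.

Lemma Cc_integrable f (M : R) : continuous f -> (forall x, M < `|x| -> f x = 0) ->
  mu.-integrable setT (EFin \o f).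
Proof.
move=> cf fM; have [K _ fK] := Cc_bounded cf fM.
exact: bounded_supp_integrable (continuous_measurable_rV cf) fK fM.
Qed.

Lemma integrable_shift f v : mu.-integrable setT (EFin \o f) ->
  mu.-integrable setT (fun x => (f (x + v))%:E).
Proof.
move=> fi; have := integrable_affine_rV v (oner_neq0 R) fi.
by under eq_fun do rewrite scale1r.
Qed.

Lemma Rintegral_shift f v : mu.-integrable setT (EFin \o f) ->
  \int[mu]_x f (x + v) = \int[mu]_x f x.
Proof.
move=> fi; rewrite -[RHS]mul1r.
have -> : 1 = `|1 : R| ^- D by rewrite normr1 expr1n invr1.
by rewrite -(Rintegral_affine_rV v)//; apply: eq_Rintegral => x _; rewrite scale1r.
Qed.

(* Translation invariance makes t |-> \int f (x + t v) constant. *)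
Lemma Rintegral_derive0 f g v (M K : R) : continuous f ->
  (forall x, is_derive x v f (g x)) -> (forall x, M < `|x| -> f x = 0) ->
  (forall x, `|g x| <= K) -> \int[mu]_x g x = 0.
Proof.
move=> cf fg fM gK.
have K0 : 0 <= K by exact: le_trans (gK 0).
(* For |t| < 1 all translates of f vanish outside the cube B of half-side N. The integral over B is
   then the full one, and the constant K is an integrable bound for the derivatives. *)
pose N := M + `|v|.
pose F (t : R) (x : V) := f (x + t *: v).
pose B := rbox (fun=> `[- N, N]%classic) : set V.
have mB : measurable B by apply: measurable_rbox => i; exact: measurable_itv.
have dF (t : R) (x : V) : is_derive t 1 (F ^~ x) (g (x + t *: v)) by exact: is_derive_line.
have outB t x : `]-1, 1[%classic t -> ~ B x -> M < `|x + t *: v|.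
  move=> /=; rewrite in_itv/= => tI xB; rewrite ltNge; apply/negP => xM; apply: xB => i /=.
  rewrite in_itv/= -ler_norml (le_trans (coord_ler_norm _ _))//.
  rewrite -(addrK (t *: v) x) (le_trans (ler_normB _ _))// lerD// normrZ.
  by rewrite ler_piMl// ltW// ltr_norml.
have iF t : mu.-integrable setT (EFin \o F t).
  exact: integrable_shift (Cc_integrable cf fM).
have FB t : `]-1, 1[%classic t -> \int[mu]_(x in B) F t x = \int[mu]_x f x.
  move=> tI; rewrite Rintegral_mkcond -(Rintegral_shift (t *: v) (Cc_integrable cf fM)).
  apply: eq_Rintegral => x _; rewrite patchE; case: ifPn => // xB.
  by rewrite fM//; apply: outB => //; rewrite notin_setE in xB.
have I0 : `]-1, 1[%classic (0 : R) by rewrite /= in_itv/= oppr_lt0 ltr01.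
have icst : mu.-integrable B (EFin \o cst K).
  apply: measurable_bounded_integrable => //; first exact: lebesgue_rbox_itv_lty.
  by exists K; split; [rewrite num_real|move=> k Kk x _; rewrite /= ger0_norm// ltW].
have := @cvg_differentiation_under_integral R _ _ mu F B mB 0 (-1) 1 I0 _ _ (cst K) (fun=> K0) _ _.
move=> /(_ (fun t _ => integrableS measurableT mB (@subsetT _ _) (iF t))).
move=> /(_ (fun t x _ _ => @ex_derive _ _ _ _ _ _ _ (dF t x))).
move=> /(_ icst).
have -> : (fun h => h^-1 *: (\int[mu]_(y in B) F (h + 0) y - \int[mu]_(y in B) F 0 y)) =
   (fun h => h^-1 *: (\int[mu]_(y in B) F h y - \int[mu]_x f x)).
  by apply/funext => h; rewrite addr0 (FB 0).
have ub t x : `]-1, 1[%classic t -> B x -> `|partial1of2 F t x| <= cst K x.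
  by move=> _ _; rewrite partial1of2E; have [_ ->] := dF t x; exact: gK.
move=> /(_ ub) H.
have {H} : (0 : R) @[h --> (0:R)^'] --> \int[mu]_(y in B) partial1of2 F 0 y.
  apply: cvg_trans H; apply: near_eq_cvg.
  exists 1 => //= h /=; rewrite sub0r normrN => h1 h0.
  by rewrite FB ?subrr ?scaler0//= in_itv/= -ltr_norml.
move/cvg_lim => /(_ (@Rhausdorff R)); rewrite lim_cst; last exact: Rhausdorff.
move=> E; rewrite [RHS]E Rintegral_mkcond [RHS]Rintegral_mkcond; apply: eq_Rintegral => x _ /=.
rewrite !patchE in_setT; case: ifPn => [_|xB].
  by rewrite partial1of2E; have [_ ->] := dF 0 x; rewrite scale0r addr0.
rewrite (is_derive_bounded_supp fg fM)//.
by rewrite -[x]addr0 -(scale0r v); apply: outB => //; rewrite notin_setE in xB.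
Qed.

Lemma test_vanish (O : set V) phi x : test_function O phi -> ~ O x ->
  \forall y \near x, phi y = 0.
Proof.
move=> [_ _ sO] xO; have : nbhs x (~` fsupport phi).
  by apply: open_nbhs_nbhs; split; [rewrite openC; exact: closed_closure|move/sO].
apply: filterS => y ynS; apply/eqP; apply: contra_notT ynS => y0.
exact: subset_closure.
Qed.

Lemma test_out (O : set V) phi x : test_function O phi -> ~ O x -> phi x = 0.
Proof. by move=> tp xO; have := nbhs_singleton (test_vanish tp xO). Qed.

Lemma test_partial_out (O : set V) phi i x : test_function O phi -> ~ O x ->
  partial i phi x = 0.
Proof. by move=> tp xO; apply: derive_vanish; exact: test_vanish tp xO. Qed.

Lemma test_bounded_supp (O : set V) phi : test_function O phi ->
  exists M : R, forall x, M < `|x| -> phi x = 0.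
Proof.
move=> [_ /compact_bounded[M [Mr bM]] _]; exists (M + 1) => x Mx.
apply/eqP; apply: contraTT Mx => x0; rewrite -leNgt; apply: bM; first by rewrite ltrDl.
exact: subset_closure.
Qed.

Lemma smooth_continuous phi : smooth phi -> continuous phi.
Proof. by move=> /(_ [::])[]. Qed.

Lemma smooth_is_derive phi i x : smooth phi -> is_derive x (e_ i) phi (partial i phi x).
Proof. by move=> /(_ [::])[_ /(_ i x)] d; split. Qed.

Lemma smooth_partial phi i : smooth phi -> smooth (partial i phi).
Proof. by move=> sp s; have := sp (rcons s i); rewrite foldr_rcons. Qed.

Lemma smooth_partial_continuous phi i : smooth phi -> continuous (partial i phi).
Proof. by move=> /(smooth_partial i)/smooth_continuous. Qed.

(** A class stable under [partial] contains every iterated partial derivative of its members, so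
    smoothness can be proved without a formula for them. *)
Lemma smooth_class (P : (V -> R) -> Prop) :
  (forall f, P f -> continuous f /\ forall i x, derivable f x (e_ i)) ->
  (forall f i, P f -> P (partial i f)) -> forall f, P f -> smooth f.
Proof.
move=> Pc Pd f Pf s; apply: Pc; elim: s => //= i s; exact: Pd.
Qed.

Lemma smooth_lin (a b : R) phi psi : smooth phi -> smooth psi ->
  smooth (fun x => a * phi x + b * psi x).
Proof.
move=> sp sq.
pose P f := exists g h, [/\ smooth g, smooth h & f = (fun x => a * g x + b * h x)].
apply: (@smooth_class P); last by exists phi, psi.
- move=> f [g [h [sg sh ->]]]; split.
    by apply: continuous_addR; apply: continuous_scaleR; exact: smooth_continuous.
  move=> i x.
  exact: (@ex_derive _ _ _ _ _ _ _ (is_derive_linR a b (smooth_is_derive i x sg) (smooth_is_derive i x sh))).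
- move=> f i [g [h [sg sh ->]]]; exists (partial i g), (partial i h); split.
  + exact: smooth_partial.
  + exact: smooth_partial.
  + apply/funext => x.
    by have [_] := is_derive_linR a b (smooth_is_derive i x sg) (smooth_is_derive i x sh).
Qed.

Lemma partial_lin (a b : R) phi psi i x : smooth phi -> smooth psi ->
  partial i (fun x => a * phi x + b * psi x) x = a * partial i phi x + b * partial i psi x.
Proof.
move=> sp sq.
by have [_] := is_derive_linR a b (smooth_is_derive i x sp) (smooth_is_derive i x sq).
Qed.

Lemma fsupport_lin (a b : R) phi psi :
  fsupport (fun x => a * phi x + b * psi x) `<=` fsupport phi `|` fsupport psi.
Proof.
rewrite /fsupport -closureU; apply: closure_subset => x /=.
have [->|p0 _] := eqVneq (phi x) 0; last by left.
by rewrite mulr0 add0r => h; right; apply: contra_neq h => ->; rewrite mulr0.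
Qed.

Lemma test_lin (O : set V) (a b : R) phi psi : test_function O phi ->
  test_function O psi -> test_function O (fun x => a * phi x + b * psi x).
Proof.
move=> [sp cp pO] [sq cq qO]; split; first exact: smooth_lin.
- apply: (subclosed_compact _ (compactU cp cq)) (@fsupport_lin _ _ _ _).
  exact: closed_closure.
- by move=> x /fsupport_lin[/pO|/qO].
Qed.

Lemma test0 (O : set V) : test_function O (fun=> 0).
Proof.
split.
- apply: (@smooth_class (eq^~ (fun=> 0))) => //.
    move=> f ->; split; first exact: continuous_cstR.
    by move=> i x; exact: derivable_cst.
  by move=> f i ->; apply/funext => x; rewrite /partial derive_cst.
- rewrite /fsupport (_ : [set x | _] = set0) ?closure0; first exact: compact0.
  by apply/seteqP; split => // x /=; rewrite eqxx.
- rewrite /fsupport (_ : [set x | _] = set0) ?closure0//.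
  by apply/seteqP; split => // x /=; rewrite eqxx.
Qed.

Lemma test_partial_supp (O : set V) phi i (M : R) : test_function O phi ->
  (forall x, M < `|x| -> phi x = 0) -> forall x, M < `|x| -> partial i phi x = 0.
Proof.
by move=> [sp _ _]; apply: is_derive_bounded_supp => x; exact: smooth_is_derive.
Qed.

(* f need not be smooth, which allows compositions such as sqrt (phi^2 + eta^2). *)
Lemma Rintegral_by_parts (f df w dw : V -> R) v (M : R) :
  continuous f -> continuous df -> continuous w -> continuous dw ->
  (forall x, is_derive x v f (df x)) -> (forall x, is_derive x v w (dw x)) ->
  (forall x, M < `|x| -> f x = 0) ->
  \int[mu]_x (df x * w x) = - \int[mu]_x (f x * dw x).
Proof.
move=> cf cdf cw cdw fd wd fM.
have dfM := is_derive_bounded_supp fd fM.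
have c1 : continuous (fun x => df x * w x) by exact: continuous_mulR.
have c2 : continuous (fun x => f x * dw x) by exact: continuous_mulR.
have i1 := Cc_integrable c1 (fun x Mx => etrans (congr1 (fun t => t * w x) (dfM x Mx)) (mul0r _)).
have i2 := Cc_integrable c2 (fun x Mx => etrans (congr1 (fun t => t * dw x) (fM x Mx)) (mul0r _)).
apply/eqP; rewrite -addr_eq0 -RintegralD//; apply/eqP.
have c3 : continuous (fun x => df x * w x + f x * dw x) by exact: continuous_addR.
have M3 x : M < `|x| -> df x * w x + f x * dw x = 0.
  by move=> Mx; rewrite dfM// fM// !mul0r addr0.
have [K _ HK] := Cc_bounded c3 M3.
apply: (@Rintegral_derive0 (fun x => f x * w x) _ v M K) => //.
- exact: continuous_mulR.
- by move=> x; exact: is_derive_mulR.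
- by move=> x Mx; rewrite fM// mul0r.
Qed.

End calculus.

(** * Mollification *)

Section exp_bump.
Context {R : realType}.
Implicit Types (s t : R) (k : nat).

(* The family is closed under differentiation: bump_exp k has derivative
   - k * bump_exp k.+1 + bump_exp k.+2. *)
Definition bump_exp k s : R := if 0 < s then s ^- k * expR (- s^-1) else 0.

Lemma bump_exp_ge0 k s : 0 <= bump_exp k s.
Proof.
rewrite /bump_exp; case: ifPn => // s0; apply: mulr_ge0; last exact: expR_ge0.
by rewrite invr_ge0 exprn_ge0// ltW.
Qed.

Lemma bump_exp_gt0 k s : 0 < s -> 0 < bump_exp k s.
Proof.
by move=> s0; rewrite /bump_exp s0 mulr_gt0 ?expR_gt0// invr_gt0 exprn_gt0.
Qed.

Lemma bump_exp_le0 k s : s <= 0 -> bump_exp k s = 0.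
Proof. by move=> s0; rewrite /bump_exp ltNge s0. Qed.

(** The inequality t <= exp t at t = 1 / (s (k + 1)), raised to the power k + 1. A linear bound for
    every k settles the derivative at 0: the difference quotient of [bump_exp k] there is
    [bump_exp k.+1], which tends to 0. *)
Lemma bump_exp_bound k s : bump_exp k s <= k.+1%:R ^+ k.+1 * `|s|.
Proof.
rewrite /bump_exp; case: ifPn => [s0|_]; last by rewrite mulr_ge0// exprn_ge0.
rewrite gtr0_norm// -ler_pdivrMr// mulrAC -exprVn -exprSr.
rewrite expRN -ler_pdivlMr ?invr_gt0 ?expR_gt0// invrK.
have k0 : 0 < k.+1%:R :> R by [].
have -> : expR s^-1 = expR (s^-1 / k.+1%:R) ^+ k.+1.
  by rewrite -expRM_natl mulrC divfK// gt_eqF.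
rewrite -exprMn lerXn2r ?nnegrE ?mulr_ge0 ?expR_ge0 ?invr_ge0 ?(ltW s0)//.
rewrite mulrC -ler_pdivrMr//.
by apply: le_trans (expR_ge1Dx _); rewrite lerDr.
Qed.

Lemma is_derive_bump_exp k s :
  is_derive s 1 (bump_exp k) (- k%:R * bump_exp k.+1 s + bump_exp k.+2 s).
Proof.
have [s0|s0|->] := ltgtP s 0.
- rewrite !bump_exp_le0 ?ltW// mulr0 addr0.
  apply: (@near_eq_is_derive _ _ _ (cst 0)).
  have : \forall t \near s, t < 0 by exact: lt_nbhsl.
  by apply: filterS => t t0; rewrite bump_exp_le0 ?ltW.
- apply: (@near_eq_is_derive _ _ _ (fun t : R => t ^- k * expR (- t^-1))).
    have : \forall t \near s, 0 < t by exact: lt_nbhsr.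
    by apply: filterS => t t0; rewrite /bump_exp t0.
  have sN0 : s != 0 by rewrite gt_eqF.
  have dV : is_derive s 1 (fun t : R => t^-1) (- s ^- 2).
    have H := @is_deriveV R id s 1 1 sN0 (is_derive_id s 1).
    by apply: (is_derive_eq H); rewrite /GRing.scale/= mulr1.
  have dX : is_derive s 1 (fun t : R => t ^+ k) (k%:R * s ^+ k.-1).
    have H := is_deriveX k (is_derive_id s (1:R)).
    rewrite [X in is_derive _ _ X _](_ : _ = id ^+ k); last by apply/funext => t; rewrite exprfctE.
    by apply: (is_derive_eq H); rewrite /GRing.scale/= mulr1.
  have dVX : is_derive s 1 (fun t : R => t ^- k) (- (s ^+ k) ^- 2 * (k%:R * s ^+ k.-1)).
    by have := @is_deriveV R (fun t => t ^+ k) s _ 1 (expf_neq0 k sN0) dX.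
  have dN : is_derive s 1 (fun t : R => - t^-1) (s ^- 2).
    have H := is_deriveN dV; by apply: (is_derive_eq H); rewrite opprK.
  have dE : is_derive s 1 (fun t : R => expR (- t^-1)) (expR (- s^-1) * s ^- 2).
    exact: (@is_derive1_comp R expR (fun t : R => - t^-1) s _ _ (is_derive_expR _) dN).
  have H := is_deriveM dVX dE; apply: (is_derive_eq H).
  rewrite /bump_exp s0 /GRing.scale/=.
  case: k {dX dVX H} => [|k] /=.
    by rewrite !expr0 mulr0n !(mul0r, oppr0, mulr0) invr1; ring.
  by rewrite !exprS; field; rewrite expf_neq0.
- rewrite !bump_exp_le0// mulr0 addr0.
  have lim0 : (fun h : R => h^-1 *: (bump_exp k (h *: 1 + 0) - bump_exp k 0)) x @[x --> (0:R)^'] --> (0 : R).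
    apply/cvgr0Pnorm_le => e e0.
    set C : R := k.+2%:R ^+ k.+2.
    have C0 : 0 < C by rewrite exprn_gt0.
    exists (e / C); first exact: divr_gt0.
    move=> h /=; rewrite sub0r normrN => he h0.
    rewrite scaler1 addr0 (bump_exp_le0 _ (lexx 0)) subr0 /GRing.scale/=.
    have -> : h^-1 * bump_exp k h = bump_exp k.+1 h.
      by rewrite /bump_exp; case: ifPn => // _; rewrite ?mulr0// mulrA -!exprVn -exprS.
    rewrite ger0_norm ?bump_exp_ge0// (le_trans (bump_exp_bound _ _))// -/C.
    by rewrite mulrC -ler_pdivlMr// ltW.
  split; first by apply/cvg_ex; exists 0.
  by apply: cvg_lim => //; exact: Rhausdorff.
Qed.

Lemma bump_exp_continuous k : continuous (bump_exp k).
Proof.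
move=> s; apply: differentiable_continuous; apply/derivable1_diffP.
by have [] := is_derive_bump_exp k s.
Qed.

End exp_bump.

Section bump_class.
Context {R : realType} {D : nat}.
Local Notation V := 'rV[R]_D.
Local Notation mu := (@lebesgue_rV R D).
Local Notation e_ i := (delta_mx ord0 i : V).
Implicit Types (f g phi : V -> R) (x y v : V).

(** Generated so that differentiation stays inside the class by induction on the construction;
    kernels taken from it can be differentiated any number of times. *)
Inductive bump_class : (V -> R) -> Prop :=
| bump_cst c : bump_class (fun=> c)
| bump_base k a c i : bump_class (fun x => bump_exp k (a + c * x ord0 i))
| bump_mul f g : bump_class f -> bump_class g -> bump_class (fun x => f x * g x)
| bump_lin a b f g : bump_class f -> bump_class g -> bump_class (fun x => a * f x + b * g x).

Lemma continuous_coordR i : continuous (fun x : V => x ord0 i).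
Proof. exact: coord_continuous. Qed.

Lemma bump_class_continuous f : bump_class f -> continuous f.
Proof.
elim => [c|k a c i|g h _ cg _ ch|a b g h _ cg _ ch].
- exact: continuous_cstR.
- move=> x; apply: (@continuous_comp _ _ _ (fun y : V => a + c * y ord0 i)); last exact: bump_exp_continuous.
  by apply: continuous_addR; [exact: continuous_cstR|apply: continuous_scaleR; exact: continuous_coordR].
- exact: continuous_mulR.
- by apply: continuous_addR; apply: continuous_scaleR.
Qed.

Lemma is_derive_affine_coord (a c : R) i x v :
  is_derive x v (fun y : V => a + c * y ord0 i) (c * v ord0 i).
Proof.
apply: is_derive_line0.
rewrite [X in is_derive _ _ X _](_ : _ = (fun s : R => (a + c * x ord0 i) + (c * v ord0 i) * s)); last first.
  by apply/funext => s; rewrite !mxE; ring.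
have H := is_deriveD (is_derive_cst (a + c * x ord0 i) (0 : R) (1 : R))
  (is_deriveZ (c * v ord0 i) (is_derive_id (0 : R) (1 : R))).
by apply: (is_derive_eq H); rewrite add0r /GRing.scale/= mulr1.
Qed.

Lemma bump_class_derive f : bump_class f -> exists df : 'I_D -> V -> R,
  (forall i, bump_class (df i)) /\
  (forall x v, is_derive x v f (\sum_i v ord0 i * df i x)).
Proof.
elim => [c|k a c j|g h bg [dg [bdg dgE]] bh [dh [bdh dhE]]|a b g h bg [dg [bdg dgE]] bh [dh [bdh dhE]]].
- exists (fun _ _ => 0); split=> [i|x v]; first exact: bump_cst.
  by rewrite big1; [exact: is_derive_cst|move=> i _; rewrite mulr0].
- pose d x := - k%:R * bump_exp k.+1 (a + c * x ord0 j) + 1 * bump_exp k.+2 (a + c * x ord0 j).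
  (* The summand [0 * 0] and the factor 1 in [d] give the derivative the shape that [bump_lin]
     produces. *)
  exists (fun i x => (if i == j then c else 0) * d x + 0 * 0); split=> [i|x v].
    exact: (bump_lin _ 0 (bump_lin (- k%:R) 1 (bump_base k.+1 a c j) (bump_base k.+2 a c j)) (bump_cst 0)).
  have := is_derive_compR (is_derive_affine_coord a c j x v) (is_derive_bump_exp k (a + c * x ord0 j)).
  move/is_derive_eq; apply; rewrite (bigD1 j)//= eqxx big1 ?addr0; last first.
    by move=> i /negbTE ->; ring.
  by rewrite /d; ring.
- exists (fun i x => 1 * (dg i x * h x) + 1 * (g x * dh i x)); split=> [i|x v].
    by apply: bump_lin; exact: bump_mul.
  have := is_derive_mulR (dgE x v) (dhE x v); move/is_derive_eq; apply.
  by rewrite mulr_suml mulr_sumr -big_split/=; apply: eq_bigr => i _; ring.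
- exists (fun i x => a * dg i x + b * dh i x); split=> [i|x v].
    exact: bump_lin.
  have := is_derive_linR a b (dgE x v) (dhE x v); move/is_derive_eq; apply.
  by rewrite !mulr_sumr -big_split/=; apply: eq_bigr => i _; ring.
Qed.

Lemma bump_prod (I : Type) (r : seq I) (F : I -> V -> R) :
  (forall i, bump_class (F i)) -> bump_class (fun x => \prod_(i <- r) F i x).
Proof.
move=> bF; elim: r => [|i r ih].
  by under eq_fun do rewrite big_nil; exact: bump_cst.
by under eq_fun do rewrite big_cons; exact: bump_mul.
Qed.

(** Each factor is positive exactly when |x_i| < e, so this is a bump adapted to the sup norm, whose
    balls are cubes. *)
Definition mbump (e : R) x : R :=
  \prod_(i < D) (bump_exp 0 (1 + e^-1 * x ord0 i) * bump_exp 0 (1 + - e^-1 * x ord0 i)).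

Lemma mbumpP e : bump_class (mbump e).
Proof. by apply: bump_prod => i; apply: bump_mul; exact: bump_base. Qed.

Lemma bump_ge0 e x : 0 <= mbump e x.
Proof. by apply: prodr_ge0 => i _; rewrite mulr_ge0// bump_exp_ge0. Qed.

Lemma bump_even e x : mbump e (- x) = mbump e x.
Proof. by apply: eq_bigr => i _; rewrite mulrC !mxE !mulNr !mulrN opprK. Qed.

Lemma bump_supp e x : 0 < e -> e < `|x| -> mbump e x = 0.
Proof.
move=> e0 ex.
have [i xi] : exists i, e < `|x ord0 i|.
  apply/not_existsP => H; have : `|x| <= e.
    by apply: rV_norm_ler; [exact: ltW|move=> i; rewrite leNgt; apply/negP/H].
  by rewrite leNgt ex.
rewrite /mbump (bigD1 i)//=; apply/eqP; rewrite mulf_eq0; apply/orP; left.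
have [x0|x0] := leP 0 (x ord0 i).
  rewrite mulrC bump_exp_le0 ?mul0r// mulNr subr_le0 mulrC ler_pdivlMr// mul1r.
  by rewrite ltW// -(ger0_norm x0).
rewrite bump_exp_le0 ?mul0r// -lerBrDl sub0r mulrC ler_pdivrMr// mulN1r.
by rewrite lerNr ltW// -(ltr0_norm x0).
Qed.

Lemma bump_gt0 e x : 0 < e -> `|x| < e -> 0 < mbump e x.
Proof.
move=> e0 xe; apply: prodr_gt0 => i _.
have : `|x ord0 i / e| < 1.
  by rewrite normrM normfV (gtr0_norm e0) ltr_pdivrMr// mul1r (le_lt_trans (coord_ler_norm _ _)).
rewrite ltr_norml => /andP[h1 h2].
by rewrite mulr_gt0 ?bump_exp_gt0// ?mulNr mulrC; lra.
Qed.

End bump_class.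

(** * Convolution of a compactly supported function with a smooth kernel *)

Section convolution.
Context {R : realType} {D : nat}.
Local Notation V := 'rV[R]_D.
Local Notation mu := (@lebesgue_rV R D).
Local Notation e_ i := (delta_mx ord0 i : V).
Implicit Types (f g phi : V -> R) (x y v : V).

(** Only x is confined to K, while y may leave it. Heine-Cantor on K alone would not give this, so
    the radius comes from a covering by neighbourhoods in the whole space. *)
Lemma compact_uniformly_continuous f (K : set V) (e : R) : compact K -> continuous f -> 0 < e ->
  exists2 d, 0 < d & forall x y, K x -> `|x - y| < d -> `|f x - f y| < e.
Proof.
move=> cK cf e0.
have := (compact_near_coveringP K).1 cK R (0%R^'+)
  (fun d x => forall y, `|x - y| < d -> `|f x - f y| < e).
case => [x Kx|].
  have /cvgrPdist_lt/(_ (e / 2)) := cf x.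
  rewrite divr_gt0// => /(_ isT)/nbhs_ballP[r /= r0 rf].
  exists (ball x (r / 2), [set d | d < r / 2]).
    split => /=; first by apply: nbhsx_ballx; rewrite divr_gt0.
    by apply: nbhs_right_lt; rewrite divr_gt0.
  move=> [z d] /= [xz dr] y zy.
  rewrite -ball_normE /= in xz.
  have h1 : `|f x - f z| < e / 2.
    by apply: rf; rewrite -ball_normE /= (lt_le_trans xz)// ler_pdivrMr// ler_pMr// ler1n.
  have h2 : `|f x - f y| < e / 2.
    apply: rf; rewrite -ball_normE /= (splitr r) -(subrKA z).
    by rewrite (le_lt_trans (ler_normD _ _))// ltrD// (lt_trans zy).
  rewrite -(subrKA (f x)) (le_lt_trans (ler_normD _ _))// (splitr e) ltrD//.
  by rewrite distrC.
move=> /= d d0 H.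
exists (d / 2); first by rewrite divr_gt0.
move=> x y Kx; apply: (H (d / 2)) => //=.
- rewrite sub0r normrN gtr0_norm ?divr_gt0// ltr_pdivrMr// ltr_pMr// ltr1n //.
- by rewrite divr_gt0.
Qed.

Lemma lipschitz_continuousR f (C : R) : 0 <= C -> (forall x y, `|f x - f y| <= C * `|x - y|) ->
  continuous f.
Proof.
move=> C0 lip x; apply/(@cvgrPdist_lt _ _ _ (nbhs x)) => eps eps0.
have c0 : 0 < C + 1 by rewrite ltr_wpDl.
apply/nbhs_ballP; exists (eps / (C + 1)) => /=; first exact: divr_gt0.
move=> z; rewrite -ball_normE /= ltr_pdivlMr// => xz.
by rewrite (le_lt_trans (lip _ _))// (le_lt_trans _ xz)// mulrC ler_wpM2l// lerDl.
Qed.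

Definition convolve f phi x := \int[mu]_y (f y * phi (x - y)).

Section conv_theory.
Variables (f : V -> R) (M : R).
Hypotheses (cf : continuous f) (fM : forall x, M < `|x| -> f x = 0).

Lemma conv_integrable phi x : continuous phi -> mu.-integrable setT (fun y => (f y * phi (x - y))%:E).
Proof.
move=> cp; apply: (@Cc_integrable _ _ (fun y => f y * phi (x - y)) M).
  apply: continuous_mulR => // y; apply: (@continuous_comp _ _ _ (fun y => x - y)); last exact: cp.
  by apply: (@continuousB _ _ _ (fun=> x) id); [exact: cst_continuous|exact: cvg_id].
by move=> y My; rewrite fM// mul0r.
Qed.

Lemma is_derive_conv phi dphi v K : continuous phi -> (forall x, is_derive x v phi (dphi x)) ->
  (forall x, `|dphi x| <= K) -> forall x, is_derive x v (convolve f phi) (convolve f dphi x).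
Proof.
move=> cp dp dK x; apply: is_derive_line0.
pose F (t : R) (y : V) := f y * phi (x + t *: v - y).
have dF (t : R) (y : V) : is_derive t 1 (F ^~ y) (f y * dphi (x + t *: v - y)).
  have H : is_derive t 1 (fun s : R => phi (x - y + s *: v)) (dphi (x + t *: v - y)).
    by apply: is_derive_line; rewrite addrAC.
  rewrite [X in is_derive _ _ X _](_ : _ = (f y) *: (fun s : R => phi (x - y + s *: v))).
    exact: is_deriveZ.
  by apply/funext => s; rewrite /F addrAC.
have iF t : mu.-integrable setT (EFin \o F t) by exact: conv_integrable.
have I0 : `]-1, 1[%classic (0 : R) by rewrite /= in_itv/= oppr_lt0 ltr01.
have K0 : 0 <= K by exact: le_trans (dK 0).
have cG : continuous (fun y => `|f y| * K).
  apply: continuous_mulR; last exact: continuous_cstR.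
  by move=> y; apply: (@continuous_comp _ _ _ f Num.norm); [exact: cf|exact: norm_continuous].
have iG : mu.-integrable setT (EFin \o (fun y => `|f y| * K)).
  by apply: (Cc_integrable cG (M := M)) => y My; rewrite fM// normr0 mul0r.
have G0 y : 0 <= `|f y| * K by rewrite mulr_ge0.
have ub t y : `]-1, 1[%classic t -> setT y -> `|partial1of2 F t y| <= `|f y| * K.
  by move=> _ _; rewrite partial1of2E; have [_ ->] := dF t y; rewrite normrM ler_wpM2l.
have := @cvg_differentiation_under_integral R _ _ mu F setT measurableT 0 (-1) 1 I0
  (fun t _ => iF t) (fun t y _ _ => @ex_derive _ _ _ _ _ _ _ (dF t y)) _ G0 iG ub.
have -> : \int[mu]_y partial1of2 F 0 y = convolve f dphi x.
  apply: eq_Rintegral => y _; rewrite partial1of2E; have [_ ->] := dF 0 y.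
  by rewrite scale0r addr0.
have -> : (fun h : R => h^-1 *: (\int[mu]_y F (h + 0) y - \int[mu]_y F 0 y)) =
   (fun h : R => h^-1 *: (convolve f phi (x + (h *: 1 + 0) *: v) - convolve f phi (x + (0 : R) *: v))).
  by apply/funext => h; rewrite scaler1.
move=> H; split; first by apply/cvg_ex; exists (convolve f dphi x).
by apply: cvg_lim => //; exact: Rhausdorff.
Qed.

Lemma conv_lin phi psi (a b : R) x : continuous phi -> continuous psi ->
  convolve f (fun y => a * phi y + b * psi y) x = a * convolve f phi x + b * convolve f psi x.
Proof.
move=> cp cq; rewrite /convolve -!RintegralZl//; try exact: conv_integrable.
rewrite -RintegralD//.
- by apply: eq_Rintegral => y _; ring.
- by apply: (integrableZl measurableT a (conv_integrable x cp)).
- by apply: (integrableZl measurableT b (conv_integrable x cq)).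
Qed.

Lemma conv_sum (I : Type) (r : seq I) (F : I -> V -> R) (c : I -> R) x :
  (forall i, continuous (F i)) ->
  convolve f (fun y => \sum_(i <- r) c i * F i y) x = \sum_(i <- r) c i * convolve f (F i) x.
Proof.
move=> cF; have cS s : continuous (fun y => \sum_(i <- s) c i * F i y).
  elim: s => [|i s ih]; first by under eq_fun do rewrite big_nil; exact: continuous_cstR.
  by under eq_fun do rewrite big_cons; apply: continuous_addR => //; exact: continuous_scaleR.
elim: r => [|i r ih].
  rewrite big_nil /convolve; under eq_Rintegral do rewrite big_nil mulr0.
  by rewrite Rintegral_cst// mul0r.
rewrite big_cons -ih -[X in _ = _ + X]mul1r -conv_lin//.
by apply: eq_Rintegral => y _; rewrite big_cons mul1r.
Qed.

Lemma bump_class_lipschitz phi (e : R) : bump_class phi -> (forall x, e < `|x| -> phi x = 0) ->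
  exists2 L, 0 <= L & forall x y, `|phi x - phi y| <= L * `|x - y|.
Proof.
move=> bp pe; have [dp [bdp dpE]] := bump_class_derive bp.
have dpi i x : is_derive x (e_ i) phi (dp i x).
  have := dpE x (e_ i); rewrite (bigD1 i)//= big1 ?addr0 ?mxE ?eqxx ?mul1r// => j ji.
  by rewrite mxE eqxx (negbTE ji) mul0r.
have /choice[K HK] (i : 'I_D) : exists K, 0 <= K /\ forall x, `|dp i x| <= K.
  have [K K0 HK] := Cc_bounded (bump_class_continuous (bdp i)) (is_derive_bounded_supp (dpi i) pe).
  by exists K.
exists (\sum_i K i); first by apply: sumr_ge0 => i _; have [] := HK i.
move=> x y.
have dl (t : R) : is_derive t 1 (fun s : R => phi (y + s *: (x - y)))
    (\sum_i (x - y) ord0 i * dp i (y + t *: (x - y))).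
  exact: is_derive_line.
have [|c _] := @MVT_segment R _ _ 0 1 ler01 (fun t _ => dl t).
  by apply: derivable_within_continuous => t _; have [] := dl t.
rewrite scale1r scale0r addr0 subrKC subr0 mulr1 => ->.
rewrite (le_trans (ler_norm_sum _ _ _))// mulr_suml; apply: ler_sum => i _.
by rewrite normrM mulrC ler_pM//; [have [_] := HK i; exact|exact: coord_ler_norm].
Qed.

Lemma conv_continuous phi (e : R) : bump_class phi -> (forall x, e < `|x| -> phi x = 0) ->
  continuous (convolve f phi).
Proof.
move=> bp pe; have [L L0 HL] := bump_class_lipschitz bp pe.
have cp := bump_class_continuous bp.
have ifn : mu.-integrable setT (fun y => `|f y|%:E) := integrable_norm (Cc_integrable cf fM).
pose I := \int[mu]_y `|f y|.
have I0 : 0 <= I by apply: Rintegral_ge0.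
have lip x z : `|convolve f phi x - convolve f phi z| <= (L * I) * `|x - z|.
  rewrite /convolve -RintegralB//; try exact: conv_integrable.
  have iB : mu.-integrable setT (fun y => (f y * phi (x - y) - f y * phi (z - y))%:E).
    by apply: (integrableB measurableT (conv_integrable x cp) (conv_integrable z cp)).
  rewrite (le_trans (le_normr_Rintegral _ iB))//.
  rewrite mulrAC -RintegralZl//; apply: le_Rintegral => //.
  - exact: (integrable_norm iB).
  - exact: (integrableZl measurableT (L * `|x - z|) ifn).
  - move=> y _; rewrite -mulrBr normrM mulrC ler_wpM2r//.
    by have := HL (x - y) (z - y); rewrite opprB subrKA.
exact: lipschitz_continuousR (mulr_ge0 L0 I0) lip.
Qed.

(** Derivatives fall on the kernel, and the kernels in [bump_class] that vanish beyond e are stable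
    under them, as [smooth_class] requires. *)
Lemma conv_smooth phi (e : R) : bump_class phi -> (forall x, e < `|x| -> phi x = 0) ->
  smooth (convolve f phi).
Proof.
move=> bp pe.
pose P g := exists phi, [/\ bump_class phi, forall x, e < `|x| -> phi x = 0 & g = convolve f phi].
have key psi i : bump_class psi -> (forall x, e < `|x| -> psi x = 0) ->
    exists dpsi, [/\ bump_class dpsi, forall x, e < `|x| -> dpsi x = 0 &
    forall x, is_derive x (e_ i) (convolve f psi) (convolve f dpsi x)].
  move=> bq qe; have [dp [bdp dpE]] := bump_class_derive bq.
  have dpi x : is_derive x (e_ i) psi (dp i x).
    have := dpE x (e_ i); rewrite (bigD1 i)//= big1 ?addr0 ?mxE ?eqxx ?mul1r// => j ji.
    by rewrite mxE eqxx (negbTE ji) mul0r.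
  have ds := is_derive_bounded_supp dpi qe.
  have [K _ HK] := Cc_bounded (bump_class_continuous (bdp i)) ds.
  exists (dp i); split => //.
  exact: is_derive_conv (bump_class_continuous bq) dpi HK.
apply: (@smooth_class _ _ P); last by exists phi.
- move=> g [psi [bq qe ->]]; split; first exact: conv_continuous bq qe.
  by move=> i x; have [dq [_ _ /(_ x)[]]] := key psi i bq qe.
- move=> g i [psi [bq qe ->]]; have [dq [bdq dqe H]] := key psi i bq qe.
  by exists dq; split => //; apply/funext => x; have [_] := H x.
Qed.

End conv_theory.
End convolution.

Section euclidean.
Context {R : realType} {D : nat}.
Local Notation V := 'rV[R]_D.
Implicit Types (x y z : V) (a b : R).

Lemma dotrVC x y : dotrV x y = dotrV y x.
Proof. by apply: eq_bigr => i _; rewrite mulrC. Qed.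

Lemma dotrVDl x y z : dotrV (x + y) z = dotrV x z + dotrV y z.
Proof. by rewrite /dotrV -big_split/=; apply: eq_bigr => i _; rewrite mxE mulrDl. Qed.

Lemma dotrVDr x y z : dotrV z (x + y) = dotrV z x + dotrV z y.
Proof. by rewrite dotrVC dotrVDl !(dotrVC z). Qed.

Lemma dotrVZl a x y : dotrV (a *: x) y = a * dotrV x y.
Proof. by rewrite /dotrV mulr_sumr; apply: eq_bigr => i _; rewrite mxE mulrA. Qed.

Lemma dotrVZr a x y : dotrV x (a *: y) = a * dotrV x y.
Proof. by rewrite dotrVC dotrVZl dotrVC. Qed.

Lemma dotrVNl x y : dotrV (- x) y = - dotrV x y.
Proof. by rewrite -scaleN1r dotrVZl mulN1r. Qed.

Lemma dotrVNr x y : dotrV x (- y) = - dotrV x y.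
Proof. by rewrite dotrVC dotrVNl dotrVC. Qed.

Lemma dotrV0l x : dotrV 0 x = 0.
Proof. by rewrite -(scale0r x) dotrVZl mul0r. Qed.

Lemma dotrV_ge0 x : 0 <= dotrV x x.
Proof. by apply: sumr_ge0 => i _; rewrite -expr2 sqr_ge0. Qed.

Lemma enorm_ge0 x : 0 <= enorm x.
Proof. exact: sqrtr_ge0. Qed.

Lemma sqr_enorm x : enorm x ^+ 2 = dotrV x x.
Proof. by rewrite sqr_sqrtr// dotrV_ge0. Qed.

Lemma coord_ler_enorm x i : `|x ord0 i| <= enorm x.
Proof.
rewrite -sqrtr_sqr ler_wsqrtr// /dotrV (bigD1 i)//= -expr2 lerDl.
by apply: sumr_ge0 => j _; rewrite -expr2 sqr_ge0.
Qed.

Lemma norm_ler_enorm x : `|x| <= enorm x.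
Proof. by apply: rV_norm_ler; [exact: enorm_ge0|exact: coord_ler_enorm]. Qed.

Lemma enorm_eq0 x : enorm x = 0 -> x = 0.
Proof. by move=> x0; apply/eqP; rewrite -normr_le0 -x0 norm_ler_enorm. Qed.

Lemma enorm0 : enorm (0 : V) = 0.
Proof. by rewrite /enorm dotrV0l sqrtr0. Qed.

Lemma enormZ a x : enorm (a *: x) = `|a| * enorm x.
Proof.
by rewrite /enorm dotrVZl dotrVZr mulrA -expr2 sqrtrM ?sqr_ge0// sqrtr_sqr.
Qed.

Lemma enormN x : enorm (- x) = enorm x.
Proof. by rewrite -scaleN1r enormZ normrN1 mul1r. Qed.

Lemma enormB x y : enorm (x - y) = enorm (y - x).
Proof. by rewrite -enormN opprB. Qed.

Lemma cauchy_schwarz x y : dotrV x y <= enorm x * enorm y.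
Proof.
have [y0|y0] := eqVneq (enorm y) 0.
  by rewrite y0 mulr0 (enorm_eq0 y0) dotrVC dotrV0l.
have yp : 0 < enorm y by rewrite lt_neqAle eq_sym y0 enorm_ge0.
have := dotrV_ge0 (enorm y ^+ 2 *: x - dotrV x y *: y).
rewrite !(dotrVDl, dotrVDr, dotrVNl, dotrVNr, dotrVZl, dotrVZr) (dotrVC y x) -!sqr_enorm.
set n := enorm y; set m := enorm x; set d := dotrV x y.
have m0 : 0 <= m := enorm_ge0 x.
move=> h; have {}h : 0 <= n ^+ 2 * ((m * n) ^+ 2 - d ^+ 2) by move: h; congr (0 <= _); ring.
rewrite pmulr_rge0 ?exprn_gt0// subr_ge0 in h.
rewrite (le_trans (ler_norm _))// -ler_sqr ?nnegrE ?mulr_ge0 ?enorm_ge0//.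
by rewrite real_normK// num_real.
Qed.

Lemma norm_dotrV x y : `|dotrV x y| <= enorm x * enorm y.
Proof.
rewrite ler_norml cauchy_schwarz andbT lerNl -dotrVNl.
by rewrite (le_trans (cauchy_schwarz _ _))// enormN.
Qed.

Lemma ler_enormD x y : enorm (x + y) <= enorm x + enorm y.
Proof.
rewrite -ler_sqr ?nnegrE ?addr_ge0 ?enorm_ge0// sqr_enorm !(dotrVDl, dotrVDr) (dotrVC y x).
rewrite sqrrD -!sqr_enorm -mulr_natl.
have := cauchy_schwarz x y; lra.
Qed.

Lemma ler_dist_enorm x y : `|enorm x - enorm y| <= enorm (x - y).
Proof.
have h (u w : V) : enorm u - enorm w <= enorm (u - w).
  by rewrite lerBlDr (le_trans _ (ler_enormD _ _))// subrK.
by rewrite ler_norml h andbT lerNl opprB enormB h.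
Qed.

Lemma enorm_ler_sum x : enorm x <= \sum_i `|x ord0 i|.
Proof.
rewrite -ler_sqr ?nnegrE ?enorm_ge0 ?sumr_ge0// sqr_enorm expr2 mulr_suml.
apply: ler_sum => i _; rewrite (le_trans (ler_norm _))// normrM ler_wpM2l//.
by rewrite (bigD1 i)//= lerDl sumr_ge0.
Qed.

Lemma enorm_ler_norm x : enorm x <= D%:R * `|x|.
Proof.
rewrite (le_trans (enorm_ler_sum x))// (le_trans (ler_sum _ (fun i _ => coord_ler_norm x i)))//.
by rewrite sumr_const card_ord mulr_natl.
Qed.

Lemma enorm_continuous : continuous (enorm : V -> R).
Proof.
apply: (@lipschitz_continuousR _ _ _ D%:R) => // x y.
exact: le_trans (ler_dist_enorm x y) (enorm_ler_norm _).
Qed.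

End euclidean.

Section mollify.
Context {R : realType} {D : nat}.
Local Notation V := 'rV[R]_D.
Local Notation mu := (@lebesgue_rV R D).
Local Notation e_ i := (delta_mx ord0 i : V).
Implicit Types (f g phi : V -> R) (x y v : V).

Definition grad f x : V := \row_i partial i f x.

Lemma is_derive_norm_le f x v (d C e : R) : 0 < e -> is_derive x v f d ->
  (forall t : R, `|t| < e -> `|f (x + t *: v) - f x| <= C * `|t|) -> `|d| <= C.
Proof.
move=> e0 [ex de] H; rewrite -de.
have cv : (fun h : R => h^-1 *: (f (h *: v + x) - f x)) @ (0:R)^' --> ('D_v f x : R) by exact: ex.
have cn : `|h^-1 *: (f (h *: v + x) - f x)| @[h --> (0:R)^'] --> `|'D_v f x|.
  by apply: (@cvg_norm R R).
apply: (cvgr_to_le cn); exists e => // h /= he h0; have {}he : `|h| < e by move: he; rewrite /ball_ /= sub0r normrN.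
rewrite normrM normfV mulrC ler_pdivrMr ?normr_gt0// [_ + x]addrC; exact: H.
Qed.

Lemma bump_integral_gt0 (e : R) : 0 < e -> 0 < \int[mu]_x (mbump e x : R).
Proof.
move=> e0; have cb := bump_class_continuous (mbumpP e : bump_class (mbump e : V -> R)).
have ib := Cc_integrable cb (fun x => @bump_supp R D e x e0).
have b0 : 0 < mbump e (0 : V) :> R by apply: bump_gt0; rewrite ?normr0.
pose U := [set x : V | mbump e (0 : V) / 2 < (mbump e x : R)].
have oU : open U.
  have -> : U = mbump e @^-1` [set r : R | mbump e (0 : V) / 2 < r] by [].
  by apply: open_comp; [move=> x _; exact: cb|exact: open_gt].
have U0 : U !=set0 by exists 0; rewrite /U /= ltr_pdivrMr// ltr_pMr// ltr1n.
have mU := measurable_open_rV oU.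
have bU : bounded_set U.
  exists e; split => [|r er x]; first by rewrite num_real.
  rewrite /U /= => h; rewrite leNgt; apply/negP => rx.
  rewrite (bump_supp e0 (lt_trans er rx)) in h.
  by have := divr_ge0 (ltW b0) (ler0n R 2); rewrite leNgt h.
have mUoo := bounded_lebesgue_rV_lty bU mU.
have mU0 := open_lebesgue_rV_gt0 oU U0.
have fU0 : 0 < fine (mu U) by rewrite fine_gt0// mU0 mUoo.
apply: (@lt_le_trans _ _ (\int[mu]_(x in U) (mbump e (0 : V) / 2))).
  by rewrite Rintegral_cst// mulr_gt0// divr_gt0.
rewrite Rintegral_mkcond; apply: le_Rintegral => //.
  have := @measurable_bounded_integrable _ _ _ mu (fun=> mbump e (0:V) / 2) U mU mUoo.
  move=> /(_ (measurable_cst _)) H.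
  have : mu.-integrable U (EFin \o (fun=> mbump e (0 : V) / 2 : R)).
    apply: H; exists (mbump e (0 : V) / 2); split; first by rewrite num_real.
    by move=> r hr x _ /=; rewrite ger0_norm ?(ltW hr)// divr_ge0// ltW.
  by move/(integrable_mkcond _ mU); rewrite restrict_EFin.
move=> x _; rewrite patchE; case: ifPn => [|_]; last exact: bump_ge0.
by rewrite inE /U /= => /ltW.
Qed.

Variables (f : V -> R) (M e : R).
Hypotheses (cf : continuous f) (fM : forall x, M < `|x| -> f x = 0) (e0 : 0 < e).
Let cb : continuous (mbump e : V -> R) := bump_class_continuous (mbumpP e).
Let be : forall x : V, e < `|x| -> mbump e x = 0 := fun x => @bump_supp R D e x e0.
Let I := \int[mu]_x (mbump e x : R).
Let I0 : 0 < I := bump_integral_gt0 e0.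

Definition mollify x := I^-1 * convolve f (mbump e) x.

Lemma bump_integral_translate x : \int[mu]_y (mbump e (x - y) : R) = I.
Proof.
have ib := Cc_integrable cb be.
rewrite /I -(Rintegral_shift (- x) ib); apply: eq_Rintegral => y _.
by rewrite -opprB bump_even.
Qed.

Lemma bump_translate_integrable x : mu.-integrable setT (fun y => (mbump e (x - y))%:E).
Proof.
have := integrable_shift (- x) (Cc_integrable cb be).
by apply: eq_integrable => // y _; rewrite /= -opprB bump_even.
Qed.

Lemma mollify_ge x (a : R) : (forall y, `|x - y| <= e -> a <= f y) -> a <= mollify x.
Proof.
move=> af; rewrite /mollify mulrC ler_pdivlMr// -(bump_integral_translate x).
have ib := bump_translate_integrable x.
rewrite -RintegralZl//; apply: le_Rintegral => //.
- exact: (integrableZl measurableT a ib).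
- exact: (conv_integrable cf fM).
- move=> y _; have [xy|xy] := leP `|x - y| e; first by rewrite ler_wpM2r ?bump_ge0// af.
  by rewrite be// !mulr0.
Qed.

Lemma mollify_smooth : smooth mollify.
Proof.
have s := conv_smooth cf fM (mbumpP e) be.
rewrite (_ : mollify = (fun x => I^-1 * convolve f (mbump e) x + 0 * convolve f (mbump e) x)).
  exact: smooth_lin.
by apply/funext => x; rewrite mul0r addr0.
Qed.

Lemma mollify_supp x : mollify x != 0 -> exists2 y, `|x - y| <= e & f y != 0.
Proof.
move=> mx; apply/not_exists2P => H; case/negP: mx; apply/eqP.
rewrite /mollify; suff -> : convolve f (mbump e) x = 0 by rewrite mulr0.
rewrite /convolve (eq_Rintegral _ (g := fun=> 0)); first by rewrite Rintegral_cst// mul0r.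
move=> y _; have [xy|xy] := leP `|x - y| e; last by rewrite be// mulr0.
have [->|fy] := eqVneq (f y) 0; first by rewrite mul0r.
by have [] := H y.
Qed.

(** Partial derivatives alone would not do: the gradient estimate differentiates in the direction of
    the gradient itself, so linearity in the direction v is needed. *)
Lemma mollify_derive x v : is_derive x v mollify (dotrV v (grad mollify x)).
Proof.
have [dp [bdp dpE]] := bump_class_derive (mbumpP e : bump_class (mbump e : V -> R)).
have cdp i := bump_class_continuous (bdp i).
have dpi i y : is_derive y (e_ i) (mbump e : V -> R) (dp i y).
  have := dpE y (e_ i); rewrite (bigD1 i)//= big1 ?addr0 ?mxE ?eqxx ?mul1r// => j ji.
  by rewrite mxE eqxx (negbTE ji) mul0r.
have ds (w : V) : continuous (fun y => \sum_i w ord0 i * dp i y).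
  elim: (index_enum _) => [|i s ih]; first by under eq_fun do rewrite big_nil; exact: continuous_cstR.
  by under eq_fun do rewrite big_cons; apply: continuous_addR => //; exact: continuous_scaleR.
have key (w y : V) : is_derive y w mollify (I^-1 * \sum_i w ord0 i * convolve f (dp i) y).
  have [K _ HK] := Cc_bounded (ds w) (is_derive_bounded_supp (dpE ^~ w) be).
  have H := is_derive_conv cf fM cb (dpE ^~ w) HK y.
  have H' := is_derive_linR I^-1 0 H H; rewrite mul0r addr0 in H'.
  rewrite -(conv_sum cf fM _ (fun i => w ord0 i) y cdp).
  apply: near_eq_is_derive H'; by near=> z; rewrite mul0r addr0.
have pE i : partial i mollify x = I^-1 * convolve f (dp i) x.
  have [_] := key (e_ i) x; rewrite /partial => ->; congr (_ * _).
  rewrite (bigD1 i)//= big1 ?addr0 ?mxE ?eqxx ?mul1r// => j ji.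
  by rewrite mxE eqxx (negbTE ji) mul0r.
have := key v x; move/is_derive_eq; apply.
rewrite mulr_sumr /dotrV; apply: eq_bigr => i _; rewrite mxE pE; ring.
Unshelve. all: by end_near. Qed.

(** The increment of the mollification is the average of the increments of f, with a non-negative
    weight of total mass 1 living within e of x. *)
Lemma mollify_lipschitz x v (K : R) :
  (forall y, `|x - y| <= e -> `|f (y + v) - f y| <= K) ->
  `|mollify (x + v) - mollify x| <= K.
Proof.
move=> HK; have iI : 0 <= I^-1 by rewrite invr_ge0 ltW.
rewrite /mollify -mulrBr normrM (ger0_norm iI) mulrC ler_pdivrMr//.
have K0 : 0 <= K by have := HK x; rewrite subrr normr0 => /(_ (ltW e0)); exact: le_trans.
have i1 : mu.-integrable setT (fun y => (f (y + v) * mbump e (x - y))%:E).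
  have := integrable_shift v (conv_integrable cf fM (x + v) cb).
  by apply: eq_integrable => // y _; rewrite /= opprD addrA addrAC addrK.
have i2 := conv_integrable cf fM x cb.
have -> : convolve f (mbump e) (x + v) = \int[mu]_y (f (y + v) * mbump e (x - y)).
  rewrite /convolve -(Rintegral_shift v (conv_integrable cf fM (x + v) cb)).
  by apply: eq_Rintegral => y _; rewrite opprD addrA addrAC addrK.
rewrite /convolve -RintegralB//.
have i3 := integrableB measurableT i1 i2.
rewrite (le_trans (le_normr_Rintegral _ i3))// -(bump_integral_translate x).
have ib := bump_translate_integrable x.
rewrite -RintegralZl//; apply: le_Rintegral => //.
- exact: (integrable_norm i3).
- exact: (integrableZl measurableT K ib).
- move=> y _; rewrite -mulrBl normrM (ger0_norm (bump_ge0 _ _)).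
  have [xy|xy] := leP `|x - y| e; first by rewrite ler_wpM2r ?bump_ge0// HK.
  by rewrite be// !mulr0.
Qed.

End mollify.

(** * Approximation of Lipschitz functions by test functions *)

Section test_approx.
Context {R : realType} {D : nat}.
Local Notation V := 'rV[R]_D.
Implicit Types (x y v : V).

(** Lowering F by e / 2 and cutting at 0 moves the support away from the boundary of O, which leaves
    room for mollification; mollifying costs at most another e / 2. The Lipschitz hypothesis is
    local, with any bound K of G on a ball, so the gradient is controlled by G at nearby points and
    hence by G x + e. *)
Lemma test_approx (O : set V) (F G : V -> R) (e : R) :
  bounded_set O -> continuous F -> continuous G ->
  (forall x, ~ O x -> F x = 0) -> (forall x, 0 <= F x) -> (forall x, 0 <= G x) ->
  (forall (x : V) (r K : R) (y z : V), (forall w : V, `|x - w| <= r -> G w <= K) ->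
     `|x - y| <= r -> `|x - z| <= r -> `|F y - F z| <= K * enorm (y - z)) ->
  0 < e -> exists2 phi, test_function O phi &
    (forall x, F x - e <= phi x) /\ (forall x, O x -> enorm (grad phi x) <= G x + e).
Proof.
move=> [M0 [M0r bO]] cF cG FO F0 G0 lip e0.
pose M := M0 + 1.
have OM x : O x -> `|x| <= M by apply: bO; rewrite ltrDl.
pose K := [set x : V | `|x| <= M].
have cK : compact K.
  apply: bounded_closed_compact; first by exists M; split; [rewrite num_real|move=> r /ltW Mr x /le_trans; exact].
  have -> : K = Num.norm @^-1` [set r : R | r <= M] by [].
  by apply: closed_comp; [move=> x _; exact: norm_continuous|exact: closed_le].
have h0 : 0 < e / 2 by rewrite divr_gt0.
have [d1 d10 H1] := compact_uniformly_continuous cK cF h0.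
have [d2 d20 H2] := compact_uniformly_continuous cK cG e0.
pose f x := Num.max (F x - e / 2) 0.
have cf : continuous f.
  move=> x; apply: (@continuous_max _ _ (fun x => F x - e / 2) (fun=> 0)); last exact: cst_continuous.
  by apply: (@continuousB _ _ _ F (fun=> e / 2)); [exact: cF|exact: cst_continuous].
have fO x : ~ O x -> f x = 0.
  by move=> /FO Fx; rewrite /f Fx max_r// sub0r oppr_le0 ltW.
have fM x : M < `|x| -> f x = 0.
  by move=> Mx; apply: fO => /OM; rewrite leNgt Mx.
(* A third, because two displacements of length d must stay within both moduli of continuity. *)
pose d := Num.min d1 d2 / 3.
have d0 : 0 < d by rewrite divr_gt0// lt_min d10.
have dd1 : d + d < d1.
  have : Num.min d1 d2 <= d1 by rewrite ge_min lexx.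
  by rewrite /d; lra.
have dd2 : d + d < d2.
  have : Num.min d1 d2 <= d2 by rewrite ge_min lexx orbT.
  by rewrite /d; lra.
have f0 x : 0 <= f x by rewrite le_max lexx orbT.
have ss : fsupport (mollify f d) `<=` O.
  move=> x /(_ (ball x d) (nbhsx_ballx _ _ d0))[z [/= mz xz]].
  have [y zy fy] := mollify_supp d0 mz.
  have Oy : O y by apply: contrapT => /fO y0; rewrite y0 eqxx in fy.
  have Fy : e / 2 < F y.
    rewrite ltNge; apply: contra fy => Fy; rewrite /f max_r// subr_le0//.
  rewrite -ball_normE /= in xz.
  have yx : `|y - x| < d1.
    rewrite distrC -(subrKA z) (le_lt_trans (ler_normD _ _))// (lt_trans _ dd1)//.
    exact: ltr_leD.
  have := H1 y x (OM _ Oy) yx.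
  rewrite ltr_distl => /andP[_ h]; apply: contrapT => /FO Fx.
  by move: h; rewrite Fx; lra.
exists (mollify f d); first split => //.
- exact: mollify_smooth cf fM d0.
- apply: bounded_closed_compact; last exact: closed_closure.
  by exists M0; split => // r Mr x /ss Ox; exact: bO.
split => x.
  have [Ox|/FO Fx] := pselect (O x); last first.
    apply: (@le_trans _ _ 0); first by rewrite Fx sub0r oppr_le0 ltW.
    by apply: (mollify_ge cf fM d0) => y _.
  apply: (mollify_ge cf fM d0) => y xy.
  have : `|F x - F y| < e / 2.
    by apply: H1; [exact: OM|rewrite (le_lt_trans xy)// (lt_trans _ dd1)// ltrDr].
  by rewrite ltr_distl => /andP[h1 h2]; rewrite le_max; apply/orP; left; lra.
move=> Ox; set v := grad _ _; set C := G x + e.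
have C0 : 0 <= C by rewrite addr_ge0// ltW.
have GC w : `|x - w| <= d + d -> G w <= C.
  move=> xw; have : `|G x - G w| < e by apply: H2; [exact: OM|exact: le_lt_trans dd2].
  by rewrite ltr_distl => /andP[h1 h2]; rewrite /C; lra.
(* In the direction v of the gradient the derivative is |v|^2, while the increments are at most C
   |v| |t|; dividing by |v| leaves |v| <= C. *)
have dv : is_derive x v (mollify f d) (dotrV v v) by exact: (mollify_derive cf fM d0).
pose r := d / (`|v| + 1).
have v1 : 0 < `|v| + 1 by rewrite ltr_wpDl.
have r0 : 0 < r by rewrite divr_gt0.
have := is_derive_norm_le (C := C * enorm v) r0 dv.
have -> : `|dotrV v v| = enorm v * enorm v by rewrite -expr2 sqr_enorm ger0_norm// dotrV_ge0.
move=> H; have {H} : enorm v * enorm v <= C * enorm v.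
  apply: H => t tr; apply: (mollify_lipschitz cf fM d0) => y xy.
  have tv : `|t *: v| <= d.
    rewrite normrZ; apply: (@le_trans _ _ (r * `|v|)); first by rewrite ler_wpM2r// ltW.
    by rewrite /r mulrAC ler_pdivrMr// ler_wpM2l ?(ltW d0)// lerDl.
  have ff a b : `|f a - f b| <= `|F a - F b|.
    rewrite /f; case: (leP (F a - e / 2) 0) => ha; case: (leP (F b - e / 2) 0) => hb.
    - by rewrite subrr normr0.
    - by rewrite sub0r normrN ger0_norm ?(ltW hb)// distrC (le_trans _ (ler_norm _))//; lra.
    - by rewrite subr0 ger0_norm ?(ltW ha)// (le_trans _ (ler_norm _))//; lra.
    - by rewrite opprB addrA subrK.
  rewrite (le_trans (ff _ _))//.
  have -> : C * enorm v * `|t| = C * enorm (y + t *: v - y).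
    by rewrite [y + _]addrC addrK enormZ -mulrA (mulrC `|t|).
  apply: (lip x (d + d)) => //.
    by rewrite opprD addrA (le_trans (ler_normB _ _))// lerD.
  by rewrite (le_trans xy)// lerDl ltW.
have [->//|v0] := eqVneq (enorm v) 0.
by rewrite ler_pM2r// lt_neqAle eq_sym v0 enorm_ge0.
Qed.

End test_approx.

(** * Spaces of p-integrable functions *)

Section powR_ineq.
Context {R : realType}.
Implicit Types (a b p q s t : R).

Lemma le_powR p a b : 0 <= p -> 0 <= a -> a <= b -> a `^ p <= b `^ p.
Proof.
by move=> p0 a0 ab; apply: ge0_ler_powR => //; rewrite nnegrE// (le_trans a0).
Qed.

Lemma powR_scaled p t x : 0 < t -> 0 <= x -> t * (x / t) `^ p = t `^ (1 - p) * x `^ p.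
Proof.
move=> t0 x0; rewrite powRM ?invr_ge0 ?(ltW t0)// mulrCA mulrC; congr (_ * _).
rewrite -powR_inv1 ?ltW// -powRrM mulN1r.
by rewrite powRD ?(gt_eqF t0) ?implybT// powRr1// ltW.
Qed.

Lemma powR_convex p t a b : 1 <= p -> 0 <= t <= 1 -> 0 <= a -> 0 <= b ->
  (t * a + (1 - t) * b) `^ p <= t * a `^ p + (1 - t) * b `^ p.
Proof.
move=> p1 /andP[t0 t1] a0 b0.
have aI : (a : R^o) \in (`[0, +oo[%classic : set R) by rewrite inE /= in_itv/= a0.
have bI : (b : R^o) \in (`[0, +oo[%classic : set R) by rewrite inE /= in_itv/= b0.
by have := @convex_powR R p p1 (Itv01 t0 t1) a b aI bI; rewrite !convRE.
Qed.

Lemma powR_add_le p a b : 0 < p -> 0 <= a -> 0 <= b ->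
  (a + b) `^ p <= 2 `^ p * (a `^ p + b `^ p).
Proof.
move=> p0 a0 b0; wlog ab : a b a0 b0 / a <= b => [H|].
  by have [/H|/ltW/H] := leP a b; [exact|rewrite addrC [X in _ * X]addrC; exact].
apply: (@le_trans _ _ ((2 * b) `^ p)).
  by apply: le_powR; [exact: ltW|exact: addr_ge0|lra].
by rewrite powRM// ler_wpM2l ?powR_ge0// lerDr powR_ge0.
Qed.

(* Convexity with the weight l such that l^(1 - p) = 1 + s. *)
Lemma powR_add_eps p s : 1 < p -> 0 < s -> exists2 C, 0 <= C &
  forall a b, 0 <= a -> 0 <= b -> (a + b) `^ p <= (1 + s) * a `^ p + C * b `^ p.
Proof.
move=> p1 s0.
pose l := (1 + s) `^ (- (p - 1)^-1).
have p10 : 0 < p - 1 by rewrite subr_gt0.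
have s1 : 1 < 1 + s by rewrite ltrDl.
have l0 : 0 < l by rewrite powR_gt0// (lt_trans ltr01).
have l1 : l < 1.
  rewrite /l powRN invf_lt1 ?powR_gt0 ?(lt_trans ltr01)//.
  have i0 : 0 < (p - 1)^-1 by rewrite invr_gt0.
  have := @gt0_ltr_powR R _ i0 1 (1 + s); rewrite powR1; apply => //; rewrite nnegrE ?ler01//.
  exact: ltW (lt_trans ltr01 s1).
have lE : l `^ (1 - p) = 1 + s.
  rewrite -powRrM -[1 - p]opprB mulrNN mulVf ?gt_eqF// powRr1// ltW// (lt_trans ltr01) //.
have m0 : 0 < 1 - l by rewrite subr_gt0.
exists ((1 - l) `^ (1 - p)); first exact: powR_ge0.
move=> a b a0 b0.
have lI : 0 <= l <= 1 by rewrite !ltW.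
have al : 0 <= a / l by rewrite divr_ge0// ltW.
have bl : 0 <= b / (1 - l) by rewrite divr_ge0// ltW.
have := powR_convex (ltW p1) lI al bl.
by rewrite !powR_scaled// lE [l * _]mulrCA divff ?gt_eqF// mulr1 [(1 - l) * _]mulrCA divff ?gt_eqF// mulr1.
Qed.

Lemma young_eps p q s : 0 < p -> 0 < q -> p^-1 + q^-1 = 1 -> 0 < s -> exists2 C, 0 <= C &
  forall a b, 0 <= a -> 0 <= b -> a * b <= C * a `^ p + s * b `^ q.
Proof.
move=> p0 q0 pq s0.
(* Young's inequality for a t and b / t, with t^-q = s; the remaining factor 1 / q is at most 1. *)
pose t := s `^ (- q^-1).
have t0 : 0 < t by rewrite powR_gt0.
exists (t `^ p / p); first by rewrite divr_ge0 ?powR_ge0 ?ltW.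
move=> a b a0 b0.
have := @conjugate_powR R (a * t) (b / t) p q.
rewrite mulrACA divff ?gt_eqF// mulr1 => /(_ _ _ p0 q0 pq)/le_trans; apply.
- by rewrite mulr_ge0// ltW.
- by rewrite divr_ge0// ltW.
rewrite powRM ?(ltW t0)// powRM ?invr_ge0 ?(ltW t0)//.
suff h : t^-1 `^ q / q <= s.
  apply: lerD; first by rewrite le_eqVlt; apply/orP; left; apply/eqP; ring.
  by rewrite -mulrA mulrC ler_wpM2r ?powR_ge0.
rewrite -powR_inv1 ?(ltW t0)// -powRrM mulN1r powRN -powRN /t -powRrM mulrNN mulVf ?gt_eqF//.
rewrite powRr1 ?(ltW s0)// ler_pdivrMr// ler_peMr ?(ltW s0)//.
have := ltW q0; rewrite -invr_ge0 => h.
by rewrite -invf_le1// -pq lerDr invr_ge0 ltW.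
Qed.

(** Either x <= t, or x / t > 1 is below its own p-th power. The free scale t makes one of the two
    terms small. *)
Lemma le_powR_scale p t x : 1 <= p -> 0 < t -> 0 <= x -> x <= t + t `^ (1 - p) * x `^ p.
Proof.
move=> p1 t0 x0; have [xt|tx] := leP x t; first by rewrite (le_trans xt)// lerDl mulr_ge0// powR_ge0.
apply: ler_wpDl; first exact: ltW.
have -> : t `^ (1 - p) * x `^ p = t * (x / t) `^ p.
  by rewrite powR_scaled.
rewrite -ler_pdivrMl// mulrC le1r_powR// ler_pdivlMr// mul1r ltW//.
Qed.

Lemma dist_le_arith (A N c s e : R) : 0 <= s -> s <= 1 -> 0 <= N -> 0 <= A ->
  s * (N + 1) <= e / 3 -> c <= 1 -> c <= e / 3 -> A <= (1 + s) * N + c ->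
  N <= (1 + s) * A + c -> `|N - A| <= e.
Proof.
move=> s0 s1 N0 A0 sN c1 c2 h1 h2.
have sN0 : s * N <= N by rewrite ler_piMl.
have h3 : A <= 2 * (N + 1) by lra.
have h4 : s * A <= s * (2 * (N + 1)) by rewrite ler_wpM2l.
by rewrite ler_norml; apply/andP; split; lra.
Qed.

End powR_ineq.

Section Lp.
Context {d} {T : measurableType d} {R : realType}.
Variables (mu : {measure set T -> \bar R}) (O : set T) (p : R).
Hypotheses (mO : measurable O) (p1 : 1 < p).
Implicit Types (f g w : T -> R).

Let p0 : 0 < p. Proof. exact: lt_trans p1. Qed.

(** Membership in L^q; [npow] below is the q-th power of the norm. Since no root is taken, the
    triangle inequality is replaced by [npow_le_add] and [npow_dist_eps]. *)
Definition pint (q : R) f := measurable_fun O f /\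
  mu.-integrable O (EFin \o (fun x => `|f x| `^ q)).
Definition npow (q : R) f := \int[mu]_(x in O) (`|f x| `^ q).

Lemma le_integrableR f g : measurable_fun O f -> (forall x, O x -> `|f x| <= g x) ->
  mu.-integrable O (EFin \o g) -> mu.-integrable O (EFin \o f).
Proof.
move=> mf fg ig; apply: (le_integrable mO _ _ ig).
  exact/measurable_EFinP.
by move=> x Ox /=; rewrite lee_fin (le_trans (fg x Ox))// ler_norm.
Qed.

Lemma integrableDR f g : mu.-integrable O (EFin \o f) -> mu.-integrable O (EFin \o g) ->
  mu.-integrable O (EFin \o (fun x => f x + g x)).
Proof. by move=> fi gi; exact: (integrableD mO fi gi). Qed.

Lemma integrableBR f g : mu.-integrable O (EFin \o f) -> mu.-integrable O (EFin \o g) ->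
  mu.-integrable O (EFin \o (fun x => f x - g x)).
Proof. by move=> fi gi; exact: (integrableB mO fi gi). Qed.

Lemma integrableZR (k : R) f : mu.-integrable O (EFin \o f) ->
  mu.-integrable O (EFin \o (fun x => k * f x)).
Proof. by move=> fi; exact: (integrableZl mO k fi). Qed.

Lemma integrable_measurableR f : mu.-integrable O (EFin \o f) -> measurable_fun O f.
Proof. by move=> /measurable_int/measurable_EFinP. Qed.

Lemma measurable_powR_norm q f : measurable_fun O f -> measurable_fun O (fun x => `|f x| `^ q).
Proof.
move=> mf; apply: (measurableT_comp (measurable_powR q)).
exact: measurableT_comp.
Qed.

Lemma npow_ge0 q f : 0 <= npow q f.
Proof. by apply: Rintegral_ge0 => x _; exact: powR_ge0. Qed.

Lemma pint_le q f g : 0 <= q -> measurable_fun O f -> (forall x, O x -> `|f x| <= `|g x|) ->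
  pint q g -> pint q f.
Proof.
move=> q0 mf fg [mg ig]; split => //; apply: le_integrableR ig.
  exact: measurable_powR_norm.
by move=> x Ox; rewrite ger0_norm ?powR_ge0// ge0_ler_powR ?nnegrE ?fg.
Qed.

Lemma pintD f g : pint p f -> pint p g -> pint p (fun x => f x + g x).
Proof.
move=> [mf fi] [mg gi]; have m := measurable_funD mf mg; split => //.
apply: (@le_integrableR _ (fun x => 2 `^ p * (`|f x| `^ p + `|g x| `^ p))).
- exact: measurable_powR_norm.
- move=> x _; rewrite ger0_norm ?powR_ge0//; apply: le_trans (powR_add_le _ _ _) => //.
  by apply: le_powR => //; [exact: ltW|exact: ler_normD].
- by apply: integrableZR; exact: integrableDR.
Qed.

Lemma pintZ (k : R) f : pint p f -> pint p (fun x => k * f x).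
Proof.
move=> [mf fi]; have m : measurable_fun O (fun x => k * f x) by apply: measurable_funM.
split => //; apply: (@le_integrableR _ (fun x => `|k| `^ p * `|f x| `^ p)).
- exact: measurable_powR_norm.
- by move=> x _; rewrite ger0_norm ?powR_ge0// normrM powRM.
- exact: integrableZR.
Qed.

Lemma pintB f g : pint p f -> pint p g -> pint p (fun x => f x - g x).
Proof.
move=> fi gi; have := pintD fi (pintZ (-1) gi).
by under eq_fun do rewrite mulN1r.
Qed.

Lemma pint_bounded f (K : R) : (mu O < +oo)%E -> measurable_fun O f ->
  (forall x, O x -> `|f x| <= K) -> pint p f.
Proof.
move=> muO mf fK; split => //; apply: measurable_bounded_integrable => //.
  exact: measurable_powR_norm.
exists (K `^ p); split; first by rewrite num_real.
move=> r Kr x Ox /=; rewrite ger0_norm ?powR_ge0// (le_trans _ (ltW Kr))//.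
by apply: le_powR => //; [exact: ltW|exact: fK].
Qed.

Lemma cst_integrableR (k : R) : (mu O < +oo)%E -> mu.-integrable O (EFin \o (fun=> k)).
Proof.
move=> muO; apply: measurable_bounded_integrable => //.
by exists `|k|; split; [rewrite num_real|move=> r kr x _ /=; exact: ltW].
Qed.

Lemma pint_integrable f : (mu O < +oo)%E -> pint p f -> mu.-integrable O (EFin \o f).
Proof.
move=> muO [mf fi]; apply: (@le_integrableR _ (fun x => 1 + 1 * `|f x| `^ p)) => //.
  by move=> x _; have := le_powR_scale (ltW p1) ltr01 (normr_ge0 (f x)); rewrite powR1.
by apply: integrableDR; [exact: cst_integrableR|exact: integrableZR].
Qed.

Lemma npow_le_add f g : pint p f -> pint p g ->
  npow p (fun x => f x + g x) <= 2 `^ p * (npow p f + npow p g).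
Proof.
move=> pf pg; have [m fgi] := pintD pf pg; have [mf fi] := pf; have [mg gi] := pg.
rewrite /npow -RintegralD// -RintegralZl//; last exact: integrableDR.
apply: le_Rintegral => //; first by apply: integrableZR; exact: integrableDR.
move=> x _; apply: le_trans (powR_add_le _ _ _) => //.
by apply: le_powR => //; [exact: ltW|exact: ler_normD].
Qed.

Section conjugate.
Variable q : R.
Hypotheses (q0 : 0 < q) (pq : p^-1 + q^-1 = 1).

Lemma pint_mul f w : pint p f -> pint q w -> mu.-integrable O (EFin \o (fun x => f x * w x)).
Proof.
move=> [mf fi] [mw wi].
apply: (@le_integrableR _ (fun x => p^-1 * `|f x| `^ p + q^-1 * `|w x| `^ q)).
- exact: measurable_funM.
- by move=> x _; rewrite normrM !(mulrC _^-1); exact: conjugate_powR.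
- by apply: integrableDR; exact: integrableZR.
Qed.

Lemma pint_cvg_mul (fn : nat -> T -> R) f w : (forall n, pint p (fn n)) -> pint p f -> pint q w ->
  npow p (fun x => fn n x - f x) @[n --> \oo] --> 0 ->
  \int[mu]_(x in O) (fn n x * w x) @[n --> \oo] --> \int[mu]_(x in O) (f x * w x).
Proof.
move=> pfn pf pw cv.
have [mw wi] := pw.
apply/cvgrPdist_le => e e0.
have N0 := npow_ge0 q w.
(* With this weight in Young's inequality the term in w uses up half of e; the constant C is then
   fixed, and the convergence pays the other half. *)
pose s := e / 2 / (npow q w + 1).
have s0 : 0 < s by rewrite !divr_gt0// ltr_wpDl.
have [C C0 HC] := young_eps p0 q0 pq s0.
have e1 : 0 < e / 2 / (C + 1) by rewrite !divr_gt0// ltr_wpDl.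
have := cv; move/cvgrPdist_le => /(_ _ e1); apply: filterS => n.
rewrite sub0r normrN ger0_norm ?npow_ge0// => Hn.
have pd := pintB (pfn n) pf; have [md di] := pd.
have i1 := pint_mul pf pw; have i2 := pint_mul (pfn n) pw; have i3 := pint_mul pd pw.
rewrite distrC -RintegralB//.
rewrite (eq_Rintegral _ (g := fun x => (fn n x - f x) * w x)); last by move=> x _; rewrite mulrBl.
rewrite (le_trans (le_normr_Rintegral _ i3))//.
apply: (@le_trans _ _ (\int[mu]_(x in O) (C * `|fn n x - f x| `^ p + s * `|w x| `^ q))).
  apply: le_Rintegral => //.
  - exact: (integrable_norm i3).
  - by apply: integrableDR; exact: integrableZR.
  - by move=> x _; rewrite normrM HC.
rewrite RintegralD//; [|exact: integrableZR|exact: integrableZR].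
rewrite !RintegralZl// [leRHS]splitr lerD//.
  apply: (@le_trans _ _ (C * (e / 2 / (C + 1)))); first by rewrite ler_wpM2l.
  by rewrite mulrCA ler_piMr ?divr_ge0 ?(ltW e0)// ler_pdivrMr ?ltr_wpDl// mul1r lerDl.
rewrite /s mulrAC ler_pdivrMr ?ltr_wpDl// ler_wpM2l ?divr_ge0 ?(ltW e0)//.
by rewrite -/(npow q w) lerDl.
Qed.

End conjugate.

(** Substitute for the Minkowski inequality: the factor of G is as close to 1 as wanted, and this is
    what makes [npow] continuous. *)
Lemma npow_dist_eps (s : R) : 0 < s -> exists2 C, 0 <= C & forall F G H : T -> R,
  pint p F -> pint p G -> pint p H ->
  (forall x, O x -> `|F x| <= `|G x| + `|H x|) ->
  npow p F <= (1 + s) * npow p G + C * npow p H.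
Proof.
move=> s0; have [C C0 HC] := powR_add_eps p1 s0; exists C => // F G H [mF iF] [mG iG] [mH iH] FGH.
rewrite /npow -!RintegralZl// -RintegralD//; [|exact: integrableZR|exact: integrableZR].
apply: le_Rintegral => //; first by apply: integrableDR; exact: integrableZR.
move=> x Ox; apply: le_trans (HC _ _ _ _) => //.
by apply: le_powR => //; [exact: ltW|exact: FGH].
Qed.

Lemma npow_cvg (Fn : nat -> T -> R) (F : T -> R) (Hn : nat -> T -> R) :
  (forall n, pint p (Fn n)) -> pint p F -> (forall n, pint p (Hn n)) ->
  (forall n x, O x -> `|Fn n x - F x| <= `|Hn n x|) ->
  npow p (Hn n) @[n --> \oo] --> 0 -> npow p (Fn n) @[n --> \oo] --> npow p F.
Proof.
move=> iFn iF iH le cv; apply/cvgrPdist_le => e e0.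
have N0 := npow_ge0 p F; set N := npow p F in N0 *.
pose s := Num.min 1 (e / (3 * (N + 1) )).
have N1 : 0 < N + 1 by rewrite ltr_wpDl.
have s0 : 0 < s by rewrite lt_min ltr01/= divr_gt0// mulr_gt0.
have s1 : s <= 1 by rewrite ge_min lexx.
have sN : s * (N + 1) <= e / 3.
  rewrite -ler_pdivlMr// /s ge_min; apply/orP; right.
  by rewrite -mulrA invfM mulrA.
have [C C0 HC] := npow_dist_eps s0.
have e1 : 0 < Num.min 1 (e / 3) / (C + 1).
  by rewrite divr_gt0 ?ltr_wpDl// lt_min ltr01/= divr_gt0.
have := cv; move/cvgrPdist_le => /(_ _ e1); apply: filterS => n.
rewrite sub0r normrN ger0_norm ?npow_ge0// => Hnn.
have CH : C * npow p (Hn n) <= Num.min 1 (e / 3).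
  apply: (@le_trans _ _ (C * (Num.min 1 (e / 3) / (C + 1)))); first by rewrite ler_wpM2l.
  have m0 : 0 <= Num.min 1 (e / 3) by rewrite le_min ler01/= divr_ge0// ltW.
  by rewrite mulrCA ler_piMr// ler_pdivrMr ?ltr_wpDl// mul1r lerDl.
have CH1 : C * npow p (Hn n) <= 1 by rewrite (le_trans CH)// ge_min lexx.
have CH2 : C * npow p (Hn n) <= e / 3 by rewrite (le_trans CH)// ge_min lexx orbT.
have h1 : npow p (Fn n) <= (1 + s) * N + C * npow p (Hn n).
  apply: HC => // x Ox; rewrite -[X in `|X|](subrK (F x)) (le_trans (ler_normD _ _))//.
  by rewrite addrC lerD// le.
have h2 : N <= (1 + s) * npow p (Fn n) + C * npow p (Hn n).
  apply: HC => // x Ox; rewrite -[X in `|X|](subrK (Fn n x)) (le_trans (ler_normD _ _))//.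
  by rewrite addrC lerD// distrC le.
have Fn0 := npow_ge0 p (Fn n).
apply: (dist_le_arith _ _ _ _ sN CH1 CH2 h1 h2) => //; exact: ltW.
Qed.

End Lp.

Section powR_continuous.
Context {R : realType}.
Implicit Types (r s t : R).

Lemma is_derive_powR r s : 0 < s -> is_derive s 1 (@powR R ^~ r) (r * s `^ (r - 1)).
Proof.
move=> s0; have sI : s \in `]0, +oo[ by rewrite in_itv/= s0.
split; first exact: derivable_powR.
by have := @powR_derive1 R r s sI; rewrite derive1E.
Qed.

Lemma powR_norm_continuous r : 0 < r -> continuous (fun s : R => `|s| `^ r).
Proof.
move=> r0 s; have [->|s0] := eqVneq s 0.
  apply/(@cvgrPdist_lt _ _ _ (nbhs (0:R))) => e e0; rewrite normr0 powR0 ?gt_eqF//.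
  have e1 : 0 < e `^ r^-1 by rewrite powR_gt0.
  apply/nbhs_ballP; exists (e `^ r^-1) => //= t; rewrite -ball_normE /= sub0r normrN => te.
  rewrite sub0r normrN ger0_norm ?powR_ge0//.
  have := gt0_ltr_powR r0 (_ : `|t| \is Num.nneg) (_ : e `^ r^-1 \is Num.nneg) te.
  rewrite -powRrM mulVf ?gt_eqF// powRr1 ?(ltW e0)//; apply; rewrite nnegrE//.
  exact: ltW.
apply: (@continuous_comp _ _ _ (fun s : R => `|s|) (@powR R ^~ r)); first exact: norm_continuous.
apply: differentiable_continuous; apply/derivable1_diffP.
by have [] := @is_derive_powR r `|s| (_ : 0 < `|s|); rewrite ?normr_gt0.
Qed.

Lemma powR_ler_exp r : 1 < r -> forall s, `| `|s| `^ r | = `|s| * `|s| `^ (r - 1).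
Proof. by move=> r1 s; rewrite mulr_powRB1 ?(lt_trans ltr01)// ger0_norm ?powR_ge0. Qed.

Lemma is_derive_norm_powR r s : 1 < r ->
  is_derive s 1 (fun t : R => `|t| `^ r) (r * (Num.sg s * `|s| `^ (r - 1))).
Proof.
move=> r1; have r0 : 0 < r - 1 by rewrite subr_gt0.
have [s0|s0|->] := ltgtP s 0.
- apply: (@near_eq_is_derive _ _ _ (fun t : R => (- t) `^ r)).
    have : \forall t \near s, t < 0 by exact: lt_nbhsl.
    by apply: filterS => t t0; rewrite ltr0_norm.
  have dN : is_derive s 1 (fun t : R => - t) (- 1).
    by have := is_deriveN (is_derive_id s (1 : R)).
  have dP := @is_derive_powR r (- s) (_ : 0 < - s).
  rewrite oppr_gt0 s0 in dP.
  have H := @is_derive1_comp R (@powR R ^~ r) (fun t : R => - t) s _ _ (dP isT) dN.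
  by apply: (is_derive_eq H); rewrite ltr0_sg// ltr0_norm//; ring.
- apply: (@near_eq_is_derive _ _ _ (@powR R ^~ r)).
    have : \forall t \near s, 0 < t by exact: lt_nbhsr.
    by apply: filterS => t t0; rewrite gtr0_norm.
  by apply: (is_derive_eq (is_derive_powR r s0)); rewrite gtr0_sg// gtr0_norm// mul1r.
- rewrite sgr0 mul0r mulr0.
  have lim0 : (fun h : R => h^-1 *: (`|h *: (1 : R) + (0 : R)| `^ r - `|0 : R| `^ r)) x @[x --> (0:R)^'] --> (0 : R).
    have c0 := @powR_norm_continuous (r - 1) r0 0.
    apply/cvgr0Pnorm_le => e e0.
    move/(@cvgrPdist_lt _ _ _ (nbhs (0:R)))/(_ e e0)/nbhs_ballP : c0 => [d /= d0 Hd].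
    exists d => // h /= hd h0.
    have hd' : `|h| < d by move: hd; rewrite sub0r normrN.
    have /= := Hd h; rewrite -ball_normE /= sub0r normrN normr0 powR0 ?gt_eqF// sub0r normrN => /(_ hd').
    rewrite ger0_norm ?powR_ge0// => H.
    rewrite scaler1 addr0 powR0 ?gt_eqF ?(lt_trans ltr01)// subr0 /GRing.scale/= normrM normfV.
    by rewrite powR_ler_exp// mulrA mulVf ?normr_eq0// mul1r ltW.
  split; first by apply/cvg_ex; exists 0.
  by apply: cvg_lim => //; exact: Rhausdorff.
Qed.

Lemma sg_powR_continuous r : 0 < r -> continuous (fun s : R => Num.sg s * `|s| `^ r).
Proof.
move=> r0 s; have [->|s0] := eqVneq s 0.
  have c0 := @powR_norm_continuous r r0 0.
  apply/(@cvgrPdist_lt _ _ _ (nbhs (0:R))) => e e0.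
  move/(@cvgrPdist_lt _ _ _ (nbhs (0:R)))/(_ e e0) : c0; apply: filterS => t.
  rewrite normr0 powR0 ?gt_eqF// mulr0 !sub0r !normrN normrM normr_sg => H.
  by case: (t != 0); rewrite ?mul1r// mul0r.
have cn := @powR_norm_continuous r r0 s.
suff : (fun t : R => Num.sg s * `|t| `^ r) t @[t --> nbhs s] --> Num.sg s * `|s| `^ r.
  apply: cvg_trans; apply: near_eq_cvg.
  have [s1|s1] : 0 < s \/ s < 0 by case/orP : (lt_total s0) => ?; [right|left].
    have : \forall t \near s, 0 < t by exact: lt_nbhsr.
    by apply: filterS => t t0; rewrite !gtr0_sg.
  have : \forall t \near s, t < 0 by exact: lt_nbhsl.
  by apply: filterS => t t0; rewrite !ltr0_sg.
by apply: cvgM => //; exact: cvg_cst.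
Qed.

Lemma cvg_powR_inv r (u : nat -> R) : 0 < r -> (forall n, 0 <= u n) ->
  (u n `^ r^-1 @[n --> \oo] --> 0) <-> (u n @[n --> \oo] --> 0).
Proof.
move=> r0 u0; split => H.
  have c : `|x : R| `^ r @[x --> (0 : R)] --> (0 : R).
    have c : `|x : R| `^ r @[x --> (0 : R)] --> `|0 : R| `^ r := @powR_norm_continuous r r0 0.
    by move: c; rewrite normr0 powR0 ?gt_eqF.
  have := cvg_comp _ _ H c; apply: cvg_trans; apply: near_eq_cvg; apply: nearW => n /=.
  by rewrite (ger0_norm (powR_ge0 _ _)) -powRrM mulVf ?gt_eqF// powRr1.
have ri : 0 < r^-1 by rewrite invr_gt0.
have c : `|x : R| `^ r^-1 @[x --> (0 : R)] --> (0 : R).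
  have c : `|x : R| `^ r^-1 @[x --> (0 : R)] --> `|0 : R| `^ r^-1 := @powR_norm_continuous r^-1 ri 0.
  by move: c; rewrite normr0 powR0 ?gt_eqF.
 have := cvg_comp _ _ H c; apply: cvg_trans; apply: near_eq_cvg; apply: nearW => n /=.
by rewrite ger0_norm.
Qed.

End powR_continuous.

(** * Completeness of L^p on a set of finite measure *)

Section Lp_complete.
Context {d} {T : measurableType d} {R : realType}.
Variables (mu : {measure set T -> \bar R}) (O : set T) (p : R).
Hypotheses (mO : measurable O) (muO : (mu O < +oo)%E) (p1 : 1 < p).
Implicit Types (f g : T -> R).

Let p0 : 0 < p. Proof. exact: lt_trans p1. Qed.

Lemma npow_L1 (t : R) f : 0 < t -> pint mu O p f -> npow mu O p f <= t `^ p ->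
  \int[mu]_(x in O) `|f x| <= t * (fine (mu O) + 1).
Proof.
move=> t0 pf fe; have [mf fi] := pf.
apply: (@le_trans _ _ (\int[mu]_(x in O) (t + t `^ (1 - p) * `|f x| `^ p))).
  apply: le_Rintegral => //.
  - exact: (integrable_norm (pint_integrable mO p1 muO pf)).
  - by apply: integrableDR => //; [exact: cst_integrableR|exact: integrableZR].
  - by move=> x _; apply: le_powR_scale => //; exact: ltW.
rewrite RintegralD//; [|exact: cst_integrableR|exact: integrableZR].
rewrite Rintegral_cst// RintegralZl// mulrDr mulr1 lerD2l//.
apply: (@le_trans _ _ (t `^ (1 - p) * t `^ p)); first by rewrite ler_wpM2l ?powR_ge0.
by rewrite -powRD ?subrK ?powRr1 ?(ltW t0)// gt_eqF ?implybT.
Qed.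

(** Riesz-Fischer: a rapidly converging subsequence has increments summable in L^1, hence converges
    almost everywhere, and Fatou's lemma carries the Cauchy estimate to its limit. *)
Lemma Lp_complete (fn : nat -> T -> R) : (forall n, pint mu O p (fn n)) ->
  (forall e, 0 < e -> exists N, forall m n, (N <= m)%N -> (N <= n)%N ->
     npow mu O p (fun x => fn m x - fn n x) <= e) ->
  exists2 f, pint mu O p f & npow mu O p (fun x => fn n x - f x) @[n --> \oo] --> 0.
Proof.
move=> pfn cau.
(* Summable, and by [npow_L1] a p-th power distance of at most t^p bounds the L^1 distance by a
   multiple of t. *)
pose t (k : nat) : R := (2 ^ k.+1)%:R^-1.
have t0 k : 0 < t k by rewrite invr_gt0 ltr0n expn_gt0.
have /choice[N0 HN0] (k : nat) : exists N, forall m n, (N <= m)%N -> (N <= n)%N ->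
     npow mu O p (fun x => fn m x - fn n x) <= t k `^ p.
  by apply: cau; exact: powR_gt0.
pose N k := maxn k (N0 k).
have HN k m n : (N k <= m)%N -> (N k <= n)%N ->
    npow mu O p (fun x => fn m x - fn n x) <= t k `^ p.
  by rewrite !geq_max => /andP[_ ?] /andP[_ ?]; exact: HN0.
(* The running maximum makes the indices monotone, so consecutive terms both lie beyond the
   threshold N k. *)
pose s k := (\max_(j < k.+1) N j)%N.
have sN k : (N k <= s k)%N by exact: (@leq_bigmax _ (fun j : 'I_k.+1 => N j) ord_max).
have sS k : (s k <= s k.+1)%N by rewrite [X in (_ <= X)%N]/s big_ord_recr/= leq_maxl.
have s_mono k j : (k <= j)%N -> (s k <= s j)%N.
  by move/subnK => <-; elim: (j - k)%N => // i ih; rewrite (leq_trans ih)// addSn sS.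
pose h k x := fn (s k.+1) x - fn (s k) x.
have ph k : pint mu O p (h k) by exact: pintB.
have hi k : mu.-integrable O (EFin \o h k) by exact: pint_integrable (ph k).
have hn k : \int[mu]_(x in O) `|h k x| <= t k * (fine (mu O) + 1).
  apply: npow_L1 => //; apply: HN; last exact: sN.
  by rewrite (leq_trans (sN k))// sS.
have m0 : 0 <= fine (mu O) + 1 by rewrite addr_ge0// fine_ge0.
pose S x := (\sum_(0 <= k <oo) `|h k x|%:E)%E.
have mh k : measurable_fun O (fun x => `|h k x|%:E).
  by apply/measurable_EFinP; apply: measurableT_comp => //; have [] := ph k.
have Sfin : (\int[mu]_(x in O) S x < +oo)%E.
  rewrite integral_nneseries//.
  apply: (@le_lt_trans _ _ (\sum_(0 <= k <oo) ((fine (mu O) + 1) / (2 ^ k.+1)%:R)%:E)%E).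
    apply: lee_nneseries => k; first by move=> _ _; exact: integral_ge0.
    move=> _; have := hn k; rewrite -lee_fin mulrC; apply: le_trans.
    rewrite /Rintegral fineK//; apply: (integrable_fin_num mO).
    exact: (integrable_norm (hi k)).
  by apply: le_lt_trans (epsilon_trick0 xpredT m0) _; rewrite ltry.
have S0 x : (0 <= S x)%E by exact: nneseries_ge0.
have mS : measurable_fun O S by apply: ge0_emeasurable_sum.
have iS : mu.-integrable O S.
  by apply/integrableP; split => //; under eq_integral do rewrite gee0_abs//.
have [Z [mZ Z0 SZ]] := integrable_ae mO iS.
pose A := O `\` Z.
have mA : measurable A by exact: measurableD.
have AO : A `<=` O by move=> x [].
have SA x : A x -> (S x < +oo)%E.
  move=> [Ox Zx]; have : S x \is a fin_num.
    by apply: contrapT => H; apply: Zx; apply: SZ => /(_ Ox).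
  by rewrite fin_numElt => /andP[].
have cA x : A x -> cvgn (fun k => fn (s k) x).
  move=> /SA Sx.
  have c1 : cvgn [normed series (fun k => h k x)].
    by apply: (@nnseries_is_cvg R (fun k => `|h k x|)) => // k; exact: normr_ge0.
  have c2 := normed_cvg c1.
  have -> : (fun k => fn (s k) x) = (fun k => fn (s 0) x + series (fun k => h k x) k).
    apply/funext => k; rewrite /series /=; elim: k => [|k ih]; first by rewrite big_geq// addr0.
    by rewrite big_nat_recr//= addrA -ih /h addrC subrK.
  by apply: is_cvgD => //; exact: is_cvg_cst.
(* With the value 0 off A, f is its own restriction to A, so measurability on A extends to O. *)
pose f x : R := if x \in A then limn (fun k => fn (s k) x) else 0.
have fA x : A x -> fn (s k) x @[k --> \oo] --> f x.
  by move=> Ax; rewrite /f mem_set//; exact: cA.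
have mfA : measurable_fun A f.
  apply: (@measurable_fun_cvg _ _ _ A (fun k => fn (s k)) f) => // k.
  by have [mk _] := pfn (s k); exact: measurable_funS mk.
have mf : measurable_fun O f.
  have fE : (f : T -> R) \_ A = f.
    by apply/funext => x; rewrite !patchE /f; case: (x \in A).
  by apply: measurable_funTS; rewrite -fE; exact: (measurable_restrictT f mA).1.
have key e : 0 < e -> exists N, forall n, (N <= n)%N ->
    (\int[mu]_(x in O) (`|fn n x - f x| `^ p)%:E <= e%:E)%E.
  move=> /cau[M HM]; exists M => n Mn.
  have mfn k : measurable_fun O (fun x => `|fn n x - fn k x| `^ p).
    by apply: measurable_powR_norm => //; have [] := pintB mO p1 (pfn n) (pfn k).
  have mnf : measurable_fun O (fun x => (`|fn n x - f x| `^ p)%:E).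
    by apply/measurable_EFinP; apply: measurable_powR_norm; apply: measurable_funB => //; have [] := pfn n.
  rewrite (ge0_negligible_integral mZ mO mnf _ Z0); last by move=> x _; rewrite lee_fin powR_ge0.
  have -> : (\int[mu]_(x in A) (`|fn n x - f x| `^ p)%:E =
      \int[mu]_(x in A) limn_einf (fun k => (`|fn n x - fn (s k) x| `^ p)%:E))%E.
    apply: eq_integral => x; rewrite inE => Ax; apply/esym.
    apply: (cvg_limn_einf_sup _).1; apply: cvg_EFin; first exact: nearW.
    have c : `|y : R| `^ p @[y --> (fn n x - f x)] --> `|fn n x - f x| `^ p.
      exact: (@powR_norm_continuous R p p0 (fn n x - f x)).
    have c' : fn n x - fn (s k) x @[k --> \oo] --> fn n x - f x.
      by apply: cvgB; [exact: cvg_cst|exact: fA].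
    exact: (cvg_comp _ _ c' c).
  have mfnA k : measurable_fun A (fun x => (`|fn n x - fn (s k) x| `^ p)%:E).
    by apply/measurable_EFinP; exact: measurable_funS (mfn (s k)).
  apply: (le_trans (fatou mu mA mfnA _)); first by move=> k x _; rewrite lee_fin powR_ge0.
  rewrite limn_einf_lim; apply: lime_le; first exact: is_cvg_einfs.
  have [K HK] : exists K, forall k, (K <= k)%N -> (M <= s k)%N.
    exists M => k /s_mono; apply: leq_trans; apply: leq_trans (sN M).
    exact: leq_maxl.
  exists K => // k /= Kk.
  apply: (@le_trans _ _ (\int[mu]_(x in A) (`|fn n x - fn (s k) x| `^ p)%:E)%E).
    by apply: ereal_inf_lbound; exists k => /=.
  apply: (@le_trans _ _ (\int[mu]_(x in O) (`|fn n x - fn (s k) x| `^ p)%:E)%E).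
    by apply: ge0_subset_integral => //; exact/measurable_EFinP.
  have := HM n (s k) Mn (HK _ Kk); rewrite -lee_fin /npow /Rintegral fineK//.
  apply: (integrable_fin_num mO).
  by have [] := pintB mO p1 (pfn n) (pfn (s k)).
have pd n : measurable_fun O (fun x => fn n x - f x).
  by apply: measurable_funB => //; have [] := pfn n.
have fin n : (\int[mu]_(x in O) (`|fn n x - f x| `^ p)%:E < +oo)%E -> pint mu O p (fun x => fn n x - f x).
  move=> H; split => //; apply/integrableP; split.
    by apply/measurable_EFinP; exact: measurable_powR_norm.
  by under eq_integral do rewrite gee0_abs ?lee_fin ?powR_ge0//.
have [M HM] := key 1 ltr01.
have pMf : pint mu O p (fun x => fn M x - f x).
  by apply: fin; apply: le_lt_trans (HM _ (leqnn M)) _; rewrite ltry.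
have pf : pint mu O p f.
  have := pintB mO p1 (pfn M) pMf; by under eq_fun do rewrite opprB addrC subrK.
exists f => //; apply/cvgrPdist_le => e e0; have [K HK] := key e e0.
exists K => // n /= Kn; rewrite sub0r normrN ger0_norm ?npow_ge0//.
have := HK n Kn; rewrite -lee_fin /npow /Rintegral fineK//; apply: (integrable_fin_num mO).
by have [] := pintB mO p1 (pfn n) pf.
Qed.

End Lp_complete.

(** * Uniform convexity of the p-th power of the Euclidean norm *)

Section uniform_convexity.
Context {R : realType} {D : nat}.
Local Notation V := 'rV[R]_D.
Implicit Types (a b : V) (p s t : R).

(** The mean value theorem on the two halves of [s, t], and strict monotonicity of the
    derivative. *)
Lemma powR_strict_convex p s t : 1 < p -> 0 <= s -> s < t ->
  2 * ((s + t) / 2) `^ p < s `^ p + t `^ p.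
Proof.
move=> p1 s0 st; set m := (s + t) / 2.
have sm : s < m by rewrite /m; lra.
have mt : m < t by rewrite /m; lra.
have t0 : 0 < t by exact: le_lt_trans st.
have tm : t - m = m - s by rewrite /m; lra.
clearbody m.
pose f (x : R) := `|x| `^ p.
pose df (x : R) := p * (Num.sg x * `|x| `^ (p - 1)).
have dfE (x : R) : is_derive x 1 f (df x) by exact: is_derive_norm_powR.
have cf (a b : R) : {within `[a, b], continuous f}.
  by apply: derivable_within_continuous => x _; have [] := dfE x.
have [c1 /itvP c1I E1] := MVT sm (fun x _ => dfE x) (@cf s m).
have [c2 /itvP c2I E2] := MVT mt (fun x _ => dfE x) (@cf m t).
have c10 : 0 < c1 by rewrite (le_lt_trans s0)// c1I.
have c12 : c1 < c2 by rewrite (lt_trans (y := m)) ?c1I ?c2I.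
have c20 : 0 < c2 by rewrite (lt_trans c10).
have lt : df c1 < df c2.
  rewrite /df !gtr0_sg// !mul1r !gtr0_norm// ltr_pM2l ?(lt_trans ltr01)//.
  by rewrite gt0_ltr_powR ?subr_gt0// nnegrE ltW.
have m0 : 0 < m by exact: le_lt_trans sm.
move: E1 E2; rewrite /f (ger0_norm s0) (gtr0_norm m0) (gtr0_norm t0) => E1 E2.
have -> : s `^ p = m `^ p - df c1 * (m - s) by rewrite -E1; ring.
have -> : t `^ p = m `^ p + df c2 * (m - s) by rewrite -tm -E2; ring.
have : 0 < (df c2 - df c1) * (m - s) by rewrite mulr_gt0// subr_gt0.
rewrite mulrBl; move: (df c1 * _) (df c2 * _) (m `^ p) => x y z; lra.
Qed.

Lemma parallelogram a b : enorm (a + b) ^+ 2 + enorm (a - b) ^+ 2 =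
  2 * (enorm a ^+ 2 + enorm b ^+ 2).
Proof.
by rewrite !sqr_enorm !(dotrVDl, dotrVDr, dotrVNl, dotrVNr) (dotrVC b a); ring.
Qed.

Definition mid_defect p a b :=
  enorm a `^ p + enorm b `^ p - 2 * enorm (2^-1 *: (a + b)) `^ p.

(** Two reasons for strictness: vectors of different length are separated by strict convexity of the
    power, and for equal lengths the parallelogram identity makes the midpoint strictly shorter. *)
Lemma mid_defect_gt0 p a b : 1 < p -> a != b -> 0 < mid_defect p a b.
Proof.
move=> p1 ab; have p0 : 0 < p by exact: lt_trans p1.
have half : enorm (2^-1 *: (a + b)) = enorm (a + b) / 2.
  by rewrite enormZ ger0_norm ?invr_ge0// mulrC.
rewrite /mid_defect subr_gt0.
have le1 : enorm (2^-1 *: (a + b)) <= (enorm a + enorm b) / 2.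
  by rewrite half ler_pM2r ?invr_gt0// ler_enormD.
have [E|] := eqVneq (enorm a) (enorm b); last first.
  move=> ne; apply: (@le_lt_trans _ _ (2 * ((enorm a + enorm b) / 2) `^ p)).
    by rewrite ler_pM2l//; apply: le_powR => //; [exact: ltW|exact: enorm_ge0].
  have [lt|lt] : enorm a < enorm b \/ enorm b < enorm a by case/orP : (lt_total ne) => ?; [left|right].
    by rewrite powR_strict_convex// enorm_ge0.
  by rewrite [enorm a + _]addrC [_ `^ p + _]addrC powR_strict_convex// enorm_ge0.
have d0 : 0 < enorm (a - b).
  rewrite lt_neqAle enorm_ge0 andbT eq_sym; apply: contra_neq ab => /enorm_eq0/eqP.
  by rewrite subr_eq0 => /eqP.
have lt : enorm (2^-1 *: (a + b)) < enorm a.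
  rewrite half ltr_pdivrMr// -ltr_sqr ?nnegrE ?mulr_ge0 ?enorm_ge0//.
  have := parallelogram a b; rewrite -E exprMn.
  have := exprn_gt0 2 d0; lra.
apply: (@lt_le_trans _ _ (2 * enorm a `^ p)); last by rewrite -E mulr_natl mulr2n.
by rewrite ltr_pM2l// gt0_ltr_powR// nnegrE enorm_ge0.
Qed.

Lemma mid_defect_ge0 p a b : 1 < p -> 0 <= mid_defect p a b.
Proof.
move=> p1; have [->|/(mid_defect_gt0 p1)/ltW//] := eqVneq a b.
rewrite /mid_defect; have -> : 2^-1 *: (b + b) = b.
  have -> : b + b = 2 *: b by rewrite scaler_nat mulr2n.
  by rewrite scalerA mulVf// scale1r.
by rewrite mulr_natl mulr2n subrr.
Qed.

Lemma enormZ_powR p t a : 0 <= t -> enorm (t *: a) `^ p = t `^ p * enorm a `^ p.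
Proof. by move=> t0; rewrite enormZ ger0_norm// powRM// enorm_ge0. Qed.

Lemma mid_defectZ p t a b : 0 <= t -> mid_defect p (t *: a) (t *: b) = t `^ p * mid_defect p a b.
Proof.
move=> t0; rewrite /mid_defect.
have -> : 2^-1 *: (t *: a + t *: b) = t *: (2^-1 *: (a + b)).
  by rewrite -scalerDr !scalerA mulrC.
by rewrite !(enormZ_powR p _ t0); ring.
Qed.

(* By homogeneity it suffices to bound the quotient on a compact set avoiding the diagonal. *)
Lemma uniform_convexity p s : 1 < p -> 0 < s -> exists2 C, 0 <= C & forall a b,
  enorm (a - b) `^ p <= s * (enorm a `^ p + enorm b `^ p) + C * mid_defect p a b.
Proof.
move=> p1 s0; have p0 : 0 < p by exact: lt_trans p1.
(* Pairs of vectors are encoded as row vectors of length D + D, so that the extreme value theorem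
   applies to functions of a pair. *)
pose l (z : 'rV[R]_(D + D)) : V := lsubmx z.
pose r (z : 'rV[R]_(D + D)) : V := rsubmx z.
have cl : continuous l by move=> z; apply: differentiable_continuous; exact: differentiable_lsubmx.
have cr : continuous r by move=> z; apply: differentiable_continuous; exact: differentiable_rsubmx.
have cpow (h : 'rV[R]_(D + D) -> V) : continuous h -> continuous (fun z => enorm (h z) `^ p).
  move=> ch z.
  have -> : (fun z => enorm (h z) `^ p) = (fun z => `|enorm (h z)| `^ p).
    by apply/funext => y; rewrite ger0_norm ?enorm_ge0.
  apply: (@continuous_comp _ _ _ (fun z => enorm (h z)) (fun s : R => `|s| `^ p)).
    by apply: (@continuous_comp _ _ _ h (enorm : V -> R)); [exact: ch|exact: enorm_continuous].
  exact: powR_norm_continuous.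
pose N z := enorm (l z) `^ p + enorm (r z) `^ p.
pose d z := enorm (l z - r z) `^ p.
pose G z := mid_defect p (l z) (r z).
have cN : continuous N by apply: continuous_addR; exact: cpow.
have cd : continuous d.
  by apply: (cpow (fun z => l z - r z)) => z; exact: (cvgB (cl z) (cr z)).
have cG : continuous G.
  have cm : continuous (fun z => (- 2 : R) * enorm (2^-1 *: (l z + r z)) `^ p).
    apply: continuous_scaleR; apply: (cpow (fun z => 2^-1 *: (l z + r z))) => z.
    exact: (cvgZr (cvgD (cl z) (cr z))).
  have -> : G = (fun z => N z + (- 2 : R) * enorm (2^-1 *: (l z + r z)) `^ p).
    by apply/funext => z; rewrite /G /mid_defect /N mulNr.
  exact: (continuous_addR cN cm).
pose K := [set z | N z = 1] `&` [set z | s <= d z].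
have NE a b : N (row_mx a b) = enorm a `^ p + enorm b `^ p by rewrite /N /l /r row_mxKl row_mxKr.
have dE a b : d (row_mx a b) = enorm (a - b) `^ p by rewrite /d /l /r row_mxKl row_mxKr.
have GE a b : G (row_mx a b) = mid_defect p a b by rewrite /G /l /r row_mxKl row_mxKr.
suff [C C0 HC] : exists2 C, 0 <= C & forall a b, enorm a `^ p + enorm b `^ p = 1 ->
    enorm (a - b) `^ p <= s + C * mid_defect p a b.
  exists C => // a b; set n := enorm a `^ p + enorm b `^ p.
  have n0 : 0 <= n by rewrite addr_ge0 ?powR_ge0.
  have [n00|n_neq0] := eqVneq n 0.
    have a0 : a = 0.
      by apply: enorm_eq0; apply: (@powR_eq0_eq0 _ _ p); apply/eqP; rewrite eq_le powR_ge0 andbT -n00 /n lerDl powR_ge0.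
    have b0 : b = 0.
      by apply: enorm_eq0; apply: (@powR_eq0_eq0 _ _ p); apply/eqP; rewrite eq_le powR_ge0 andbT -n00 /n lerDr powR_ge0.
    rewrite a0 b0 subr0 enorm0 powR0 ?gt_eqF// n00 mulr0 add0r mulr_ge0//.
    exact: mid_defect_ge0.
  have np : 0 < n by rewrite lt_neqAle eq_sym n_neq0.
  pose t := n `^ (- p^-1).
  have t0 : 0 < t by rewrite powR_gt0.
  have tp : t `^ p = n^-1 by rewrite /t -powRrM mulNr mulVf ?gt_eqF// powR_inv1 // ltW.
  have := HC (t *: a) (t *: b).
  rewrite (mid_defectZ _ _ _ (ltW t0)) -(scalerBr t a b) !(enormZ_powR p _ (ltW t0)) tp.
  rewrite -mulrDr -/n mulVf// => /(_ erefl).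
  rewrite mulrC ler_pdivrMr// => /le_trans; apply.
  by rewrite mulrDl mulrCA mulrAC mulVf// mul1r mulrC.
(* For large s no normalized pair is s apart, and C = 0 serves. Otherwise the minimum of the defect
   on K is positive and is compared with the trivial bound 2^p. *)
have [K0|/set0P K0] := eqVneq K set0.
  exists 0 => // a b ab; rewrite mul0r addr0 leNgt; apply/negP => h.
  have : K (row_mx a b).
    by split; [exact: etrans (NE a b) ab|rewrite /= dE ltW].
  by rewrite K0.
have cK : compact K.
  apply: bounded_closed_compact.
    exists 1; split => // M M1 z [Nz _]; apply: le_trans (ltW M1).
    have bnd (v w : R) : 0 <= v -> 0 <= w -> v `^ p + w `^ p = 1 -> v <= 1.
      move=> v0 w0 E; rewrite leNgt; apply/negP => v1.
      have := le1r_powR (ltW v1) (ltW p1); have := powR_ge0 w p; lra.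
    have la : enorm (l z) <= 1 by apply: (bnd _ (enorm (r z))); rewrite ?enorm_ge0.
    have lb : enorm (r z) <= 1.
      apply: (bnd _ (enorm (l z))); [exact: enorm_ge0|exact: enorm_ge0|].
      by rewrite [LHS]addrC; exact: Nz.
    apply: rV_norm_ler => // i; case: (split_ordP i) => j ->.
      by have := coord_ler_enorm (lsubmx z) j; rewrite mxE => /le_trans; apply.
    by have := coord_ler_enorm (rsubmx z) j; rewrite mxE => /le_trans; apply.
  apply: closedI.
    have -> : [set z | N z = 1] = N @^-1` [set 1 : R] by [].
    by apply: closed_comp; [move=> z _; exact: cN|exact: closed_eq].
  have -> : [set z | s <= d z] = d @^-1` [set x : R | s <= x] by [].
  by apply: closed_comp; [move=> z _; exact: cd|exact: closed_ge].
have cGK : {within K, continuous G} by apply: continuous_subspaceT.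
have [c cK' Hc] := EVT_min_rV K0 cK cGK.
rewrite inE in cK'; have [_ /= sc] := cK'.
have Gc : 0 < G c.
  apply: mid_defect_gt0 => //; apply/eqP => E.
  by move: sc; rewrite /d E subrr enorm0 powR0 ?gt_eqF// leNgt s0.
exists (2 `^ p / G c); first by rewrite divr_ge0 ?powR_ge0// ltW.
move=> a b ab.
have dG0 : 0 <= 2 `^ p / G c * mid_defect p a b.
  by rewrite mulr_ge0 ?mid_defect_ge0// divr_ge0 ?powR_ge0// ltW.
have [h|h] := leP (enorm (a - b) `^ p) s; first by rewrite (le_trans h)// lerDl.
apply: (ler_wpDl (ltW s0)).
have Kab : K (row_mx a b).
  by split; [exact: etrans (NE a b) ab|rewrite /= dE ltW].
have := Hc (row_mx a b); rewrite inE GE => /(_ Kab) h2.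
apply: (@le_trans _ _ (2 `^ p)).
  have := powR_add_le p0 (enorm_ge0 a) (enorm_ge0 b); rewrite ab mulr1; apply: le_trans.
  apply: le_powR; [exact: ltW|exact: enorm_ge0|by rewrite (le_trans (ler_enormD _ _))// enormN].
have := powR_ge0 (2 : R) p; move: (2 `^ p) (G c) (mid_defect p a b) Gc h2 => A g m g0 gm A0.
by rewrite mulrAC ler_pdivlMr// ler_wpM2l.
Qed.

End uniform_convexity.

(** * Existence of the torsion function *)

Section W0.
Context {R : realType} {D : nat}.
Local Notation V := 'rV[R]_D.
Local Notation mu := (@lebesgue_rV R D).
Local Notation e_ i := (delta_mx ord0 i : V).
Variables (O : set V) (p : R).
Hypotheses (oO : open O) (bO : bounded_set O) (p1 : 1 < p).
Implicit Types (u f phi : V -> R) (g h : V -> V).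

Let p0 : 0 < p. Proof. exact: lt_trans p1. Qed.
Let mO : measurable O. Proof. exact: measurable_open_rV. Qed.
Let muO : (mu O < +oo)%E. Proof. exact: bounded_lebesgue_rV_lty. Qed.

Let restrict_powR u : (fun x : V => (`|(EFin \o (u \* \1_O)%R) x| `^ p)%E) =
  (EFin \o (fun x => `|u x| `^ p)) \_ O.
Proof.
apply/funext => x /=; rewrite patchE indicE; case: ifPn => _ /=.
  by rewrite mulr1.
by rewrite mulr0 normr0 powR0 ?gt_eqF.
Qed.

Lemma Lp_norm_npow u : pint mu O p u -> Lp_norm p O u = (npow mu O p u `^ p^-1)%:E.
Proof.
move=> [mu_ iu]; rewrite /Lp_norm unlock restrict_powR -integral_mkcond.
by rewrite -poweR_EFin /npow /Rintegral fineK// integrable_fin_num.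
Qed.

Lemma in_Lp_pint u : in_Lp p O u <-> pint mu O p u.
Proof.
have mE : measurable_fun O u <-> measurable_fun setT (u \* \1_O).
  by rewrite -patch_indic; exact: measurable_restrictT.
have powE : Lp_norm p O u =
    ((\int[mu]_(x in O) (`|u x| `^ p)%:E) `^ p^-1)%E.
  by rewrite /Lp_norm unlock restrict_powR -integral_mkcond.
rewrite /in_Lp; split.
  move=> /andP[mu1 fu]; have mu_ : measurable_fun O u.
    by apply/mE; move: mu1; rewrite inE.
  split=> //; apply/integrableP; split.
    by apply/measurable_EFinP; exact: measurable_powR_norm.
  move: fu; rewrite inE /= /finite_norm -/(Lp_norm p O u) powE => /lty_poweRy.
  rewrite gt_eqF ?invr_gt0// => /(_ isT) lt.
  apply: le_lt_trans lt; under eq_integral do rewrite /= ger0_norm ?powR_ge0//.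
  by [].
move=> [mu_ iu]; apply/andP; split; first by rewrite inE; exact/mE.
by rewrite inE /= /finite_norm -/(Lp_norm p O u) Lp_norm_npow ?ltry.
Qed.

Lemma Lp_norm_cvg (fn : nat -> V -> R) : (forall n, pint mu O p (fn n)) ->
  (Lp_norm p O (fn n) @[n --> \oo] --> 0%E) <->
  (npow mu O p (fn n) @[n --> \oo] --> 0).
Proof.
move=> pfn.
rewrite (_ : (fun n => Lp_norm p O (fn n)) = EFin \o (fun n => npow mu O p (fn n) `^ p^-1)).
  rewrite -(@cvg_powR_inv _ p (fun n => npow mu O p (fn n)))// => [|n]; last exact: npow_ge0.
  by split => [/fine_cvgP[_]|H]; [|apply/fine_cvgP; split => //; exact: nearW].
by apply/funext => n /=; rewrite Lp_norm_npow.
Qed.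

Lemma Rintegral_vanish f : (forall x, ~ O x -> f x = 0) ->
  \int[mu]_(x in O) f x = \int[mu]_x f x.
Proof.
move=> fO; rewrite Rintegral_mkcond; congr Rintegral; apply/funext => x.
by rewrite patchE; case: ifPn => // /negP Ox; rewrite fO// => /mem_set.
Qed.

Lemma test_bounded phi : test_function O phi -> exists2 K, 0 <= K & forall x, `|phi x| <= K.
Proof.
move=> tp; have [M HM] := test_bounded_supp tp.
by apply: Cc_bounded HM; apply: smooth_continuous; case: tp.
Qed.

Lemma test_partial_bounded phi i : test_function O phi ->
  exists2 K, 0 <= K & forall x, `|partial i phi x| <= K.
Proof.
move=> tp; have [M HM] := test_bounded_supp tp.
apply: (Cc_bounded (M := M)); first by apply: smooth_partial_continuous; case: tp.
exact: test_partial_supp tp HM.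
Qed.

Lemma continuous_measurable_on f : continuous f -> measurable_fun O f.
Proof. by move=> cf; apply: measurable_funTS; exact: continuous_measurable_rV. Qed.

Lemma test_pint r phi : 0 <= r -> test_function O phi -> pint mu O r phi.
Proof.
move=> r0 tp; have [K K0 HK] := test_bounded tp.
have m : measurable_fun O phi.
  by apply: continuous_measurable_on; apply: smooth_continuous; case: tp.
split; first by [].
apply: (le_integrableR mO (g := fun=> K `^ r)).
- exact: measurable_powR_norm.
- by move=> x _; rewrite ger0_norm ?powR_ge0//; apply: le_powR.
- exact: cst_integrableR.
Qed.

Lemma test_partial_pint r i phi : 0 <= r -> test_function O phi ->
  pint mu O r (partial i phi).
Proof.
move=> r0 tp; have [K K0 HK] := test_partial_bounded i tp.
have m : measurable_fun O (partial i phi).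
  by apply: continuous_measurable_on; apply: smooth_partial_continuous; case: tp.
split; first by [].
apply: (le_integrableR mO (g := fun=> K `^ r)).
- exact: measurable_powR_norm.
- by move=> x _; rewrite ger0_norm ?powR_ge0//; apply: le_powR.
- exact: cst_integrableR.
Qed.

Lemma test_by_parts i phi f : test_function O phi -> smooth f ->
  \int[mu]_x (phi x * partial i f x) = - \int[mu]_x (partial i phi x * f x).
Proof.
move=> tp sf; have [sp _ _] := tp; have [M HM] := test_bounded_supp tp.
have := Rintegral_by_parts (smooth_continuous sp) (@smooth_partial_continuous _ _ _ i sp)
  (smooth_continuous sf) (@smooth_partial_continuous _ _ _ i sf)
  (fun x => smooth_is_derive i x sp) (fun x => smooth_is_derive i x sf) HM.
by move=> ->; rewrite opprK.
Qed.

(** [W01p] expressed through [npow]; [W0_weak_gradient] recovers the weak gradient identity from the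
    approximating test functions. *)
Definition W0 u g := [/\ pint mu O p u, forall i, pint mu O p (fun x => g x ord0 i) &
  exists phi : nat -> V -> R, [/\ forall n, test_function O (phi n),
    npow mu O p (fun x => phi n x - u x) @[n --> \oo] --> 0 &
    forall i, npow mu O p (fun x => partial i (phi n) x - g x ord0 i) @[n --> \oo] --> 0]].

(** For test functions the identity is integration by parts, and both of its sides are L^p-L^q
    pairings, hence continuous along the approximation. *)
Lemma W0_weak_gradient u g : W0 u g -> weak_gradient O u g.
Proof.
move=> [pu pg [phi [tphi cu cg]]] psi i tpsi.
pose q := p / (p - 1).
have p10 : 0 < p - 1 by rewrite subr_gt0.
have q0 : 0 < q by rewrite divr_gt0.
have pq : p^-1 + q^-1 = 1 by rewrite /q invf_div; field; rewrite gt_eqF.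
have pphi n : pint mu O p (phi n) by apply: test_pint => //; exact: ltW.
have pdphi n : pint mu O p (partial i (phi n)) by apply: test_partial_pint => //; exact: ltW.
have c1 := pint_cvg_mul mO p1 q0 pq pphi pu (test_partial_pint i (ltW q0) tpsi) cu.
have c2 := pint_cvg_mul mO p1 q0 pq pdphi (pg i) (test_pint (ltW q0) tpsi) (cg i).
apply: (cvg_unique _ c1) => //.
have -> : (fun n => \int[mu]_(x in O) (phi n x * partial i psi x)) =
    (fun n => - \int[mu]_(x in O) (partial i (phi n) x * psi x)).
  apply/funext => n.
  have [s2 _ _] := tpsi.
  rewrite !Rintegral_vanish.
  - exact: test_by_parts.
  - by move=> x Ox; rewrite (test_out tpsi Ox) mulr0.
  - by move=> x Ox; rewrite (test_out (tphi n) Ox) mul0r.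
exact: cvgN.
Qed.

Lemma W01pP u g : W01p p O u g <-> W0 u g.
Proof.
have pu0 u' (phi : nat -> V -> R) : pint mu O p u' -> (forall n, test_function O (phi n)) ->
    forall n : nat, pint mu O p (fun x => phi n x - u' x).
  by move=> pu' tphi n; apply: pintB => //; apply: test_pint => //; exact: ltW.
have pg0 u' (phi : nat -> V -> R) i : pint mu O p u' -> (forall n, test_function O (phi n)) ->
    forall n : nat, pint mu O p (fun x => partial i (phi n) x - u' x).
  by move=> pu' tphi n; apply: pintB => //; apply: test_partial_pint => //; exact: ltW.
split.
  move=> [[/in_Lp_pint pu pg _] [phi [tphi cu cg]]].
  have pg' i : pint mu O p (fun x => g x ord0 i) by apply/in_Lp_pint; exact: pg.
  split; [exact: pu|exact: pg'|exists phi; split; first exact: tphi].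
    exact: (Lp_norm_cvg (pu0 _ _ pu tphi)).1 cu.
  by move=> i; exact: (Lp_norm_cvg (pg0 _ _ i (pg' i) tphi)).1 (cg i).
move=> W; have wg := W0_weak_gradient W; case: W => pu pg [phi [tphi cu cg]].
split; first by split; [exact/in_Lp_pint|move=> i; apply/in_Lp_pint; exact: pg|exact: wg].
exists phi; split; first exact: tphi.
  exact: (Lp_norm_cvg (pu0 _ _ pu tphi)).2 cu.
by move=> i; exact: (Lp_norm_cvg (pg0 _ _ i (pg i) tphi)).2 (cg i).
Qed.

End W0.

Section energy.
Context {R : realType} {D : nat}.
Local Notation V := 'rV[R]_D.
Local Notation mu := (@lebesgue_rV R D).
Local Notation e_ i := (delta_mx ord0 i : V).
Variables (O : set V) (p : R).
Hypotheses (oO : open O) (bO : bounded_set O) (p1 : 1 < p).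
Implicit Types (u w f phi psi : V -> R) (g h : V -> V).

Let p0 : 0 < p. Proof. exact: lt_trans p1. Qed.
Let mO : measurable O. Proof. exact: measurable_open_rV. Qed.
Let muO : (mu O < +oo)%E. Proof. exact: bounded_lebesgue_rV_lty. Qed.

Lemma grad_coord phi i : (fun x => grad phi x ord0 i) = partial i phi.
Proof. by apply/funext => x; rewrite mxE. Qed.

Lemma grad_lin (a b : R) phi psi x : smooth phi -> smooth psi ->
  grad (fun x => a * phi x + b * psi x) x = a *: grad phi x + b *: grad psi x.
Proof. by move=> sp sq; apply/rowP => i; rewrite !mxE partial_lin. Qed.

Lemma test_W0 phi : test_function O phi -> W0 O p phi (grad phi).
Proof.
move=> tp; split => [|i|].
- by apply: test_pint => //; exact: ltW.
- by rewrite grad_coord; apply: test_partial_pint => //; exact: ltW.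
- exists (fun=> phi); split => [//| |i].
    rewrite (_ : (fun=> _) = fun=> 0); first exact: cvg_cst.
    apply/funext => n; rewrite /npow; under eq_Rintegral do rewrite subrr normr0 powR0 ?gt_eqF//.
    by rewrite Rintegral_cst// mul0r.
  rewrite (_ : (fun=> _) = fun=> 0); first exact: cvg_cst.
  apply/funext => n; rewrite /npow; under eq_Rintegral do rewrite mxE subrr normr0 powR0 ?gt_eqF//.
  by rewrite Rintegral_cst// mul0r.
Qed.

Lemma pint_lin (a b : R) f w : pint mu O p f -> pint mu O p w ->
  pint mu O p (fun x => a * f x + b * w x).
Proof. by move=> pf pw; apply: pintD => //; exact: pintZ. Qed.

Lemma npowZ (a : R) f : pint mu O p f ->
  npow mu O p (fun x => a * f x) = `|a| `^ p * npow mu O p f.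
Proof.
move=> [mf fi]; rewrite /npow -RintegralZl//.
by apply: eq_Rintegral => x _; rewrite normrM powRM.
Qed.

Lemma npow_lin_cvg (a b : R) (fn wn : nat -> V -> R) :
  (forall n, pint mu O p (fn n)) -> (forall n, pint mu O p (wn n)) ->
  npow mu O p (fn n) @[n --> \oo] --> 0 -> npow mu O p (wn n) @[n --> \oo] --> 0 ->
  npow mu O p (fun x => a * fn n x + b * wn n x) @[n --> \oo] --> 0.
Proof.
move=> pf pw cf cw.
pose M n := 2 `^ p * (`|a| `^ p * npow mu O p (fn n) + `|b| `^ p * npow mu O p (wn n)).
apply: (@squeeze_cvgr _ _ _ _ (fun=> 0) M).
- apply: nearW => n; rewrite npow_ge0 /=; apply: le_trans (npow_le_add _ _ _ _) _ => //.
  + exact: pintZ.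
  + exact: pintZ.
  + by rewrite !npowZ.
- exact: cvg_cst.
- rewrite -[X in _ --> X](_ : 2 `^ p * (`|a| `^ p * 0 + `|b| `^ p * 0) = 0); last by ring.
  have ca := cvgMl_tmp (a := `|a| `^ p) cf.
  have cb := cvgMl_tmp (a := `|b| `^ p) cw.
  by apply: cvgMl_tmp; apply: cvgD; [exact: ca|exact: cb].
Qed.

Lemma W0_lin (a b : R) u g w h : W0 O p u g -> W0 O p w h ->
  W0 O p (fun x => a * u x + b * w x) (fun x => a *: g x + b *: h x).
Proof.
move=> [pu pg [phi [tphi cu cg]]] [pw ph [psi [tpsi cw ch]]]; split.
- exact: pint_lin.
- move=> i; rewrite (_ : (fun x => _) = (fun x => a * g x ord0 i + b * h x ord0 i)).
    exact: pint_lin.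
  by apply/funext => x; rewrite !mxE.
exists (fun n x => a * phi n x + b * psi n x); split => [n||i].
- exact: test_lin.
- rewrite (_ : (fun n => npow _ _ _ _) = (fun n => npow mu O p
      (fun x => a * (phi n x - u x) + b * (psi n x - w x)))); last first.
    by apply/funext => n; congr npow; apply/funext => x; ring.
  apply: npow_lin_cvg => // n.
    by apply: pintB => //; apply: test_pint => //; exact: ltW.
  by apply: pintB => //; apply: test_pint => //; exact: ltW.
rewrite (_ : (fun n => npow _ _ _ _) = (fun n => npow mu O p
    (fun x => a * (partial i (phi n) x - g x ord0 i) + b * (partial i (psi n) x - h x ord0 i)))).
  apply: npow_lin_cvg; [| |exact: cg|exact: ch] => n.
    by apply: pintB => //; apply: test_partial_pint => //; exact: ltW.
  by apply: pintB => //; apply: test_partial_pint => //; exact: ltW.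
apply/funext => n; congr npow; apply/funext => x.
by have [s1 _ _] := tphi n; have [s2 _ _] := tpsi n; rewrite partial_lin// !mxE; ring.
Qed.

(* Integrate |phi|^p against the derivative of a coordinate by parts. *)
Lemma poincare (i0 : 'I_D) : exists2 C, 0 <= C & forall phi, test_function O phi ->
  npow mu O p phi <= C * npow mu O p (partial i0 phi).
Proof.
pose q := p / (p - 1).
have p10 : 0 < p - 1 by rewrite subr_gt0.
have q0 : 0 < q by rewrite divr_gt0.
have pq : p^-1 + q^-1 = 1 by rewrite /q invf_div; field; rewrite gt_eqF.
have [M M0 HM] : exists2 M : R, 0 < M & forall x, O x -> `|x| <= M.
  have [M [_ HM]] := bO; exists (`|M| + 1); first by rewrite ltr_wpDl.
  by move=> x Ox; apply: HM => //; rewrite (le_lt_trans (ler_norm M))// ltrDl.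
(* After multiplication by p M the term in |phi|^p gets the coefficient 1 / 2 and is absorbed on the
   left. *)
have s0 : 0 < (2 * (p * M))^-1 by rewrite invr_gt0 !mulr_gt0.
have [C C0 HC] := young_eps p0 q0 pq s0.
exists (2 * (p * M * C)); first by rewrite !mulr_ge0// ltW.
move=> phi tp; have [sp _ _] := tp; have [K HK] := test_bounded_supp tp.
have cphi := smooth_continuous sp.
have cdphi : continuous (partial i0 phi) by exact: smooth_partial_continuous.
pose f x := `|phi x| `^ p.
pose df x := p * (Num.sg (phi x) * `|phi x| `^ (p - 1)) * partial i0 phi x.
have cf : continuous f.
  by move=> x; apply: (@continuous_comp _ _ _ phi (fun s : R => `|s| `^ p)); [exact: cphi|exact: powR_norm_continuous].
have cdf : continuous df.
  apply: continuous_mulR => //; apply: continuous_scaleR => x.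
  apply: (@continuous_comp _ _ _ phi (fun s : R => Num.sg s * `|s| `^ (p - 1))); first exact: cphi.
  exact: sg_powR_continuous.
have dfE x : is_derive x (e_ i0) f (df x).
  apply: (@is_derive_compR _ _ (fun s : R => `|s| `^ p)); last exact: is_derive_norm_powR.
  exact: smooth_is_derive.
have fK x : K < `|x| -> f x = 0 by move=> /HK E; rewrite /f E normr0 powR0 ?gt_eqF.
have dw x : is_derive x (e_ i0) (fun y : V => y ord0 i0) 1.
  by have := @is_derive_coord R D i0 i0 x; rewrite eqxx.
have := Rintegral_by_parts cf cdf (@continuous_coordR _ _ i0) (@continuous_cstR _ _ 1) dfE dw fK.
rewrite -!(Rintegral_vanish (O := O)); last first.
- by move=> x Ox; rewrite /df (test_partial_out _ tp Ox) mulr0 mul0r.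
- by move=> x Ox; rewrite /f (test_out tp Ox) normr0 powR0 ?gt_eqF// mul0r.
under [X in _ = - X]eq_Rintegral do rewrite mulr1.
rewrite -/(npow mu O p phi) => E.
have [mphi iphi] : pint mu O p phi by apply: test_pint => //; exact: ltW.
have [mdphi idphi] : pint mu O p (partial i0 phi) by apply: test_partial_pint => //; exact: ltW.
suff : npow mu O p phi <= p * M * C * npow mu O p (partial i0 phi) + 2^-1 * npow mu O p phi.
  by rewrite -[X in _ -> _ <= X]mulrA; move: (npow _ _ _ phi) (p * M * C * _) => y z; lra.
have E' : npow mu O p phi = - \int[mu]_(x in O) (df x * x ord0 i0) by rewrite E opprK.
rewrite {1}E' {E E'}.
have mdf : measurable_fun O (fun x => df x * x ord0 i0).
  apply: (@continuous_measurable_on _ _ O (fun x => df x * x ord0 i0)).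
  by apply: continuous_mulR => //; exact: continuous_coordR.
have bnd x : O x -> `|df x * x ord0 i0| <=
    p * M * C * `|partial i0 phi x| `^ p + 2^-1 * `|phi x| `^ p.
  move=> Ox; have h := HC _ _ (normr_ge0 (partial i0 phi x)) (powR_ge0 `|phi x| (p - 1)).
  have qE : (`|phi x| `^ (p - 1)) `^ q = `|phi x| `^ p.
    by rewrite -powRrM /q mulrCA mulfV ?mulr1// gt_eqF.
  rewrite qE in h.
  have h1 : `|df x| <= p * (`|partial i0 phi x| * `|phi x| `^ (p - 1)).
    rewrite /df !normrM (gtr0_norm p0) normr_sg (ger0_norm (powR_ge0 _ _)).
    rewrite [leRHS]mulrCA [leRHS]mulrC ler_wpM2r// ler_wpM2l ?(ltW p0)//.
    by case: (phi x != 0); rewrite ?mul1r// mul0r powR_ge0.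
  have h2 : `|x ord0 i0| <= M by apply: le_trans (coord_ler_norm _ _) (HM _ Ox).
  rewrite normrM.
  have pM : 0 < p * M by rewrite mulr_gt0.
  apply: (@le_trans _ _ ((p * M) * (`|partial i0 phi x| * `|phi x| `^ (p - 1)))).
    rewrite mulrAC; apply: ler_pM => //.
  apply: (@le_trans _ _ ((p * M) * (C * `|partial i0 phi x| `^ p + (2 * (p * M))^-1 * `|phi x| `^ p))).
    by rewrite ler_wpM2l// ltW.
  move: (`|partial i0 phi x| `^ p) (`|phi x| `^ p) (p * M) pM => y z t t0.
  by rewrite le_eqVlt; apply/orP; left; apply/eqP; field; rewrite gt_eqF.
rewrite /npow -!RintegralZl// -RintegralD//; [|exact: integrableZR|exact: integrableZR].
have ib : mu.-integrable O (EFin \o (fun x => p * M * C * `|partial i0 phi x| `^ p + 2^-1 * `|phi x| `^ p)).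
  by apply: integrableDR => //; exact: integrableZR.
have ii : mu.-integrable O (EFin \o (fun x => df x * x ord0 i0)).
  exact: le_integrableR ib.
rewrite -mulN1r -RintegralZl//; apply: le_Rintegral => //; first exact: integrableZR.
by move=> x Ox; rewrite mulN1r (le_trans _ (bnd x Ox))// -normrN ler_norm.
Qed.

End energy.

(** * The field |b|^(p - 2) b *)

Section vector_field_convexity.
Context {R : realType} {D : nat}.
Local Notation V := 'rV[R]_D.
Implicit Types (a b h : V) (p : R).

Lemma enorm_powB2 p b : 0 < p -> enorm b `^ (p - 2) * dotrV b b = enorm b `^ p.
Proof.
move=> p0; have [->|/eqP b0] := eqVneq b 0; first by rewrite dotrV0l mulr0 enorm0 powR0 ?gt_eqF.
have b1 : 0 < enorm b.
  by rewrite lt_neqAle enorm_ge0 andbT eq_sym; apply/eqP => /enorm_eq0.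
rewrite -sqr_enorm -powR_mulrn ?enorm_ge0// -powRD; last by rewrite (gt_eqF b1) implybT.
by rewrite subrK.
Qed.

Lemma enorm_powB2_le p b h : 1 < p ->
  `|enorm b `^ (p - 2) * dotrV b h| <= enorm b `^ (p - 1) * enorm h.
Proof.
move=> p1; have [->|/eqP b0] := eqVneq b 0.
  by rewrite dotrV0l mulr0 normr0 mulr_ge0 ?powR_ge0 ?enorm_ge0.
have b1 : 0 < enorm b.
  by rewrite lt_neqAle enorm_ge0 andbT eq_sym; apply/eqP => /enorm_eq0.
have -> : enorm b `^ (p - 1) = enorm b `^ (p - 2) * enorm b.
  have -> : p - 1 = (p - 2) + 1 by ring.
  rewrite [LHS]powRD; last by rewrite (gt_eqF b1) implybT.
  by rewrite powRr1 ?enorm_ge0.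
rewrite normrM (ger0_norm (powR_ge0 _ _)) -mulrA.
by rewrite ler_wpM2l ?powR_ge0// norm_dotrV.
Qed.

(** The supporting hyperplane of the convex function |.|^p at b. It comes from Cauchy-Schwarz and
    Young's inequality instead of a derivative, which would be awkward at b = 0. *)
Lemma enorm_powR_tangent p a b : 1 < p ->
  enorm b `^ p + p * (enorm b `^ (p - 2) * dotrV b (a - b)) <= enorm a `^ p.
Proof.
move=> p1; have p0 : 0 < p by exact: lt_trans p1.
have p10 : 0 < p - 1 by rewrite subr_gt0.
pose q := p / (p - 1).
have q0 : 0 < q by rewrite divr_gt0.
have pq : p^-1 + q^-1 = 1 by rewrite /q invf_div; field; rewrite gt_eqF.
rewrite dotrVDr dotrVNr mulrBr enorm_powB2//.
have h1 := le_trans (ler_norm _) (enorm_powB2_le b a p1).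
have := conjugate_powR (enorm_ge0 a) (powR_ge0 (enorm b) (p - 1)) p0 q0 pq.
have -> : (enorm b `^ (p - 1)) `^ q = enorm b `^ p.
  by rewrite -powRrM /q mulrCA mulfV ?mulr1// gt_eqF.
rewrite [enorm a * _]mulrC.
move: h1; move: (enorm b `^ (p - 2) * _) (enorm b `^ (p - 1) * _) => x y xy.
have -> : q^-1 = 1 - p^-1 by rewrite -pq; ring.
move: (enorm a `^ p) (enorm b `^ p) => A B /(le_trans xy) h.
have : p * x <= p * (A / p + B * (1 - p^-1)) by rewrite ler_pM2l.
have -> : p * (A / p + B * (1 - p^-1)) = A + p * B - B by field; rewrite gt_eqF.
lra.
Qed.

Lemma dotrV_continuous h : continuous (fun b : V => dotrV b h).
Proof.
apply: (@lipschitz_continuousR _ _ _ (D%:R * enorm h)).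
  by rewrite mulr_ge0 ?enorm_ge0.
move=> x y; rewrite (_ : _ - _ = dotrV (x - y) h); last by rewrite dotrVDl dotrVNl.
apply: le_trans (norm_dotrV _ _) _; rewrite mulrAC ler_wpM2r ?enorm_ge0//.
exact: enorm_ler_norm.
Qed.

(** For p < 2 the factor |b|^(p - 2) is unbounded near 0; the product is still at most |b|^(p - 1)
    |h|, which vanishes there. *)
Lemma enorm_powB2_continuous p h : 1 < p ->
  continuous (fun b : V => enorm b `^ (p - 2) * dotrV b h).
Proof.
move=> p1 b; have p10 : 0 < p - 1 by rewrite subr_gt0.
have [->|/eqP b0] := eqVneq b 0.
  apply/(@cvgrPdist_le _ _ _ (nbhs (0 : V))) => e e0.
  have c : (fun b : V => `|enorm b| `^ (p - 1) * enorm h) b @[b --> (0 : V)] -->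
      `|enorm (0 : V)| `^ (p - 1) * enorm h.
    apply: (@continuous_mulR _ _ (fun b : V => `|enorm b| `^ (p - 1)) (fun=> enorm h)).
      move=> x; apply: (@continuous_comp _ _ _ (enorm : V -> R) (fun s : R => `|s| `^ (p - 1))).
        exact: enorm_continuous.
      exact: powR_norm_continuous.
    exact: continuous_cstR.
  move/(@cvgrPdist_le _ _ _ (nbhs (0 : V)))/(_ e e0) : c; apply: filterS => x.
  have -> : `|enorm (0 : V)| `^ (p - 1) * enorm h = 0 by rewrite enorm0 normr0 powR0 ?gt_eqF// mul0r.
  rewrite dotrV0l mulr0 !sub0r !normrN.
  apply: le_trans; apply: le_trans (enorm_powB2_le _ _ p1) _.
  by rewrite ger0_norm ?mulr_ge0 ?powR_ge0 ?enorm_ge0// ger0_norm ?enorm_ge0.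
have b1 : 0 < enorm b.
  by rewrite lt_neqAle enorm_ge0 andbT eq_sym; apply/eqP => /enorm_eq0.
have [dp _] := is_derive_powR (p - 2) b1.
apply: (@cvgM _ _ (nbhs b) _ (fun b : V => enorm b `^ (p - 2)) (fun b : V => dotrV b h)); last first.
  exact: dotrV_continuous.
apply: (@continuous_comp _ _ _ (enorm : V -> R) (@powR R ^~ (p - 2))).
  exact: enorm_continuous.
by apply: differentiable_continuous; apply/derivable1_diffP.
Qed.

End vector_field_convexity.

Section dominated_Rintegral.
Context {d} {T : measurableType d} {R : realType}.
Variables (mu : {measure set T -> \bar R}) (O : set T).
Hypothesis mO : measurable O.

Lemma dominated_Rintegral (fn : nat -> T -> R) (f G : T -> R) :
  (forall n, measurable_fun O (fn n)) -> mu.-integrable O (EFin \o G) ->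
  mu.-integrable O (EFin \o f) ->
  (forall x, O x -> fn n x @[n --> \oo] --> f x) ->
  (forall n x, O x -> `|fn n x| <= G x) ->
  \int[mu]_(x in O) fn n x @[n --> \oo] --> \int[mu]_(x in O) f x.
Proof.
move=> mf iG fi cf bf.
have ifn n : mu.-integrable O (EFin \o fn n) by apply: le_integrableR (bf n) iG.
have := @dominated_cvg _ _ _ mu O mO (fun n => EFin \o fn n) (EFin \o f) (EFin \o G).
move=> H; have {}H : (\int[mu]_(x in O) (EFin \o fn n) x)%E @[n --> \oo] -->
    (\int[mu]_(x in O) (EFin \o f) x)%E.
  apply: H => //.
  - by move=> n; apply/measurable_EFinP.
  - by move=> x Ox; apply/cvg_EFin; [exact: nearW|exact: cf].
have fin := integrable_fin_num mO fi.
rewrite /Rintegral; apply: fine_cvg; rewrite fineK//; exact: H.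
Qed.

End dominated_Rintegral.

Section vector_pint.
Context {R : realType} {D : nat}.
Local Notation V := 'rV[R]_D.
Local Notation mu := (@lebesgue_rV R D).
Variables (O : set V) (p : R).
Hypotheses (oO : open O) (bO : bounded_set O) (p1 : 1 < p).
Implicit Types (u w f phi psi : V -> R) (g h : V -> V).

Let p0 : 0 < p. Proof. exact: lt_trans p1. Qed.
Let mO : measurable O. Proof. exact: measurable_open_rV. Qed.
Let muO : (mu O < +oo)%E. Proof. exact: bounded_lebesgue_rV_lty. Qed.

Definition mvec g := forall i, measurable_fun O (fun x => g x ord0 i).
Definition pvec g := forall i, pint mu O p (fun x => g x ord0 i).
Definition vpow g := npow mu O p (fun x => enorm (g x)).

Lemma pvec_measurable g : pvec g -> mvec g.
Proof. by move=> pg i; have [] := pg i. Qed.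

Lemma measurable_dotrV g h : mvec g -> mvec h -> measurable_fun O (fun x => dotrV (g x) (h x)).
Proof. by move=> mg mh; apply: measurable_sum => i; apply: measurable_funM. Qed.

Lemma measurable_enorm g : mvec g -> measurable_fun O (fun x => enorm (g x)).
Proof.
have ms : measurable_fun setT (Num.sqrt : R -> R) := continuous_measurable_fun (@sqrt_continuous R).
by move=> mg; exact: (measurableT_comp ms (measurable_dotrV mg mg)).
Qed.

Lemma vpowE g : vpow g = \int[mu]_(x in O) (enorm (g x) `^ p).
Proof. by apply: eq_Rintegral => x _; rewrite ger0_norm ?enorm_ge0. Qed.

Lemma pint_sum (I : Type) (s : seq I) (f : I -> V -> R) :
  (forall i, pint mu O p (f i)) -> pint mu O p (fun x => \sum_(i <- s) f i x).
Proof.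
move=> pf; elim: s => [|i s IH].
  by under eq_fun do rewrite big_nil; apply: (pint_bounded mO p1 (K := 0)) => // x _; rewrite normr0.
by under eq_fun do rewrite big_cons; exact: pintD.
Qed.

Lemma pint_norm f : pint mu O p f -> pint mu O p (fun x => `|f x|).
Proof.
move=> pf; have [mf _] := pf.
apply: (pint_le mO (ltW p0) _ _ pf); last by move=> x _; rewrite normr_id.
exact: measurableT_comp.
Qed.

Lemma npow_sum_cvg (I : Type) (s : seq I) (f : I -> nat -> V -> R) :
  (forall i n, pint mu O p (f i n)) ->
  (forall i, npow mu O p (f i n) @[n --> \oo] --> 0) ->
  npow mu O p (fun x => \sum_(i <- s) f i n x) @[n --> \oo] --> 0.
Proof.
move=> pf cf; elim: s => [|i s IH].
  rewrite (_ : (fun=> _) = fun=> 0); first exact: cvg_cst.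
  apply/funext => n; rewrite /npow; under eq_Rintegral do rewrite big_nil normr0 powR0 ?gt_eqF//.
  by rewrite Rintegral_cst// mul0r.
rewrite (_ : (fun n => _) = (fun n => npow mu O p (fun x => 1 * f i n x + 1 * \sum_(j <- s) f j n x))).
  apply: npow_lin_cvg; [exact: oO|exact: p1|exact: pf|by move=> n; apply: pint_sum => j; exact: pf|exact: cf|exact: IH].
by apply/funext => n; congr npow; apply/funext => x; rewrite big_cons !mul1r.
Qed.

Lemma pvec_enorm g : pvec g -> pint mu O p (fun x => enorm (g x)).
Proof.
move=> pg; apply: (@pint_le _ _ _ _ _ mO _ _ (fun x => \sum_i `|g x ord0 i|)); first exact: ltW.
- by apply: measurable_enorm; exact: pvec_measurable.
- move=> x _; rewrite !ger0_norm ?enorm_ge0 ?sumr_ge0//; exact: enorm_ler_sum.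
- by apply: pint_sum => i; exact: pint_norm.
Qed.

Lemma pvec_lin (a b : R) g h : pvec g -> pvec h -> pvec (fun x => a *: g x + b *: h x).
Proof.
move=> pg ph i; rewrite (_ : (fun x => _) = (fun x => a * g x ord0 i + b * h x ord0 i)).
  exact: pint_lin.
by apply/funext => x; rewrite !mxE.
Qed.

Lemma vpow_cvg (gn : nat -> V -> V) g : (forall n, pvec (gn n)) -> pvec g ->
  (forall i, npow mu O p (fun x => gn n x ord0 i - g x ord0 i) @[n --> \oo] --> 0) ->
  vpow (gn n) @[n --> \oo] --> vpow g.
Proof.
move=> pgn pg cg.
have pd n i : pint mu O p (fun x => `|gn n x ord0 i - g x ord0 i|).
  exact: (pint_norm (pintB mO p1 (pgn n i) (pg i))).
apply: (@npow_cvg _ _ _ mu O p mO p1 _ _ (fun n x => \sum_i `|gn n x ord0 i - g x ord0 i|)).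
- by move=> n; exact: pvec_enorm.
- exact: pvec_enorm.
- by move=> n; apply: pint_sum => i; exact: pd.
- move=> n x _; apply: le_trans (ler_dist_enorm _ _) _; apply: le_trans (enorm_ler_sum _) _.
  rewrite [leRHS]ger0_norm ?sumr_ge0//; apply: ler_sum => i _; by rewrite !mxE.
- apply: (@npow_sum_cvg _ _ (fun i n x => `|gn n x ord0 i - g x ord0 i|)) => [i n|i]; first exact: pd.
  have E n : npow mu O p (fun x => `|gn n x ord0 i - g x ord0 i|) =
      npow mu O p (fun x => gn n x ord0 i - g x ord0 i).
    by apply: eq_Rintegral => x _; rewrite normr_id.
  rewrite (funext E); exact: cg.
Qed.

End vector_pint.

(** * The direct method *)

Section minimizer.
Context {R : realType} {D : nat}.
Local Notation V := 'rV[R]_D.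
Local Notation mu := (@lebesgue_rV R D).
Variables (O : set V) (p : R) (i0 : 'I_D).
Hypotheses (oO : open O) (bO : bounded_set O) (p1 : 1 < p).
Implicit Types (u w f phi psi : V -> R) (g h : V -> V).

Let p0 : 0 < p. Proof. exact: lt_trans p1. Qed.
Let mO : measurable O. Proof. exact: measurable_open_rV. Qed.
Let muO : (mu O < +oo)%E. Proof. exact: bounded_lebesgue_rV_lty. Qed.

Lemma vpow_ge0 g : 0 <= vpow O p g. Proof. exact: npow_ge0. Qed.

Lemma pvec_integrable g : pvec O p g ->
  mu.-integrable O (EFin \o (fun x => enorm (g x) `^ p)).
Proof.
move=> pg; have [_] := pvec_enorm oO bO p1 pg.
by under eq_fun do rewrite ger0_norm ?enorm_ge0//.
Qed.

Lemma npow_coord_le g i : pvec O p g -> npow mu O p (fun x => g x ord0 i) <= vpow O p g.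
Proof.
move=> pg; rewrite vpowE; apply: le_Rintegral => //; first by have [] := pg i.
  exact: pvec_integrable.
by move=> x _; apply: le_powR; [exact: ltW| |exact: coord_ler_enorm].
Qed.

Lemma test_pvec phi : test_function O phi -> pvec O p (grad phi).
Proof. by move=> tp; have [] := test_W0 oO bO p1 tp. Qed.

Lemma pint_int f : pint mu O p f -> mu.-integrable O (EFin \o f).
Proof. exact: pint_integrable. Qed.

Lemma test_int phi : test_function O phi -> mu.-integrable O (EFin \o phi).
Proof. by move=> tp; apply: pint_int; apply: test_pint => //; exact: ltW. Qed.

Lemma vpow_uniform_convexity (s : R) : 0 < s -> exists2 C, 0 <= C & forall g h,
  pvec O p g -> pvec O p h ->
  vpow O p (fun x => g x - h x) <= s * (vpow O p g + vpow O p h) +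
    C * (vpow O p g + vpow O p h - 2 * vpow O p (fun x => 2^-1 *: g x + 2^-1 *: h x)).
Proof.
move=> s0; have [C C0 HC] := @uniform_convexity R D p s p1 s0.
exists C => // g h pg ph.
have pd : pvec O p (fun x => g x - h x).
  have := pvec_lin oO p1 1 (-1) pg ph.
  by rewrite (_ : (fun x => _) = (fun x => g x - h x))//; apply/funext => x; rewrite scale1r scaleN1r.
have pm := pvec_lin oO p1 2^-1 2^-1 pg ph.
have ig := pvec_integrable pg; have ih := pvec_integrable ph.
have im := pvec_integrable pm; have id := pvec_integrable pd.
have igh := integrableDR mO ig ih.
have i2m := integrableZR mO 2 im.
have igm := integrableBR mO igh i2m.
have i1 := integrableZR mO s igh; have i2 := integrableZR mO C igm.
have le x : O x -> enorm (g x - h x) `^ p <= s * (enorm (g x) `^ p + enorm (h x) `^ p) +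
    C * (enorm (g x) `^ p + enorm (h x) `^ p - 2 * enorm (2^-1 *: g x + 2^-1 *: h x) `^ p).
  by move=> _; rewrite -scalerDr; exact: HC.
have := le_Rintegral mO id (integrableDR mO i1 i2) le.
rewrite (RintegralD mO i1 i2) (RintegralZl s mO igh) (RintegralZl C mO igm).
by rewrite (RintegralB mO igh i2m) (RintegralZl 2 mO im) (RintegralD mO ig ih) !vpowE.
Qed.

Definition energy u g := p^-1 * vpow O p g - \int[mu]_(x in O) u x.

Lemma pint_cst1 r : pint mu O r (cst (1 : R)).
Proof.
split; first exact: measurable_cst.
rewrite (_ : _ \o _ = EFin \o (fun=> `|1 : R| `^ r))//; exact: cst_integrableR.
Qed.

Lemma npow_cvg_int (phi : nat -> V -> R) u : (forall n, pint mu O p (phi n)) -> pint mu O p u ->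
  npow mu O p (fun x => phi n x - u x) @[n --> \oo] --> 0 ->
  \int[mu]_(x in O) phi n x @[n --> \oo] --> \int[mu]_(x in O) u x.
Proof.
move=> pphi pu cu.
pose q := p / (p - 1).
have p10 : 0 < p - 1 by rewrite subr_gt0.
have q0 : 0 < q by rewrite divr_gt0.
have pq : p^-1 + q^-1 = 1 by rewrite /q invf_div; field; rewrite gt_eqF.
have := pint_cvg_mul mO p1 q0 pq pphi pu (pint_cst1 q) cu.
have E f : \int[mu]_(x in O) (f x * cst 1 x) = \int[mu]_(x in O) f x.
  by apply: eq_Rintegral => x _; rewrite mulr1.
by rewrite E (funext (fun n => E (phi n))).
Qed.

Lemma energy_cvg (phi : nat -> V -> R) u g : (forall n, test_function O (phi n)) ->
  pint mu O p u -> pvec O p g ->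
  npow mu O p (fun x => phi n x - u x) @[n --> \oo] --> 0 ->
  (forall i, npow mu O p (fun x => partial i (phi n) x - g x ord0 i) @[n --> \oo] --> 0) ->
  energy (phi n) (grad (phi n)) @[n --> \oo] --> energy u g.
Proof.
move=> tphi pu pg cu cg; rewrite /energy.
have c1 : \int[mu]_(x in O) phi n x @[n --> \oo] --> \int[mu]_(x in O) u x.
  by apply: npow_cvg_int => // n; apply: test_pint => //; exact: ltW.
have c2 : vpow O p (grad (phi n)) @[n --> \oo] --> vpow O p g.
  apply: (vpow_cvg oO bO p1 (fun n => test_pvec (tphi n)) pg) => i.
  have E n : npow mu O p (fun x => grad (phi n) x ord0 i - g x ord0 i) =
      npow mu O p (fun x => partial i (phi n) x - g x ord0 i).
    by congr npow; apply/funext => x; rewrite mxE.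
  rewrite (funext E); exact: cg.
exact: (cvgB (cvgMl_tmp (a := p^-1) c2) c1).
Qed.

(** The linear term is bounded by a constant plus a small multiple of \int |phi|^p, and by
    [poincare] this multiple costs only half of the gradient term. *)
Lemma energy_coercive : exists C, forall phi, test_function O phi ->
  (2 * p)^-1 * vpow O p (grad phi) - C <= energy phi (grad phi).
Proof.
have [C C0 HC] := poincare oO bO p1 i0.
have C1 : 0 < 2 * p * (C + 1) by rewrite !mulr_gt0// ltr_wpDl.
have p10 : 0 < p - 1 by rewrite subr_gt0.
(* The solution of t^(1 - p) = 1 / (2 p (C + 1)); C + 1 instead of C avoids dividing by 0. *)
pose t := (2 * p * (C + 1)) `^ (p - 1)^-1.
have t0 : 0 < t by rewrite powR_gt0.
have tE : t `^ (1 - p) = (2 * p * (C + 1))^-1.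
  rewrite /t -powRrM (_ : (p - 1)^-1 * (1 - p) = -1); last by field; rewrite gt_eqF.
  by rewrite powR_inv1// ltW.
exists (t * fine (mu O)) => phi tp.
have pphi : pint mu O p phi by apply: test_pint => //; exact: ltW.
have [mphi iphi] := pphi.
have h1 : \int[mu]_(x in O) phi x <= t * fine (mu O) + t `^ (1 - p) * npow mu O p phi.
  rewrite -Rintegral_cst// -RintegralZl// -RintegralD//; [|exact: cst_integrableR|exact: integrableZR].
  apply: le_Rintegral => //; first exact: test_int.
    by apply: integrableDR => //; [exact: cst_integrableR|exact: integrableZR].
  by move=> x _; rewrite (le_trans (ler_norm _))//; apply: le_powR_scale => //; exact: ltW.
have h2 : npow mu O p phi <= C * vpow O p (grad phi).
  apply: le_trans (HC _ tp) _; rewrite ler_wpM2l//.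
  by rewrite -grad_coord; apply: npow_coord_le; exact: test_pvec.
have h3 : t `^ (1 - p) * npow mu O p phi <= (2 * p)^-1 * vpow O p (grad phi).
  rewrite tE; apply: (@le_trans _ _ ((2 * p * (C + 1))^-1 * (C * vpow O p (grad phi)))).
    by rewrite ler_wpM2l// invr_ge0 ltW.
  rewrite invfM -mulrA ler_wpM2l ?invr_ge0 ?mulr_ge0 ?(ltW p0)//.
  by rewrite mulrA ler_piMl ?vpow_ge0// ler_pdivrMl ?ltr_wpDl// mulr1 lerDl.
rewrite /energy.
have -> : p^-1 = (2 * p)^-1 + (2 * p)^-1 by field; rewrite gt_eqF.
rewrite [X in _ <= X - _]mulrDl; move: h1 h3.
move: ((2 * p)^-1 * _) (t * _) (_ `^ _ * _) (\int[mu]_(x in O) phi x) => a b c e; lra.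
Qed.

(** The linear part of the energy cancels at the midpoint, so the convexity defect of the gradient
    terms is a defect of energies, which the infimum controls. *)
Lemma energy_midpoint phi psi : test_function O phi -> test_function O psi ->
  let chi := fun x => 2^-1 * phi x + 2^-1 * psi x in
  p^-1 * (vpow O p (grad phi) + vpow O p (grad psi) -
    2 * vpow O p (fun x => 2^-1 *: grad phi x + 2^-1 *: grad psi x)) =
  energy phi (grad phi) + energy psi (grad psi) - 2 * energy chi (grad chi).
Proof.
move=> tp ts chi; rewrite /energy.
have -> : grad chi = (fun x => 2^-1 *: grad phi x + 2^-1 *: grad psi x).
  by apply/funext => x; have [s1 _ _] := tp; have [s2 _ _] := ts; rewrite grad_lin.
have -> : \int[mu]_(x in O) chi x =
    2^-1 * \int[mu]_(x in O) phi x + 2^-1 * \int[mu]_(x in O) psi x.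
  have i1 := test_int tp; have i2 := test_int ts.
  by rewrite -!RintegralZl// -RintegralD//; exact: integrableZR.
have alg (A B M a b : R) : p^-1 * (A + B - 2 * M) =
    p^-1 * A - a + (p^-1 * B - b) - 2 * (p^-1 * M - (2^-1 * a + 2^-1 * b)) by field; rewrite gt_eqF.
exact: alg.
Qed.

(** Midpoints of test functions are test functions, so their energies are at least the infimum, and
    uniform convexity makes a minimizing sequence Cauchy: first its gradients, then, by [poincare],
    the functions themselves. The energy is continuous along the strong limit. *)
Lemma energy_minimizer : exists u g, W0 O p u g /\
  forall w h, W0 O p w h -> energy u g <= energy w h.
Proof.
have [C HC] := energy_coercive.
have [P P0 HP] := poincare oO bO p1 i0.
pose E := [set r | exists2 phi, test_function O phi & r = energy phi (grad phi)].
have E0 : E !=set0 by exists (energy (fun=> 0) (grad (fun=> 0))); exists (fun=> 0) => //; exact: test0.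
have Elb : lbound E (- C).
  move=> _ [phi tp ->]; apply: le_trans (HC _ tp).
  by rewrite lerDr mulr_ge0 ?vpow_ge0// invr_ge0 mulr_ge0// ltW.
have hE : has_inf E by split => //; exists (- C).
pose m := inf E.
have mle phi : test_function O phi -> m <= energy phi (grad phi).
  by move=> tp; apply: ge_inf; [case: hE|exists phi].
have /choice[phi Hphi] : forall n : nat, exists phi, test_function O phi /\
    energy phi (grad phi) < m + n.+1%:R^-1.
  move=> n; have [||_ [phi tp ->] lt] := @inf_adherent _ E n.+1%:R^-1 => //.
  by exists phi.
have tphi n : test_function O (phi n) by case: (Hphi n).
have ephi n : energy (phi n) (grad (phi n)) < m + n.+1%:R^-1 by case: (Hphi n).
(* The energies lie below m + 1, so coercivity bounds all gradient terms by B. *)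
pose B := 2 * p * (m + 1 + C).
have vB n : vpow O p (grad (phi n)) <= B.
  rewrite /B -ler_pdivrMl ?mulr_gt0//.
  have h1 := HC _ (tphi n); have h2 := ephi n.
  have h3 : n.+1%:R^-1 <= 1 :> R by rewrite invf_le1 ?ler1n.
  by rewrite -lerBlDr; apply: le_trans h1 _; apply: le_trans (ltW h2) _; rewrite lerD2l.
have B0 : 0 <= B by apply: le_trans (vB 0%N); exact: vpow_ge0.
have cau e : 0 < e -> exists N, forall k n, (N <= k)%N -> (N <= n)%N ->
    vpow O p (fun x => grad (phi k) x - grad (phi n) x) <= e.
  move=> e0; have s0 : 0 < e / (4 * (B + 1)) by rewrite divr_gt0// mulr_gt0// ltr_wpDl.
  have [K K0 HK] := vpow_uniform_convexity s0.
  (* Beyond N the energies exceed the infimum by at most 1 / (N + 1), the convexity defect is at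
     most 2 p / (N + 1), and K times it is at most e / 2. *)
  pose N := Num.bound (4 * K * p / e).
  exists N => k n Nk Nn.
  apply: le_trans (HK _ _ (test_pvec (tphi k)) (test_pvec (tphi n))) _.
  rewrite [leRHS]splitr.
  apply: lerD.
    apply: (@le_trans _ _ (e / (4 * (B + 1)) * (2 * B))).
      by rewrite ler_wpM2l ?(ltW s0)// mulr_natl mulr2n lerD.
    rewrite mulrAC ler_pdivrMr ?mulr_gt0 ?ltr_wpDl//.
    have -> : e / 2 * (4 * (B + 1)) = e * (2 * (B + 1)) by field.
    by rewrite ler_wpM2l ?(ltW e0)// ler_wpM2l// lerDl.
  have md := energy_midpoint (tphi k) (tphi n); cbv zeta in md.
  set md1 := (X in p^-1 * X = _) in md; rewrite -/md1.
  have tc : test_function O (fun x => 2^-1 * phi k x + 2^-1 * phi n x) by exact: test_lin.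
  have hm := mle _ tc.
  have N1 j : (N <= j)%N -> j.+1%:R^-1 <= N.+1%:R^-1 :> R.
    by move=> Nj; rewrite lef_pV2 ?posrE// ler_nat.
  have h4 : md1 <= 2 * p * N.+1%:R^-1.
    rewrite -ler_pdivrMl ?mulr_gt0// invfM -mulrA md.
    have := ephi k; have := ephi n; have := N1 _ Nk; have := N1 _ Nn; move: hm.
    have alg (a b c x y z r : R) : r <= c -> x <= z -> y <= z -> a < r + x -> b < r + y ->
      2^-1 * (b + a - 2 * c) <= z by lra.
    exact: alg.
  apply: (@le_trans _ _ (K * (2 * p * N.+1%:R^-1))); first by rewrite ler_wpM2l.
  have SN : 4 * K * p / e < N.+1%:R.
    apply: (@lt_trans _ _ N%:R); last by rewrite ltr_nat.
    by apply: archi_boundP; rewrite divr_ge0 ?mulr_ge0// ltW.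
  move: SN; rewrite ltr_pdivrMr// => /ltW SN.
  rewrite mulrA ler_pdivrMr ?ltr0n//.
  have -> : K * (2 * p) = (4 * K * p) / 2 by field.
  by rewrite [leRHS]mulrAC ler_pM2r ?invr_gt0// [leRHS]mulrC.
have pphi n : pint mu O p (phi n) by apply: test_pint => //; exact: ltW.
have pdphi i n : pint mu O p (partial i (phi n)) by apply: test_partial_pint => //; exact: ltW.
have pgd k n : pvec O p (fun x => grad (phi k) x - grad (phi n) x).
  move=> i; rewrite (_ : (fun x => _) = (fun x => partial i (phi k) x - partial i (phi n) x)).
    exact: pintB.
  by apply/funext => x; rewrite !mxE.
have cau_i i e : 0 < e -> exists N, forall k n, (N <= k)%N -> (N <= n)%N ->
    npow mu O p (fun x => partial i (phi k) x - partial i (phi n) x) <= e.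
  move=> /cau[N HN]; exists N => k n Nk Nn; apply: le_trans (HN _ _ Nk Nn).
  apply: le_trans (npow_coord_le i (pgd k n)).
  by rewrite le_eqVlt; apply/orP; left; apply/eqP; congr npow; apply/funext => x; rewrite !mxE.
have cau_0 e : 0 < e -> exists N, forall k n, (N <= k)%N -> (N <= n)%N ->
    npow mu O p (fun x => phi k x - phi n x) <= e.
  move=> e0; have P1 : 0 < P + 1 by rewrite ltr_wpDl.
  have [N HN] := cau_i i0 _ (divr_gt0 e0 P1).
  exists N => k n Nk Nn; have {HN} := HN _ _ Nk Nn.
  have td : test_function O (fun x => 1 * phi k x + (-1) * phi n x) by exact: test_lin.
  have [s1 _ _] := tphi k; have [s2 _ _] := tphi n.
  have E1 : (fun x => 1 * phi k x + (-1) * phi n x) = (fun x => phi k x - phi n x).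
    by apply/funext => x; rewrite mul1r mulN1r.
  have E2 : partial i0 (fun x => 1 * phi k x + (-1) * phi n x) =
      (fun x => partial i0 (phi k) x - partial i0 (phi n) x).
    by apply/funext => x; rewrite partial_lin// mul1r mulN1r.
  have := HP _ td; rewrite E2 E1 => h1 h2; apply: (le_trans h1).
  apply: (@le_trans _ _ (P * (e / (P + 1)))); first by rewrite ler_wpM2l.
  by rewrite mulrCA ler_piMr ?(ltW e0)// ler_pdivrMr// mul1r lerDl.
have [u pu cu] := Lp_complete mO muO p1 pphi cau_0.
have /choice[gi Hgi] : forall i, exists f, pint mu O p f /\
    npow mu O p (fun x => partial i (phi n) x - f x) @[n --> \oo] --> 0.
  by move=> i; have [f pf cf] := Lp_complete mO muO p1 (pdphi i) (cau_i i); exists f.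
pose g (x : V) : V := \row_i gi i x.
have giE i : (fun x => g x ord0 i) = gi i by apply/funext => x; rewrite mxE.
have pg : pvec O p g by move=> i; rewrite giE; case: (Hgi i).
have cg i : npow mu O p (fun x => partial i (phi n) x - g x ord0 i) @[n --> \oo] --> 0.
  have E1 n : npow mu O p (fun x => partial i (phi n) x - g x ord0 i) =
      npow mu O p (fun x => partial i (phi n) x - gi i x).
    by congr npow; apply/funext => x; rewrite mxE.
  rewrite (funext E1); exact: (Hgi i).2.
have ce := energy_cvg tphi pu pg cu cg.
have cm : energy (phi n) (grad (phi n)) @[n --> \oo] --> m.
  apply: (@squeeze_cvgr _ _ _ _ (fun=> m) (fun n => m + n.+1%:R^-1)).
  - by apply: nearW => n; rewrite mle//= ltW.
  - exact: cvg_cst.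
  - rewrite -[X in _ --> X]addr0; apply: cvgD; first exact: cvg_cst.
    exact: cvg_harmonic.
have em : energy u g = m by exact: (cvg_unique _ ce cm).
exists u, g; split; first by split => //; exists phi.
move=> w h [pw ph [psi [tpsi cw ch]]]; rewrite em.
apply: (cvgr_to_ge (energy_cvg tpsi pw ph cw ch)).
by apply: nearW => n; exact: mle.
Qed.

End minimizer.

(** * The Euler-Lagrange equation and the two dual bounds *)

Section torsion.
Context {R : realType} {D : nat}.
Local Notation V := 'rV[R]_D.
Local Notation mu := (@lebesgue_rV R D).
Variables (O : set V) (p : R).
Hypotheses (oO : open O) (bO : bounded_set O) (p1 : 1 < p).
Implicit Types (u w f phi psi : V -> R) (g h : V -> V).

Let p0 : 0 < p. Proof. exact: lt_trans p1. Qed.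
Let mO : measurable O. Proof. exact: measurable_open_rV. Qed.
Let muO : (mu O < +oo)%E. Proof. exact: bounded_lebesgue_rV_lty. Qed.

Local Notation flux g h x := (enorm (g x) `^ (p - 2) * dotrV (g x) (h x)).

Lemma flux_le g h x (G : R) : enorm (g x) <= G -> enorm (h x) <= G -> `|flux g h x| <= G `^ p.
Proof.
move=> gG hG; apply: le_trans (enorm_powB2_le _ _ p1) _.
have G0 : 0 <= G by apply: le_trans gG; exact: enorm_ge0.
rewrite -(mulr_powRB1 G0 p0) mulrC; apply: ler_pM; rewrite ?enorm_ge0 ?powR_ge0//.
by apply: le_powR => //; [rewrite subr_ge0 ltW|exact: enorm_ge0].
Qed.

Lemma flux_measurable g h : mvec O g -> mvec O h -> measurable_fun O (fun x => flux g h x).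
Proof.
move=> mg mh; apply: measurable_funM; last exact: measurable_dotrV.
by apply: (measurableT_comp (measurable_powR _)); exact: measurable_enorm.
Qed.

Lemma flux_dominator g h : pvec O p g -> pvec O p h ->
  mu.-integrable O (EFin \o (fun x => (enorm (g x) + enorm (h x)) `^ p)).
Proof.
move=> pg ph.
have [_] := pintD mO p1 (pvec_enorm oO bO p1 pg) (pvec_enorm oO bO p1 ph).
by under eq_fun do rewrite ger0_norm ?addr_ge0 ?enorm_ge0//.
Qed.

Lemma flux_integrable g h : pvec O p g -> pvec O p h ->
  mu.-integrable O (EFin \o (fun x => flux g h x)).
Proof.
move=> pg ph; apply: (le_integrableR mO _ _ (flux_dominator pg ph)).
  by apply: flux_measurable; exact: pvec_measurable.
by move=> x _; apply: flux_le; rewrite ?lerDl ?lerDr enorm_ge0.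
Qed.

(** Minimality is tested at u + t w. The tangent inequality is taken at the moved point g + t h, so
    it bounds the growth of the energy by the flux there without differentiating under the integral;
    dominated convergence then sends t to 0. *)
Lemma euler_lagrange_ge u g w h : W0 O p u g -> W0 O p w h ->
  (forall w' h', W0 O p w' h' -> energy O p u g <= energy O p w' h') ->
  \int[mu]_(x in O) w x <= \int[mu]_(x in O) flux g h x.
Proof.
move=> Wu Ww minu; have [pu pg _] := Wu; have [pw ph _] := Ww.
pose t n : R := n.+1%:R^-1.
have t0 n : 0 < t n by rewrite invr_gt0.
have t1 n : t n <= 1 by rewrite /t invf_le1 ?ler1n.
pose b n x := g x + t n *: h x.
have bE n : b n = (fun x => 1 *: g x + t n *: h x).
  by apply/funext => x; rewrite scale1r.
have pb n : pvec O p (b n) by rewrite bE; exact: pvec_lin.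
have step n : \int[mu]_(x in O) w x <= \int[mu]_(x in O) flux (b n) h x.
  have ib := pvec_integrable oO bO p1 (pb n); have ig := pvec_integrable oO bO p1 pg.
  have ifl := flux_integrable (pb n) ph.
  have := minu _ _ (W0_lin oO bO p1 1 (t n) Wu Ww).
  rewrite -bE /energy.
  have iu := pint_int oO bO p1 pu; have iw := pint_int oO bO p1 pw.
  rewrite (RintegralD mO (integrableZR mO 1 iu) (integrableZR mO (t n) iw)).
  rewrite (RintegralZl 1 mO iu) (RintegralZl (t n) mO iw).
  have : vpow O p (b n) <= vpow O p g + p * t n * \int[mu]_(x in O) flux (b n) h x.
    rewrite !vpowE -(RintegralZl (p * t n) mO ifl) -(RintegralD mO ig (integrableZR mO _ ifl)).
    apply: (le_Rintegral mO ib (integrableDR mO ig (integrableZR mO _ ifl))) => x _.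
    have := enorm_powR_tangent (g x) (b n x) p1.
    have -> : g x - b n x = (- t n) *: h x by rewrite /b opprD addrA subrr add0r scaleNr.
    rewrite dotrVZr => H; rewrite -lerBlDr; apply: le_trans H.
    by rewrite le_eqVlt; apply/orP; left; apply/eqP; ring.
  move: (vpow _ _ _) (vpow _ _ _) (\int[mu]_(x in O) u x) (\int[mu]_(x in O) w x) => A B U W.
  move: (\int[mu]_(x in O) _) (t n) (t0 n) => F s s0 h1 h2.
  have h3 : p^-1 * B <= p^-1 * (A + p * s * F) by rewrite ler_pM2l ?invr_gt0.
  have h4 : p^-1 * (A + p * s * F) = p^-1 * A + s * F by field; rewrite gt_eqF.
  have : s * W <= s * F by lra.
  by rewrite ler_pM2l.
have cv : \int[mu]_(x in O) flux (b n) h x @[n --> \oo] --> \int[mu]_(x in O) flux g h x.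
  apply: (dominated_Rintegral mO _ (flux_dominator pg ph) (flux_integrable pg ph)).
  - by move=> n; apply: flux_measurable; exact: pvec_measurable.
  - move=> x Ox.
    have cb : b n x @[n --> \oo] --> g x.
      have gE : g x = g x + (0 : R) *: h x by rewrite scale0r addr0.
      rewrite [X in _ --> X]gE; apply: cvgD; first exact: cvg_cst.
      apply: cvgZl; exact: cvg_harmonic.
    exact: (cvg_comp _ _ cb (@enorm_powB2_continuous _ _ _ (h x) p1 (g x))).
  - move=> n x _; apply: flux_le; last by rewrite lerDr enorm_ge0.
    apply: le_trans (ler_enormD _ _) _; rewrite lerD2l enormZ gtr0_norm//.
    by rewrite ler_piMl ?enorm_ge0.
by apply: (cvgr_to_ge cv); apply: nearW => n; exact: step.
Qed.

Lemma torsion_solution_exists (i0 : 'I_D) : exists u, torsion_solution p O u.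
Proof.
have [u [g [Wu minu]]] := energy_minimizer i0 oO bO p1.
exists u; exists g; first by apply/W01pP.
move=> w h /(W01pP oO bO p1) Ww.
have [pu pg _] := Wu; have [pw ph _] := Ww.
have h0 := euler_lagrange_ge Wu Ww minu; apply/eqP; rewrite eq_le h0 andbT.
(* The variation in direction - w, written as a combination to which [W0_lin] applies, gives the
   reverse inequality. *)
have W00 : W0 O p (fun x => 0 * w x + (-1) * w x) (fun x => 0 *: h x + (-1) *: h x) by exact: W0_lin.
have := euler_lagrange_ge Wu W00 minu.
have -> : \int[mu]_(x in O) (0 * w x + (-1) * w x) = - \int[mu]_(x in O) w x.
  rewrite -[RHS]mulN1r -(RintegralZl (-1) mO (pint_int oO bO p1 pw)).
  by apply: eq_Rintegral => x _; rewrite mul0r add0r.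
have -> : \int[mu]_(x in O) flux g (fun x => 0 *: h x + (-1) *: h x) x =
    - \int[mu]_(x in O) flux g h x.
  rewrite -[RHS]mulN1r -(RintegralZl (-1) mO (flux_integrable pg ph)).
  by apply: eq_Rintegral => x _; rewrite scale0r add0r scaleN1r dotrVNr mulrN mulN1r.
by rewrite lerN2.
Qed.

(** Existence turns the value picked by [xget] into a solution; testing its equation with itself
    equates the integral of u with that of |g|^p. *)
Lemma torsional_rigidityP (i0 : 'I_D) : exists u g, [/\ W0 O p u g,
  torsional_rigidity p O = \int[mu]_(x in O) u x,
  torsional_rigidity p O = vpow O p g &
  forall w h, W0 O p w h -> \int[mu]_(x in O) flux g h x = \int[mu]_(x in O) w x].
Proof.
have [g Wu Hg] : torsion_solution p O (torsion_function p O).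
  have [u Hu] := torsion_solution_exists i0; apply: (@xgetPex _ (cst 0) [set u | torsion_solution p O u]).
  by exists u.
exists (torsion_function p O), g; split => //; first exact/W01pP.
  rewrite /torsional_rigidity -(Hg _ _ Wu) vpowE; apply: eq_Rintegral => x _.
  exact: enorm_powB2.
by move=> w h /(W01pP oO bO p1); exact: Hg.
Qed.

Section bounds.
Variables (i0 : 'I_D) (q : R).
Hypothesis pq : p^-1 + q^-1 = 1.

(** The equation tested with phi writes \int phi as a flux, to which Young's inequality applies: the
    part in |g|^p is exactly q^-1 T. *)
Lemma torsion_ge phi : test_function O phi ->
  \int[mu]_(x in O) phi x - p^-1 * \int[mu]_(x in O) (enorm (grad phi x) `^ p) <=
  q^-1 * torsional_rigidity p O.
Proof.
move=> tp; have [u [g [Wu _ Tg Hg]]] := torsional_rigidityP i0.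
have [pu pg _] := Wu; have ph := test_pvec oO bO p1 tp.
rewrite -(Hg _ _ (test_W0 oO bO p1 tp)) Tg vpowE.
have ig := pvec_integrable oO bO p1 pg; have ih := pvec_integrable oO bO p1 ph.
rewrite lerBlDr -(RintegralZl _ mO ig) -(RintegralZl _ mO ih).
rewrite -(RintegralD mO (integrableZR mO _ ig) (integrableZR mO _ ih)).
apply: (le_Rintegral mO (flux_integrable pg ph) (integrableDR mO (integrableZR mO _ ig) (integrableZR mO _ ih))).
move=> x _.
have q0 : 0 < q.
  by rewrite -invr_gt0 (_ : q^-1 = 1 - p^-1) ?subr_gt0 ?invf_lt1// -pq; ring.
apply: le_trans (ler_norm _) _; apply: le_trans (enorm_powB2_le _ _ p1) _.
have := conjugate_powR (enorm_ge0 (grad phi x)) (powR_ge0 (enorm (g x)) (p - 1)) p0 q0 pq.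
have -> : (enorm (g x) `^ (p - 1)) `^ q = enorm (g x) `^ p.
  rewrite -powRrM; congr (_ `^ _).
  have -> : q = (q^-1)^-1 by rewrite invrK.
  have -> : q^-1 = 1 - p^-1 by rewrite -pq; ring.
  have -> : 1 - p^-1 = (p - 1) / p by field; rewrite gt_eqF.
  by rewrite invf_div mulrCA mulfV ?mulr1// gt_eqF// subr_gt0.
move: (enorm (grad phi x) `^ p) (enorm (g x) `^ p) => A B.
by rewrite (mulrC (enorm (grad phi x))) (mulrC A) (mulrC B) (addrC (p^-1 * A)).
Qed.

(** The solution has energy - T / q, and this energy is a limit of energies of test functions. *)
Lemma torsion_le K : (forall phi, test_function O phi ->
    \int[mu]_(x in O) phi x - p^-1 * \int[mu]_(x in O) (enorm (grad phi x) `^ p) <= K) ->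
  q^-1 * torsional_rigidity p O <= K.
Proof.
move=> HK; have [u [g [Wu Tu Tg _]]] := torsional_rigidityP i0.
have [pu pg [phi [tphi cu cg]]] := Wu.
have := energy_cvg oO bO p1 tphi pu pg cu cg.
have -> : energy O p u g = - (q^-1 * torsional_rigidity p O).
  rewrite /energy -Tu -Tg (_ : q^-1 = 1 - p^-1); first by ring.
  by rewrite -pq; ring.
move=> /cvgN; rewrite opprK => cv.
apply: (cvgr_to_le cv); apply: nearW => n.
rewrite (_ : _ n = - energy O p (phi n) (grad (phi n)))// /energy opprB vpowE.
exact: HK.
Qed.

End bounds.
End torsion.

(** * Bounds for the torsional rigidity *)

Section continuous_sums.
Context {R : realType} {D : nat}.
Local Notation V := 'rV[R]_D.
Local Notation mu := (@lebesgue_rV R D).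
Local Notation e_ i := (delta_mx ord0 i : V).
Implicit Types (f g phi psi : V -> R) (O : set V).

Lemma continuous_sumR (I : Type) (s : seq I) (f : I -> V -> R) :
  (forall i, continuous (f i)) -> continuous (fun x => \sum_(i <- s) f i x).
Proof.
move=> cf; elim: s => [|i s IH].
  by under eq_fun do rewrite big_nil; exact: continuous_cstR.
by under eq_fun do rewrite big_cons; exact: continuous_addR.
Qed.

Lemma continuous_enorm_field (W : V -> V) : (forall i, continuous (fun x => W x ord0 i)) ->
  continuous (fun x => enorm (W x)).
Proof.
move=> cW; have c : continuous (fun x => dotrV (W x) (W x)).
  by apply: continuous_sumR => i; exact: continuous_mulR.
move=> x; apply: (@continuous_comp _ _ _ (fun x => dotrV (W x) (W x)) (Num.sqrt : R -> R)).
  exact: c.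
exact: sqrt_continuous.
Qed.

Lemma continuous_bounded_on O f : bounded_set O -> continuous f ->
  exists2 K, 0 <= K & forall x, O x -> `|f x| <= K.
Proof.
move=> [M [_ HM]] cf; pose r := `|M| + 1.
have r0 : 0 <= r by rewrite addr_ge0.
pose B := [set x : V | `|x| <= r].
have cB : compact B.
  apply: bounded_closed_compact.
    by exists r; split; [exact: num_real|move=> k /ltW rk x /= /le_trans; exact].
  have -> : B = Num.norm @^-1` [set s : R | s <= r] by [].
  by apply: closed_comp; [move=> x _; exact: norm_continuous|exact: closed_le].
have B0 : B !=set0 by exists 0; rewrite /B /= normr0.
have cnf : {within B, continuous (fun x => `|f x|)}.
  apply: continuous_subspaceT => x.
  by apply: (@continuous_comp _ _ _ f Num.norm); [exact: cf|exact: norm_continuous].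
have [c _ Hc] := EVT_max_rV B0 cB cnf.
exists `|f c| => // x Ox; apply: Hc; rewrite inE /B /=.
by apply: HM => //; rewrite (le_lt_trans (ler_norm M))// ltrDl.
Qed.

Lemma continuous_integrable_on O f : open O -> bounded_set O -> continuous f ->
  mu.-integrable O (EFin \o f).
Proof.
move=> oO bO cf; have mO := measurable_open_rV oO.
have [K _ HK] := continuous_bounded_on bO cf.
apply: (le_integrableR mO (continuous_measurable_on cf) HK).
by apply: cst_integrableR => //; exact: bounded_lebesgue_rV_lty.
Qed.

Lemma Rintegral_sumR O (I : Type) (s : seq I) (f : I -> V -> R) : measurable O ->
  (forall i, mu.-integrable O (EFin \o f i)) ->
  mu.-integrable O (EFin \o (fun x => \sum_(i <- s) f i x)) /\
  \int[mu]_(x in O) (\sum_(i <- s) f i x) = \sum_(i <- s) \int[mu]_(x in O) f i x.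
Proof.
move=> mO fi; elim: s => [|i s [IH1 IH2]].
  rewrite big_nil (_ : (fun x => _) = fun=> 0); last by apply/funext => x; rewrite big_nil.
  by split; [exact: integrable0|rewrite Rintegral_cst// mul0r].
have E : (fun x => \sum_(j <- i :: s) f j x) = (fun x => f i x + \sum_(j <- s) f j x).
  by apply/funext => x; rewrite big_cons.
by rewrite E; split; [exact: integrableDR|rewrite RintegralD// IH2 big_cons].
Qed.

End continuous_sums.

(** * Upper bound from a vector field *)

Section field_bound.
Context {R : realType} {D : nat}.
Local Notation V := 'rV[R]_D.
Local Notation mu := (@lebesgue_rV R D).
Local Notation e_ i := (delta_mx ord0 i : V).
Implicit Types (f g phi psi : V -> R) (O : set V).

(** A C^1 version of |s| that is non-negative and vanishes at 0. The condition div W <= -1 can only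
    be integrated against non-negative functions, whereas a test function may change sign; the value
    0 at 0 keeps the support. *)
Definition soft_abs (eta s : R) : R := Num.sqrt (s ^+ 2 + eta ^+ 2) - eta.

Lemma soft_abs_ge eta s : `|s| - eta <= soft_abs eta s.
Proof.
by rewrite lerD2r -sqrtr_sqr ler_wsqrtr// lerDl sqr_ge0.
Qed.

Lemma soft_abs0 eta : 0 < eta -> soft_abs eta 0 = 0.
Proof. by move=> e0; rewrite /soft_abs expr0n add0r sqrtr_sqr gtr0_norm// subrr. Qed.

Lemma soft_abs_ge0 eta s : 0 < eta -> 0 <= soft_abs eta s.
Proof.
move=> e0; rewrite subr_ge0 -{1}(gtr0_norm e0) -sqrtr_sqr ler_wsqrtr// lerDr.
exact: sqr_ge0.
Qed.

Definition dsoft_abs (eta s : R) : R := s / Num.sqrt (s ^+ 2 + eta ^+ 2).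

Let rad_gt0 (eta s : R) : 0 < eta -> 0 < s ^+ 2 + eta ^+ 2.
Proof. by move=> e0; rewrite ltr_wpDl ?sqr_ge0// exprn_gt0. Qed.

Lemma is_derive_soft_abs (eta s : R) : 0 < eta -> is_derive s 1 (soft_abs eta) (dsoft_abs eta s).
Proof.
move=> e0.
have d1 : is_derive s 1 (fun t : R => t ^+ 2 + eta ^+ 2) (2 * s).
  have d2 : is_derive s 1 (fun t : R => t ^+ 2) (2 * s).
    have := @is_deriveX R R^o id 2 s 1 1 (is_derive_id s 1).
    by rewrite /= expr1 -[X in is_derive _ _ _ X]/(2 * s * 1) mulr1.
  by apply: (is_derive_eq (is_deriveD d2 (is_derive_cst (eta ^+ 2) s 1))); rewrite addr0.
have d3 := @is_derive1_comp _ Num.sqrt _ s _ _ (is_derive1_sqrt (rad_gt0 s e0)) d1.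
have d4 := is_deriveB d3 (is_derive_cst eta s 1).
apply: (is_derive_eq d4); rewrite subr0 /dsoft_abs invfM.
by rewrite mulrACA mulVf// mul1r mulrC.
Qed.

Lemma dsoft_abs_le1 eta s : 0 < eta -> `|dsoft_abs eta s| <= 1.
Proof.
move=> e0; rewrite normrM normfV (ger0_norm (sqrtr_ge0 _)) -(sqrtr_sqr s).
by rewrite ler_pdivrMr ?sqrtr_gt0 ?rad_gt0// mul1r ler_wsqrtr// lerDl sqr_ge0.
Qed.

Lemma dsoft_abs_continuous eta : 0 < eta -> continuous (dsoft_abs eta).
Proof.
move=> e0 s; apply: cvgM; first exact: cvg_id.
apply: cvgV; first by rewrite gt_eqF// sqrtr_gt0 rad_gt0.
apply: (@continuous_comp _ _ _ (fun s : R => s ^+ 2 + eta ^+ 2) (Num.sqrt : R -> R)).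
  by apply: cvgD; [exact: exprn_continuous|exact: cvg_cst].
exact: sqrt_continuous.
Qed.

Variables (O : set V) (p q : R).
Hypotheses (oO : open O) (bO : bounded_set O) (p1 : 1 < p) (pq : p^-1 + q^-1 = 1).
Let p0 : 0 < p. Proof. exact: lt_trans p1. Qed.
Let q0 : 0 < q.
Proof. by rewrite -invr_gt0 (_ : q^-1 = 1 - p^-1) ?subr_gt0 ?invf_lt1// -pq; ring. Qed.
Let mO : measurable O. Proof. exact: measurable_open_rV. Qed.
Let muO : (mu O < +oo)%E. Proof. exact: bounded_lebesgue_rV_lty. Qed.

Variables (W : V -> V) (dW : 'I_D -> V -> R).
Hypotheses (cW : forall i, continuous (fun x => W x ord0 i))
  (cdW : forall i, continuous (dW i))
  (dWE : forall i x, is_derive x (e_ i) (fun y => W y ord0 i) (dW i x))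
  (divW : forall x, O x -> \sum_i dW i x <= -1).

Lemma field_pow_integrable : mu.-integrable O (EFin \o (fun x => enorm (W x) `^ q)).
Proof.
apply: continuous_integrable_on => // x.
have -> : (fun x => enorm (W x) `^ q) = (fun x => `|enorm (W x)| `^ q).
  by apply/funext => y; rewrite ger0_norm ?enorm_ge0.
apply: (@continuous_comp _ _ _ (fun x => enorm (W x)) (fun s : R => `|s| `^ q)).
  exact: continuous_enorm_field.
exact: powR_norm_continuous.
Qed.

(** For psi = [soft_abs eta] of phi, \int psi <= - \int psi div W = \int grad psi . W. Since |grad
    psi| <= |grad phi|, Young's inequality finishes. *)
Lemma field_bound_soft eta phi : 0 < eta -> test_function O phi ->
  \int[mu]_(x in O) soft_abs eta (phi x) <=
  p^-1 * \int[mu]_(x in O) (enorm (grad phi x) `^ p) +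
  q^-1 * \int[mu]_(x in O) (enorm (W x) `^ q).
Proof.
move=> e0 tp; have [sp _ _] := tp; have [M HM] := test_bounded_supp tp.
pose psi x := soft_abs eta (phi x).
pose dpsi i x := dsoft_abs eta (phi x) * partial i phi x.
have dpsiE i x : is_derive x (e_ i) psi (dpsi i x).
  exact: (is_derive_compR (smooth_is_derive i x sp) (is_derive_soft_abs (phi x) e0)).
have cphi := smooth_continuous sp.
have cpsi : continuous psi.
  move=> x; apply: (@continuous_comp _ _ _ phi (soft_abs eta)); first exact: cphi.
  by apply: differentiable_continuous; apply/derivable1_diffP; have [] := is_derive_soft_abs (phi x) e0.
have cdpsi i : continuous (dpsi i).
  apply: continuous_mulR; last exact: smooth_partial_continuous.
  move=> x; apply: (@continuous_comp _ _ _ phi (dsoft_abs eta)); first exact: cphi.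
  exact: dsoft_abs_continuous.
have psiM x : M < `|x| -> psi x = 0 by move=> /HM; rewrite /psi => ->; exact: soft_abs0.
have psiO x : ~ O x -> psi x = 0 by move=> /(test_out tp); rewrite /psi => ->; exact: soft_abs0.
have dpsiO i x : ~ O x -> dpsi i x = 0.
  by move=> Ox; rewrite /dpsi (test_partial_out _ tp Ox) mulr0.
have parts i : \int[mu]_(x in O) (dpsi i x * W x ord0 i) = - \int[mu]_(x in O) (psi x * dW i x).
  have v1 : \int[mu]_(x in O) (dpsi i x * W x ord0 i) = \int[mu]_x (dpsi i x * W x ord0 i).
    by apply: Rintegral_vanish => x Ox; rewrite dpsiO// mul0r.
  have v2 : \int[mu]_(x in O) (psi x * dW i x) = \int[mu]_x (psi x * dW i x).
    by apply: Rintegral_vanish => x Ox; rewrite psiO// mul0r.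
  rewrite v1 v2.
  have parts := Rintegral_by_parts cpsi (cdpsi i) (@cW i) (@cdW i) (dpsiE i) (dWE i) psiM.
  exact: parts.
have i1 i : mu.-integrable O (EFin \o (fun x => dpsi i x * W x ord0 i)).
  by apply: continuous_integrable_on => //; exact: continuous_mulR.
have i2 i : mu.-integrable O (EFin \o (fun x => psi x * dW i x)).
  by apply: continuous_integrable_on => //; exact: continuous_mulR.
have [i3 E3] := Rintegral_sumR (index_enum 'I_D) mO i1.
have [i4 E4] := Rintegral_sumR (index_enum 'I_D) mO i2.
have E5 : \int[mu]_(x in O) \sum_i (dpsi i x * W x ord0 i) =
    - \int[mu]_(x in O) \sum_i (psi x * dW i x).
  by rewrite E3 E4 -sumrN; apply: eq_bigr => i _; exact: parts.
have ipsi : mu.-integrable O (EFin \o psi) by exact: continuous_integrable_on.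
apply: (@le_trans _ _ (\int[mu]_(x in O) \sum_i (dpsi i x * W x ord0 i))).
  rewrite E5 -mulN1r -(RintegralZl (-1) mO i4).
  apply: (le_Rintegral mO ipsi (integrableZR mO _ i4)) => x Ox.
  rewrite -mulr_sumr mulrCA ler_peMr//; first exact: soft_abs_ge0.
  by have := divW Ox; rewrite mulN1r lerNr.
have ig := pvec_integrable oO bO p1 (test_pvec oO bO p1 tp).
have iW := field_pow_integrable.
rewrite -(RintegralZl _ mO ig) -(RintegralZl _ mO iW).
rewrite -(RintegralD mO (integrableZR mO _ ig) (integrableZR mO _ iW)).
apply: (le_Rintegral mO i3 (integrableDR mO (integrableZR mO _ ig) (integrableZR mO _ iW))) => x _.
have -> : \sum_i (dpsi i x * W x ord0 i) = dsoft_abs eta (phi x) * dotrV (grad phi x) (W x).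
  by rewrite /dotrV mulr_sumr; apply: eq_bigr => i _; rewrite mxE mulrA.
apply: le_trans (ler_norm _) _; rewrite normrM.
apply: (@le_trans _ _ (enorm (grad phi x) * enorm (W x))).
  rewrite -[leRHS]mul1r; apply: ler_pM => //; first exact: dsoft_abs_le1.
  exact: norm_dotrV.
rewrite ![_^-1 * _]mulrC; exact: conjugate_powR (enorm_ge0 _) (enorm_ge0 _) p0 q0 pq.
Qed.

Lemma torsion_le_field (i0 : 'I_D) :
  torsional_rigidity p O <= \int[mu]_(x in O) (enorm (W x) `^ q).
Proof.
rewrite -(@ler_pM2l _ q^-1) ?invr_gt0//.
apply: torsion_le => // phi tp.
rewrite lerBlDr addrC; apply/ler_addgt0Pr => e e0.
pose eta := e / (fine (mu O) + 1).
have m1 : 0 < fine (mu O) + 1 by rewrite ltr_wpDl// fine_ge0.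
have eta0 : 0 < eta by rewrite divr_gt0.
have ip := test_int oO bO p1 tp.
have ic : mu.-integrable O (EFin \o (fun=> eta)) by exact: cst_integrableR.
have is_ : mu.-integrable O (EFin \o (fun x => soft_abs eta (phi x))).
  apply: continuous_integrable_on => // x.
  have [sp _ _] := tp.
  apply: (@continuous_comp _ _ _ phi (soft_abs eta)); first exact: smooth_continuous.
  by apply: differentiable_continuous; apply/derivable1_diffP; have [] := is_derive_soft_abs (phi x) eta0.
apply: (@le_trans _ _ (\int[mu]_(x in O) (soft_abs eta (phi x) + eta))).
  apply: (le_Rintegral mO ip (integrableDR mO is_ ic)) => x _.
  by rewrite -lerBlDr (le_trans _ (soft_abs_ge _ _))// lerD2r ler_norm.
rewrite (RintegralD mO is_ ic) Rintegral_cst//; apply: lerD; first exact: field_bound_soft.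
rewrite /eta mulrAC ler_pdivrMr// ler_wpM2l ?(ltW e0)//.
by rewrite lerDl.
Qed.

End field_bound.

(** * Lower bound from a Lipschitz function *)

Section lower_bound.
Context {R : realType} {D : nat}.
Local Notation V := 'rV[R]_D.
Local Notation mu := (@lebesgue_rV R D).
Variables (O : set V) (p q : R) (i0 : 'I_D).
Hypotheses (oO : open O) (bO : bounded_set O) (p1 : 1 < p) (pq : p^-1 + q^-1 = 1).
Implicit Types (F G : V -> R).

Let p0 : 0 < p. Proof. exact: lt_trans p1. Qed.
Let mO : measurable O. Proof. exact: measurable_open_rV. Qed.
Let muO : (mu O < +oo)%E. Proof. exact: bounded_lebesgue_rV_lty. Qed.

Lemma continuous_pint F : continuous F -> pint mu O p F.
Proof.
move=> cF; split; first exact: continuous_measurable_on.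
apply: continuous_integrable_on => // x.
apply: (@continuous_comp _ _ _ F (fun s : R => `|s| `^ p)); first exact: cF.
exact: powR_norm_continuous.
Qed.

(** F is merely Lipschitz, so [torsion_ge] is applied to the approximations of [test_approx], which
    lose at most e in value and in slope, and e tends to 0. A Lipschitz constant taken from the two
    endpoints is below any bound of G on a ball containing them. *)
Lemma torsion_ge_fun F G : continuous F -> continuous G ->
  (forall x, ~ O x -> F x = 0) -> (forall x, 0 <= F x) -> (forall x, 0 <= G x) ->
  (forall y z, `|F y - F z| <= Num.max (G y) (G z) * enorm (y - z)) ->
  \int[mu]_(x in O) F x - p^-1 * \int[mu]_(x in O) (G x `^ p) <=
  q^-1 * torsional_rigidity p O.
Proof.
move=> cF cG FO F0 G0 lip.
pose e n : R := n.+1%:R^-1.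
have e0 n : 0 < e n by rewrite invr_gt0.
have e1 n : e n <= 1 by rewrite /e invf_le1 ?ler1n.
have iF : mu.-integrable O (EFin \o F) by exact: continuous_integrable_on.
have cGe n : continuous (fun x => G x + e n) by apply: continuous_addR => //; exact: continuous_cstR.
have pG := continuous_pint cG; have pGe n := continuous_pint (@cGe n).
have pe n : pint mu O p (fun=> e n) by apply: continuous_pint; exact: continuous_cstR.
have step n : \int[mu]_(x in O) F x - e n * fine (mu O) -
    p^-1 * npow mu O p (fun x => G x + e n) <= q^-1 * torsional_rigidity p O.
  have [|phi tphi [Fphi gphi]] := test_approx bO cF cG FO F0 G0 _ (e0 n).
    move=> x r K y z GK xy xz; apply: le_trans (lip y z) _.
    by rewrite ler_wpM2r ?enorm_ge0// ge_max !GK.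
  apply: le_trans (torsion_ge oO bO p1 i0 pq tphi); apply: lerB.
    have ie : mu.-integrable O (EFin \o (fun=> e n)) by exact: cst_integrableR.
    rewrite -Rintegral_cst// -(RintegralB mO iF ie).
    by apply: (le_Rintegral mO (integrableBR mO iF ie) (test_int oO bO p1 tphi)) => x _.
  rewrite ler_pM2l ?invr_gt0//; have [_ iGe] := pGe n.
  apply: (le_Rintegral mO (pvec_integrable oO bO p1 (test_pvec oO bO p1 tphi)) iGe) => x Ox.
  apply: le_powR; [exact: ltW|exact: enorm_ge0|].
  by rewrite ger0_norm ?addr_ge0 ?(ltW (e0 n))// gphi.
have c1 : e n * fine (mu O) @[n --> \oo] --> 0 * fine (mu O).
  by apply: cvgMr_tmp; exact: cvg_harmonic.
have c2 : npow mu O p (fun x => G x + e n) @[n --> \oo] --> npow mu O p G.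
  apply: (@npow_cvg _ _ _ mu O p mO p1 _ _ (fun n => fun=> e n)) => //.
    by move=> n x _; rewrite addrAC subrr add0r.
  apply: (@squeeze_cvgr _ _ _ _ (fun=> 0) (fun n => e n * fine (mu O))).
  - apply: nearW => n; rewrite npow_ge0 /= /npow Rintegral_cst//.
    rewrite ler_wpM2r ?fine_ge0// (ger0_norm (ltW (e0 n))).
    by rewrite -{2}(powRr1 (ltW (e0 n))) ger_powR ?e0 ?e1//= ltW.
  - exact: cvg_cst.
  - by move: c1; rewrite mul0r.
have E : npow mu O p G = \int[mu]_(x in O) (G x `^ p).
  by apply: eq_Rintegral => x _; rewrite ger0_norm.
have cv : \int[mu]_(x in O) F x - e n * fine (mu O) - p^-1 * npow mu O p (fun x => G x + e n)
    @[n --> \oo] --> \int[mu]_(x in O) F x - 0 * fine (mu O) - p^-1 * npow mu O p G.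
  apply: cvgB; last by apply: cvgMl_tmp; exact: c2.
  by apply: cvgB; [exact: cvg_cst|exact: c1].
move: cv; rewrite mul0r subr0 E => cv.
by apply: (cvgr_to_le cv); apply: nearW => n; exact: step.
Qed.

End lower_bound.

(** * Convex domains: distance to the complement and gauge *)

Section sub_continuous.
Context {R : realType} {D : nat}.
Local Notation V := 'rV[R]_D.

Lemma continuous_subl (c : V) : continuous (fun x : V => c - x).
Proof.
have cc : continuous (fun _ : V => c) by exact: cst_continuous.
have ci : continuous (fun x : V => x) by move=> x; exact: cvg_id.
by move=> x; exact: (cvgB (cc x) (ci x)).
Qed.

Lemma dotrV_sub_scale (a b : V) (t : R) : dotrV (a - t *: b) (a - t *: b) =
  dotrV a a - 2 * (t * dotrV a b) + t * (t * dotrV b b).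
Proof.
by rewrite !(dotrVDl, dotrVDr, dotrVNl, dotrVNr, dotrVZl, dotrVZr) (dotrVC b a); ring.
Qed.

End sub_continuous.

Section convex_geometry.
Context {R : realType} {D : nat}.
Local Notation V := 'rV[R]_D.
Variables (O : set V) (i0 : 'I_D).
Hypotheses (oO : open O) (bO : bounded_set O) (vO : convex_set O) (nO : O !=set0).
Implicit Types (x y z c v nu : V).

Lemma convex_comb x y (t : R) : 0 <= t <= 1 -> O x -> O y -> O (t *: x + (1 - t) *: y).
Proof.
move=> /andP[t0 t1] Ox Oy.
by have := @vO x y (Itv01 t0 t1); rewrite !inE => /(_ Ox Oy) H; exact: H.
Qed.

Lemma bounded_normP : exists2 M : R, 0 < M & forall x, O x -> `|x| <= M.
Proof.
have [M [_ HM]] := bO; exists (`|M| + 1); first by rewrite ltr_wpDl.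
by move=> x Ox; apply: HM => //; rewrite (le_lt_trans (ler_norm M))// ltrDl.
Qed.

Lemma outside_nonempty : ~` O !=set0.
Proof.
have [M M0 HM] := bounded_normP.
exists ((M + 1) *: delta_mx ord0 i0) => /HM h.
have := le_trans (coord_ler_norm _ i0) h; rewrite !mxE !eqxx mulr1.
by rewrite ger0_norm ?addr_ge0 ?(ltW M0)// leNgt ltrDl ltr01.
Qed.

Definition cdist x : R := inf [set enorm (x - y) | y in ~` O].

Let dset0 x : [set enorm (x - y) | y in ~` O] !=set0.
Proof. by have [y Oy] := outside_nonempty; exists (enorm (x - y)); exists y. Qed.

Let dsetlb x : lbound [set enorm (x - y) | y in ~` O] 0.
Proof. by move=> _ [y _ <-]; exact: enorm_ge0. Qed.

Lemma cdist_le x y : ~ O y -> cdist x <= enorm (x - y).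
Proof. by move=> Oy; apply: ge_inf; [exists 0; exact: dsetlb|exists y]. Qed.

Lemma cdist_ge x r : (forall y, ~ O y -> r <= enorm (x - y)) -> r <= cdist x.
Proof. by move=> H; apply: lb_le_inf => // _ [y Oy <-]; exact: H. Qed.

Lemma cdist_ge0 x : 0 <= cdist x.
Proof. by apply: cdist_ge => y _; exact: enorm_ge0. Qed.

Lemma cdist_out x : ~ O x -> cdist x = 0.
Proof.
move=> Ox; apply/eqP; rewrite eq_le cdist_ge0 andbT.
by have := cdist_le x Ox; rewrite subrr enorm0.
Qed.

Lemma cdist_ball x y : enorm (y - x) < cdist x -> O y.
Proof.
move=> h; apply: contrapT => Oy; have := cdist_le x Oy.
by rewrite enormB leNgt h.
Qed.

Lemma cdist_lip x y : cdist x <= cdist y + enorm (x - y).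
Proof.
rewrite -lerBlDr; apply: cdist_ge => z Oz; rewrite lerBlDr.
apply: le_trans (cdist_le x Oz) _.
by have -> : x - z = (y - z) + (x - y) by [rewrite [RHS]addrC addrA subrK]; exact: ler_enormD.
Qed.

Lemma cdist_continuous : continuous cdist.
Proof.
apply: (@lipschitz_continuousR _ _ _ D%:R) => // x y.
apply: le_trans (enorm_ler_norm _); rewrite ler_norml.
by have := cdist_lip x y; have := cdist_lip y x; rewrite (enormB y x); lra.
Qed.

Lemma closed_norm_ball_compact (c : V) (r : R) : compact [set x : V | `|c - x| <= r].
Proof.
apply: bounded_closed_compact.
  exists (`|c| + r); split; first exact: num_real.
  move=> k /ltW rk x /= xr; apply: le_trans rk.
  rewrite -[x](subKr c); apply: le_trans (ler_normB _ _) _.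
  by rewrite lerD2l.
have -> : [set x : V | `|c - x| <= r] = (fun x => `|c - x|) @^-1` [set s : R | s <= r] by [].
apply: closed_comp; last exact: closed_le.
move=> x _; apply: (@continuous_comp _ _ _ (fun x => c - x) Num.norm); last exact: norm_continuous.
exact: continuous_subl.
Qed.

Lemma cdist_attained x : exists2 y, ~ O y & enorm (x - y) = cdist x.
Proof.
have [y0 Oy0] := outside_nonempty.
pose K := [set y : V | `|x - y| <= enorm (x - y0)] `&` ~` O.
have cK : compact K.
  apply: compact_closedI; first exact: closed_norm_ball_compact.
  by rewrite closedC.
have K0 : K !=set0 by exists y0; split => //; exact: norm_ler_enorm.
have ce : continuous (fun y : V => enorm (x - y)).
  move=> y; apply: (@continuous_comp _ _ _ (fun y => x - y) (enorm : V -> R)).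
    exact: continuous_subl.
  exact: enorm_continuous.
have [y yK Hy] := EVT_min_rV K0 cK (continuous_subspaceT ce).
move: yK; rewrite inE => -[_ Oy]; exists y => //.
apply/eqP; rewrite eq_le cdist_le// andbT; apply: cdist_ge => z Oz.
have [zK|zK] := leP `|x - z| (enorm (x - y0)).
  by apply: Hy; rewrite inE.
apply: (@le_trans _ _ (enorm (x - y0))).
  by apply: Hy; rewrite inE; split => //; exact: norm_ler_enorm.
exact: le_trans (ltW zK) (norm_ler_enorm _).
Qed.

Lemma cdist_gt0 x : O x -> 0 < cdist x.
Proof.
move=> Ox; have [y Oy <-] := cdist_attained x.
rewrite lt_neqAle enorm_ge0 andbT eq_sym; apply/eqP => /enorm_eq0 /eqP.
by rewrite subr_eq0 => /eqP xy; apply: Oy; rewrite -xy.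
Qed.

(* The hyperplane through the nearest outside point y: a point z of O beyond it would, with a point
   of the inscribed ball on the line from z through y, put y in O. *)
Lemma supporting_half_space x : O x -> exists2 nu, enorm nu = 1 &
  forall z, O z -> dotrV nu (z - x) <= cdist x.
Proof.
move=> Ox; have d0 := cdist_gt0 Ox; have [y Oy yd] := cdist_attained x.
have dE : dotrV (y - x) (y - x) = cdist x ^+ 2 by rewrite -sqr_enorm enormB yd.
exists ((cdist x)^-1 *: (y - x)).
  by rewrite enormZ enormB yd gtr0_norm ?invr_gt0// mulVf// gt_eqF.
move=> z Oz; rewrite dotrVZl ler_pdivrMl// leNgt; apply/negP => lt; apply: Oy.
pose al := dotrV (y - x) (z - y); pose be := dotrV (z - y) (z - y).
have al0 : 0 < al.
  rewrite /al (_ : z - y = (z - x) - (y - x)); last by rewrite opprB addrA subrK.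
  by rewrite dotrVDr dotrVNr dE subr_gt0 expr2.
have be0 : 0 <= be by exact: dotrV_ge0.
(* The squared distance from x to y - t (z - y) is d^2 - 2 t al + t^2 be, and this t ensures t be <=
   al, so the point is closer to x than y is. *)
pose t := al / (be + 1).
have be1 : 0 < be + 1 by rewrite ltr_wpDl.
have t0 : 0 < t by rewrite divr_gt0.
have tE : t * (be + 1) = al by rewrite /t divfK// gt_eqF.
have Ow : O (y - t *: (z - y)).
  apply: (cdist_ball (x := x)); rewrite -ltr_sqr ?nnegrE ?enorm_ge0 ?cdist_ge0// sqr_enorm.
  have -> : y - t *: (z - y) - x = (y - x) - t *: (z - y) by rewrite addrAC.
  rewrite dotrV_sub_scale dE -/al -/be.
  have : 0 < t * al by rewrite mulr_gt0.
  have : t * (t * be) <= t * al by rewrite ler_pM2l// -tE ler_pM2l// lerDl.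
  move: (t * al) (t * (t * be)) (cdist x ^+ 2) => A B C; lra.
have -> : y = (t / (1 + t)) *: z + (1 - t / (1 + t)) *: (y - t *: (z - y)).
  have t1 : 1 + t != 0 by rewrite gt_eqF// addr_gt0.
  by apply/rowP => i; rewrite !mxE; field.
apply: convex_comb => //; rewrite divr_ge0 ?addr_ge0 ?(ltW t0)//=.
by rewrite ler_pdivrMr ?addr_gt0// mul1r lerDr.
Qed.

(** [cdist] is continuous and vanishes off O, so its maximum over a closed ball containing O is
    attained in O. A ball of radius r about x lies in O exactly when r <= [cdist O x], so the
    maximum is the inradius. *)
Lemma incenter : exists c, [/\ O c, cdist c = inradius O & forall x, cdist x <= inradius O].
Proof.
have [M M0 HM] := bounded_normP; have [x0 Ox0] := nO.
have cB := @closed_norm_ball_compact 0 M.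
have B0 : [set x : V | `|0 - x| <= M] !=set0 by exists 0; rewrite /= subrr normr0 ltW.
have [c cB' Hc] := EVT_max_rV B0 cB (continuous_subspaceT cdist_continuous).
have dc x : cdist x <= cdist c.
  have [Ox|Ox] := pselect (O x); last by rewrite cdist_out// cdist_ge0.
  by apply: Hc; rewrite inE /= sub0r normrN HM.
have Oc : O c.
  apply: contrapT => /cdist_out E; have := dc x0; rewrite E leNgt.
  by rewrite cdist_gt0.
have cE : cdist c = inradius O.
  apply/eqP; rewrite eq_le /inradius; apply/andP; split.
    apply: ub_le_sup.
      exists (cdist c) => r [_ [x xr]]; apply: le_trans (dc x); apply: cdist_ge => y Oy.
      by rewrite leNgt; apply/negP => lt; apply: Oy; apply: xr; rewrite /eball /= enormB.
    split; first exact: cdist_gt0.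
    by exists c => y; exact: cdist_ball.
  apply: sup_le_ub.
    exists (cdist c); split; first exact: cdist_gt0.
    by exists c => y; exact: cdist_ball.
  move=> r [_ [x xr]]; apply: le_trans (dc x); apply: cdist_ge => y Oy.
  by rewrite leNgt; apply/negP => lt; apply: Oy; apply: xr; rewrite /eball /= enormB.
by exists c; split => // x; rewrite -cE.
Qed.

End convex_geometry.

Section powR_tangent.
Context {R : realType}.
Implicit Types (a b p : R).

Lemma powR_tangent p a b : 1 < p -> 0 <= a -> 0 <= b ->
  b `^ p + p * (b `^ (p - 1) * (a - b)) <= a `^ p.
Proof.
move=> p1 a0 b0; have p0 : 0 < p by exact: lt_trans p1.
have p10 : 0 < p - 1 by rewrite subr_gt0.
pose q := p / (p - 1).
have q0 : 0 < q by rewrite divr_gt0.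
have pq : p^-1 + q^-1 = 1 by rewrite /q invf_div; field; rewrite gt_eqF.
have := conjugate_powR a0 (powR_ge0 b (p - 1)) p0 q0 pq.
have -> : (b `^ (p - 1)) `^ q = b `^ p.
  by rewrite -powRrM /q mulrCA mulfV ?mulr1// gt_eqF.
have -> : q^-1 = 1 - p^-1 by rewrite -pq; ring.
have <- := mulr_powRB1 b0 p0.
move: (a `^ p) (b `^ (p - 1)) => A B h.
have : p * (a * B) <= p * (A / p + b * B * (1 - p^-1)) by rewrite ler_pM2l.
have -> : p * (A / p + b * B * (1 - p^-1)) = A + p * (b * B) - b * B by field; rewrite gt_eqF.
have -> : p * (B * (a - b)) = p * (a * B) - p * (b * B) by ring.
lra.
Qed.

End powR_tangent.

Section restrict.
Context {T : Type} {R : realType}.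
Implicit Types (A : set T) (f : T -> R).

Lemma restrict_in A f x : A x -> (f \_ A) x = f x.
Proof. by move=> Ax; rewrite patchE mem_set. Qed.

Lemma restrict_out A f x : ~ A x -> (f \_ A) x = 0.
Proof. by move=> Ax; rewrite patchE memNset. Qed.

End restrict.

(** * The gauge of a convex domain and its moments *)

Section gauge.
Context {R : realType} {D : nat}.
Local Notation V := 'rV[R]_D.
Local Notation mu := (@lebesgue_rV R D).
Variables (O : set V) (c : V) (r : R).
Hypotheses (oO : open O) (bO : bounded_set O) (vO : convex_set O) (Oc : O c)
  (r0 : 0 < r) (rO : eball c r `<=` O).
Implicit Types (x y z v nu : V) (s t : R).

Let mO : measurable O. Proof. exact: measurable_open_rV. Qed.
Let muO : (mu O < +oo)%E. Proof. exact: bounded_lebesgue_rV_lty. Qed.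

Definition gauge x : R := inf [set t | 0 < t /\ O (c + t^-1 *: (x - c))].

Lemma gauge_set_nonempty x : [set t | 0 < t /\ O (c + t^-1 *: (x - c))] !=set0.
Proof.
have t0 : 0 < enorm (x - c) / r + 1 by rewrite ltr_wpDl// divr_ge0 ?enorm_ge0// ltW.
exists (enorm (x - c) / r + 1); split => //; apply: rO.
rewrite /eball /= addrAC subrr add0r enormZ gtr0_norm ?invr_gt0//.
rewrite ltr_pdivrMl// mulrDl mul1r divfK ?gt_eqF//.
by rewrite ltrDl.
Qed.

Let gauge_lb x : lbound [set t | 0 < t /\ O (c + t^-1 *: (x - c))] 0.
Proof. by move=> t [/ltW]. Qed.

Lemma gauge_ge0 x : 0 <= gauge x.
Proof. by apply: lb_le_inf => //; exact: gauge_set_nonempty. Qed.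

Lemma gauge_le x t : 0 < t -> O (c + t^-1 *: (x - c)) -> gauge x <= t.
Proof. by move=> t0 Ot; apply: ge_inf; [exists 0; exact: gauge_lb|]. Qed.

Lemma gauge_ltW x t : gauge x < t -> O (c + t^-1 *: (x - c)).
Proof.
move=> lt; have [|s [s0 Os] st] := @inf_adherent _ _ (t - gauge x) _
    (conj (gauge_set_nonempty x) (ex_intro _ 0 (@gauge_lb x))).
  by rewrite subr_gt0.
rewrite -/(gauge x) addrCA subrr addr0 in st.
have t0 : 0 < t by exact: lt_trans st.
have -> : c + t^-1 *: (x - c) = (s / t) *: (c + s^-1 *: (x - c)) + (1 - s / t) *: c.
  apply/rowP => i; rewrite !mxE; field.
  by rewrite !gt_eqF.
apply: convex_comb => //; rewrite divr_ge0 ?(ltW s0) ?(ltW t0)//=.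
by rewrite ler_pdivrMr// mul1r ltW.
Qed.

(** Since O is open, the point can be pushed a little further away from c, which puts the infimum
    strictly below t. *)
Lemma gauge_lt x t : 0 < t -> O (c + t^-1 *: (x - c)) -> gauge x < t.
Proof.
move=> t0 Oz; set z := c + t^-1 *: (x - c) in Oz.
have zc : t^-1 *: (x - c) = z - c by rewrite /z addrAC subrr add0r.
have := oO; rewrite openE => /(_ z Oz) /nbhs_ballP[e /= e0 He].
pose n := e / (`|z - c| + 1).
have n1 : 0 < `|z - c| + 1 by rewrite ltr_wpDl.
have n0 : 0 < n by rewrite divr_gt0.
have p1 : 0 < 1 + n by rewrite addr_gt0.
apply: (@le_lt_trans _ _ (t / (1 + n))); last by rewrite ltr_pdivrMr// ltr_pMr// ltrDl.
apply: gauge_le; first by rewrite divr_gt0.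
have -> : c + (t / (1 + n))^-1 *: (x - c) = z + n *: (z - c).
  by rewrite -zc /z invf_div scalerA mulrDl mul1r scalerDl addrA.
apply: He; rewrite -ball_normE /= opprD addrA subrr add0r normrN normrZ gtr0_norm//.
by rewrite /n mulrAC ltr_pdivrMr// ltr_pM2l// ltrDl.
Qed.

Lemma gaugeP x t : 0 < t -> (gauge x < t <-> O (c + t^-1 *: (x - c))).
Proof. by move=> t0; split; [exact: gauge_ltW|exact: gauge_lt]. Qed.

Lemma gauge_in x : O x <-> gauge x < 1.
Proof. by rewrite gaugeP// invr1 scale1r addrC subrK. Qed.

(** Subadditivity of the gauge, with the increment x - y measured in the inscribed ball. The
    Lipschitz constant 1 / r is the source of the factor (r / D)^q in the lower bound. *)
Lemma gauge_sub x y : gauge x <= gauge y + enorm (x - y) / r.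
Proof.
apply/ler_addgt0Pr => e e0.
have e2 : 0 < e / 2 by rewrite divr_gt0.
pose t := gauge y + e / 2; pose s := enorm (x - y) / r + e / 2.
have t0 : 0 < t by rewrite ltr_wpDl ?gauge_ge0.
have s0 : 0 < s by rewrite ltr_wpDl ?divr_ge0 ?enorm_ge0 ?(ltW r0).
have -> : gauge y + enorm (x - y) / r + e = t + s by rewrite /t /s [e in LHS]splitr; ring.
have Oy : O (c + t^-1 *: (y - c)) by apply: gauge_ltW; rewrite ltrDl.
have Oxy : O (c + s^-1 *: (x - y)).
  apply: rO; rewrite /eball /= addrAC subrr add0r enormZ gtr0_norm ?invr_gt0//.
  by rewrite ltr_pdivrMl// /s mulrDl divfK ?gt_eqF// ltrDl mulr_gt0.
clearbody t s; have ts : 0 < t + s by rewrite addr_gt0.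
apply: gauge_le => //.
have -> : c + (t + s)^-1 *: (x - c) = (t / (t + s)) *: (c + t^-1 *: (y - c)) +
    (1 - t / (t + s)) *: (c + s^-1 *: (x - y)).
  apply/rowP => i; rewrite !mxE; field.
  by rewrite !gt_eqF.
apply: convex_comb => //; rewrite divr_ge0 ?(ltW t0) ?(ltW ts)//=.
by rewrite ler_pdivrMr// mul1r lerDl ltW.
Qed.

Lemma gauge_continuous : continuous gauge.
Proof.
apply: (@lipschitz_continuousR _ _ _ (D%:R / r)); first by rewrite divr_ge0 ?ler0n ?(ltW r0).
move=> x y; apply: (@le_trans _ _ (enorm (x - y) / r)).
  by rewrite ler_norml; have := gauge_sub x y; have := gauge_sub y x; rewrite (enormB y x); lra.
by rewrite mulrAC ler_wpM2r ?invr_ge0 ?(ltW r0)// enorm_ler_norm.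
Qed.

(* For x in O and gauge x < t < 1 the ball of radius r (1 - t) about x is a convex combination of
   the ball about c and a point of O. *)
Lemma gauge_cdist (i0 : 'I_D) x : r - cdist O x <= r * gauge x.
Proof.
have [Ox|Ox] := pselect (O x); last first.
  have g1 : 1 <= gauge x by rewrite leNgt; apply/negP => /gauge_in.
  by apply: (@le_trans _ _ r); [rewrite gerBl cdist_ge0|rewrite ler_peMr// ltW].
apply/ler_addgt0Pr => e e0.
have gx1 := (gauge_in x).1 Ox.
have [t1|t1] := leP 1 (gauge x + e / r).
  apply: (@le_trans _ _ r); first by rewrite gerBl cdist_ge0.
  have : r * 1 <= r * (gauge x + e / r) by rewrite ler_pM2l.
  by rewrite mulr1 mulrDr mulrCA mulfV ?mulr1// gt_eqF.
set t := gauge x + e / r in t1.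
have gt : gauge x < t by rewrite ltrDl divr_gt0.
have t0 : 0 < t by exact: le_lt_trans (gauge_ge0 x) gt.
have -> : r * gauge x + e = r * t by rewrite /t mulrDr mulrCA mulfV ?mulr1// gt_eqF.
rewrite lerBlDr -lerBlDl -{1}(mulr1 r) -mulrBr.
apply: cdist_ge => // y Oy; rewrite leNgt; apply/negP => lt; apply: Oy.
have t2 : 0 < 1 - t by rewrite subr_gt0.
have -> : y = t *: (c + t^-1 *: (x - c)) + (1 - t) *: (c + (1 - t)^-1 *: (y - x)).
  apply/rowP => i; rewrite !mxE; field.
  by rewrite !gt_eqF.
apply: convex_comb => //; first by rewrite !ltW.
  exact: gauge_ltW.
apply: rO; rewrite /eball /= addrAC subrr add0r enormZ gtr0_norm ?invr_gt0//.
by rewrite ltr_pdivrMl// mulrC enormB.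
Qed.

(** For t slightly above the gauge, (x - c) / t belongs to O - c. Applied to the Euclidean norm and
    to the functional of a supporting half-space. *)
Lemma gauge_homogeneous_le (f : V -> R) (h : R) x :
  (forall t v, 0 < t -> f (t *: v) = t * f v) -> 0 <= h ->
  (forall y, O y -> f (y - c) <= h) -> f (x - c) <= h * gauge x.
Proof.
move=> fZ h0 fh; apply/ler_addgt0Pr => e e0.
have h1 : 0 < h + 1 by rewrite ltr_wpDl.
pose t := gauge x + e / (h + 1).
have gt : gauge x < t by rewrite ltrDl divr_gt0.
have t0 : 0 < t by exact: le_lt_trans (gauge_ge0 x) gt.
have := fh _ (gauge_ltW gt); rewrite addrAC subrr add0r fZ ?invr_gt0//.
rewrite ler_pdivrMl// mulrC => /le_trans; apply.
rewrite /t mulrDr lerD2l mulrCA ler_piMr ?(ltW e0)//.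
by rewrite ler_pdivrMr// mul1r lerDl.
Qed.

Lemma gauge_scale_le x t : 0 < t -> gauge (c + t *: (x - c)) <= t * gauge x.
Proof.
move=> t0; apply/ler_addgt0Pr => e e0.
pose s := gauge x + e / t.
have gs : gauge x < s by rewrite ltrDl divr_gt0.
have s0 : 0 < s by exact: le_lt_trans (gauge_ge0 x) gs.
have -> : t * gauge x + e = t * s by rewrite /s mulrDr mulrCA mulfV ?mulr1// gt_eqF.
apply: gauge_le; first by rewrite mulr_gt0.
rewrite [c + _ *: _ - c]addrAC subrr add0r scalerA invfM mulrAC mulVf ?gt_eqF// mul1r.
exact: gauge_ltW.
Qed.

Lemma gauge_scale x t : 0 < t -> gauge (c + t *: (x - c)) = t * gauge x.
Proof.
move=> t0; apply/eqP; rewrite eq_le gauge_scale_le//=.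
have ti : 0 < t^-1 by rewrite invr_gt0.
have := gauge_scale_le (c + t *: (x - c)) ti.
rewrite [c + t *: _ - c]addrAC subrr add0r scalerA mulVf ?gt_eqF// scale1r.
by rewrite addrC subrK ler_pdivlMl.
Qed.

Section moments.
Variables (s : R).
Hypotheses (s0 : 0 < s) (D1 : (1 < D)%N).

Let f x := gauge x `^ s.
Let Phi := \int[mu]_(x in O) f x.
Let v := fine (mu O).

Lemma gauge_pow_continuous q : 0 < q -> continuous (fun x => gauge x `^ q).
Proof.
move=> q0 x; have -> : (fun x => gauge x `^ q) = (fun x => `|gauge x| `^ q).
  by apply/funext => y; rewrite ger0_norm ?gauge_ge0.
apply: (@continuous_comp _ _ _ gauge (fun t : R => `|t| `^ q)); first exact: gauge_continuous.
exact: powR_norm_continuous.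
Qed.

Let fi : mu.-integrable O (EFin \o f).
Proof. by apply: continuous_integrable_on => //; exact: gauge_pow_continuous. Qed.

Section dilate.
Variable t : R.
Hypotheses (t0 : 0 < t) (t1 : t < 1).
Let w : V := c - t^-1 *: c.
Let Ot : set V := [set x | O (t^-1 *: x + w)].

Let OtE x : Ot x = O (c + t^-1 *: (x - c)).
Proof. by rewrite /Ot /= /w scalerBr addrCA addrA. Qed.

Let OtP x : Ot x <-> gauge x < t.
Proof. by rewrite OtE gaugeP. Qed.

Let mOt : measurable Ot.
Proof.
by rewrite -[X in measurable X]setTI; apply: (measurable_affine_rV t^-1 w).
Qed.

Let OtO : Ot `<=` O.
Proof. by move=> x /OtP xt; apply/gauge_in; exact: lt_trans t1. Qed.

Let tD : `|t^-1| ^- D = t `^ D%:R.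
Proof. by rewrite normfV exprVn invrK gtr0_norm// powR_mulrn// ltW. Qed.

Let muOt : fine (mu Ot) = t `^ D%:R * v.
Proof.
have := @lebesgue_rV_affine R D t^-1 w O; rewrite invr_eq0 gt_eqF// => /(_ isT mO) E.
rewrite (_ : mu Ot = (`|t^-1| ^- D)%:E * mu O)%E//.
by rewrite fineM ?tD// ge0_fin_numE.
Qed.

Let int_Ot : \int[mu]_(x in Ot) f x = t `^ (D%:R + s) * Phi.
Proof.
have fO : mu.-integrable setT (EFin \o (f \_ O)).
  by have := (integrable_mkcond (EFin \o f) mO).1 fi; rewrite restrict_EFin.
have ti0 : t^-1 != 0 by rewrite invr_eq0 gt_eqF.
have E0 : \int[mu]_x (f \_ O) x = Phi := esym (Rintegral_mkcond mu O f).
have E := etrans (Rintegral_affine_rV w ti0 fO) (congr2 *%R tD E0).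
have ia := integrable_affine_rV w ti0 fO.
have E1 : f \_ Ot = (fun x => t `^ s * (f \_ O) (t^-1 *: x + w)).
  apply/funext => x; have [xO|xO] := pselect (O (t^-1 *: x + w)).
    rewrite (restrict_in f (xO : Ot x)) (restrict_in f xO).
    have -> : t^-1 *: x + w = c + t^-1 *: (x - c) by rewrite /w scalerBr addrCA addrA.
    rewrite /f gauge_scale ?invr_gt0// powRM ?invr_ge0 ?(ltW t0) ?gauge_ge0//.
    by rewrite mulrA -powRM ?invr_ge0 ?(ltW t0)// mulfV ?gt_eqF// powR1 mul1r.
  by rewrite (restrict_out f (xO : ~ Ot x)) (restrict_out f xO) mulr0.
rewrite (Rintegral_mkcond mu Ot f) E1 (RintegralZl (t `^ s) measurableT ia) E.
by rewrite powRD ?(gt_eqF t0) ?implybT//; ring.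
Qed.

(** On O minus its dilation by t the integrand lies between t^s and 1, while homogeneity gives the
    integral and the volume over the dilation. *)
Lemma gauge_moment_annulus :
  (1 - t `^ (D%:R + s)) * Phi <= (1 - t `^ D%:R) * v /\
  t `^ s * ((1 - t `^ D%:R) * v) <= (1 - t `^ (D%:R + s)) * Phi.
Proof.
pose g := f \_ Ot; pose o := (cst (1 : R)) \_ Ot.
have OOt : O `&` Ot = Ot by rewrite setIC; apply/setIidPl.
have ig : \int[mu]_(x in O) g x = t `^ (D%:R + s) * Phi.
  by rewrite -int_Ot -[in RHS]OOt Rintegral_mkcondr.
have io : \int[mu]_(x in O) o x = t `^ D%:R * v.
  by rewrite -muOt -(mul1r (fine _)) -Rintegral_cst// -[in RHS]OOt Rintegral_mkcondr.
have gi : mu.-integrable O (EFin \o g).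
  apply: (le_integrableR mO _ _ fi).
    apply/measurable_restrict => //; rewrite OOt.
    by apply: (measurable_funS _ OtO) => //; exact: integrable_measurableR fi.
  by move=> x _; rewrite /g patchE; case: ifP => _; rewrite ?normr0 ?powR_ge0// ger0_norm ?powR_ge0.
have oi : mu.-integrable O (EFin \o o).
  apply: (le_integrableR mO _ _ (cst_integrableR mO 1 muO)).
    by apply/measurable_restrict => //; exact: measurable_cst.
  by move=> x _; rewrite /o patchE; case: ifP => _; rewrite ?normr0 ?normr1.
have ci := cst_integrableR mO 1 muO.
have i1o := integrableBR mO ci oi.
split.
  have : Phi <= t `^ (D%:R + s) * Phi + (1 * v - t `^ D%:R * v).
    rewrite -ig -io -Rintegral_cst// -(RintegralB mO ci oi) -(RintegralD mO gi i1o).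
    apply: (le_Rintegral mO fi (integrableDR mO gi i1o)) => x Ox.
    rewrite /g /o !patchE; case: ifP => _; first by rewrite subrr addr0.
    rewrite add0r subr0; have gx1 := (gauge_in x).1 Ox.
    have <- : (1 : R) `^ s = 1 by rewrite powR1.
    apply: le_powR; [exact: ltW|exact: gauge_ge0|exact: ltW].
  by lra.
have : t `^ (D%:R + s) * Phi + t `^ s * (1 * v - t `^ D%:R * v) <= Phi.
  rewrite -ig -io -Rintegral_cst// -(RintegralB mO ci oi).
  rewrite -(RintegralZl _ mO i1o) -(RintegralD mO gi (integrableZR mO _ i1o)).
  apply: (le_Rintegral mO (integrableDR mO gi (integrableZR mO _ i1o)) fi) => x Ox.
  rewrite /g /o !patchE; case: ifPn => [_|/negP xt]; first by rewrite subrr mulr0 addr0.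
  rewrite add0r subr0 mulr1; apply: le_powR; [exact: ltW|exact: ltW|].
  by rewrite leNgt; apply/negP => /OtP/mem_set.
by lra.
Qed.

End dilate.

(* Compare the annuli with the ones of the gauge t^(D + s) and let t tend to 1. *)
Lemma gauge_moment : (D%:R + s) * Phi = D%:R * v.
Proof.
have Phi0 : 0 <= Phi by apply: Rintegral_ge0 => x _; exact: powR_ge0.
have v0 : 0 <= v by rewrite fine_ge0.
have D1R : 1 < D%:R :> R by rewrite ltr1n.
have a1 : 1 < D%:R + s by rewrite (lt_trans D1R)// ltrDl.
have b0 : 0 < D%:R + s - 1 by rewrite subr_gt0.
have step t : 0 < t -> t < 1 ->
    (D%:R + s) * (t `^ (D%:R + s - 1) * Phi) <= D%:R * v /\
    D%:R * (t `^ (D%:R + s - 1) * v) <= (D%:R + s) * Phi.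
  move=> t0 t1; have [h1 h2] := gauge_moment_annulus t0 t1.
  have t2 : 0 < 1 - t by rewrite subr_gt0.
  (* The tangents at t and at 1 place 1 - t^a between a t^(a - 1) (1 - t) and a (1 - t), for a = D +
     s and a = D; the common factor 1 - t is then cancelled. *)
  have tg1 := powR_tangent a1 ler01 (ltW t0).
  have tg2 := powR_tangent D1R ler01 (ltW t0).
  have tg3 := powR_tangent a1 (ltW t0) ler01.
  have tg4 := powR_tangent D1R (ltW t0) ler01.
  rewrite !powR1 in tg1 tg2 tg3 tg4; rewrite !mul1r in tg3 tg4.
  split.
    rewrite -(ler_pM2r t2).
    have e1 : (D%:R + s) * (t `^ (D%:R + s - 1) * (1 - t)) * Phi <= (1 - t `^ (D%:R + s)) * Phi.
      by rewrite ler_wpM2r// lerBrDl.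
    have e2 : (1 - t `^ D%:R) * v <= D%:R * (1 - t) * v.
      by rewrite ler_wpM2r//; move: tg4; lra.
    have -> : (D%:R + s) * (t `^ (D%:R + s - 1) * Phi) * (1 - t) =
        (D%:R + s) * (t `^ (D%:R + s - 1) * (1 - t)) * Phi by ring.
    have -> : D%:R * v * (1 - t) = D%:R * (1 - t) * v by ring.
    exact: le_trans e1 (le_trans h1 e2).
  rewrite -(ler_pM2r t2).
  have tE : t `^ (D%:R + s - 1) = t `^ s * t `^ (D%:R - 1).
    by rewrite -powRD ?(gt_eqF t0) ?implybT//; congr (_ `^ _); ring.
  have e1 : D%:R * (t `^ (D%:R - 1) * (1 - t)) * v <= (1 - t `^ D%:R) * v.
    by rewrite ler_wpM2r// lerBrDl.
  have e2 : (1 - t `^ (D%:R + s)) * Phi <= (D%:R + s) * (1 - t) * Phi.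
    by rewrite ler_wpM2r//; move: tg3; lra.
  have e3 := ler_wpM2l (powR_ge0 t s) e1.
  have -> : D%:R * (t `^ (D%:R + s - 1) * v) * (1 - t) =
      t `^ s * (D%:R * (t `^ (D%:R - 1) * (1 - t)) * v) by rewrite tE; ring.
  have -> : (D%:R + s) * Phi * (1 - t) = (D%:R + s) * (1 - t) * Phi by ring.
  exact: le_trans e3 (le_trans h2 e2).
(* The offset 2 keeps the first term positive. *)
pose t n : R := 1 - n.+2%:R^-1.
have t0 n : 0 < t n by rewrite subr_gt0 invf_lt1// ltr1n.
have t1 n : t n < 1 by rewrite gtrBl.
have ct : t n `^ (D%:R + s - 1) @[n --> \oo] --> (1 : R).
  have c1 : t n @[n --> \oo] --> (1 : R).
    rewrite -[X in _ --> X](subr0 (1 : R)); apply: cvgB; first exact: cvg_cst.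
    by have := @cvg_harmonic R; rewrite -(cvg_shiftS (@harmonic R)).
  have := cvg_comp _ _ c1 (@powR_norm_continuous R _ b0 1).
  rewrite normr1 powR1 => cc.
  rewrite (_ : (fun n => _) = (fun n => `|t n| `^ (D%:R + s - 1)))//.
  by apply/funext => n; rewrite gtr0_norm.
apply/eqP; rewrite eq_le; apply/andP; split.
  have cc : (D%:R + s) * (t n `^ (D%:R + s - 1) * Phi) @[n --> \oo] --> (D%:R + s) * (1 * Phi).
    by apply: cvgMl_tmp; apply: cvgMr_tmp.
  rewrite mul1r in cc.
  by apply: (cvgr_to_le cc); apply: nearW => n; case: (step _ (t0 n) (t1 n)).
have cc : D%:R * (t n `^ (D%:R + s - 1) * v) @[n --> \oo] --> D%:R * (1 * v).
  by apply: cvgMl_tmp; apply: cvgMr_tmp.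
rewrite mul1r in cc.
by apply: (cvgr_to_le cc); apply: nearW => n; case: (step _ (t0 n) (t1 n)).
Qed.

End moments.

End gauge.

Section real_lemmas.
Context {R : realType}.

Lemma sub1_le_add (A B m e : R) : A - B <= e -> 1 - A <= m -> 1 - B <= e + m.
Proof. lra. Qed.

End real_lemmas.

Section lipschitz_max.
Context {R : realType} {D : nat}.

Lemma lipschitz_max (F G : 'rV[R]_D -> R) :
  (forall x z, F z - F x <= G x * enorm (x - z)) ->
  forall x z, `|F x - F z| <= Num.max (G x) (G z) * enorm (x - z).
Proof.
move=> lip1 x z; rewrite ler_norml; apply/andP; split.
  rewrite lerNl opprB; apply: le_trans (lip1 x z) _.
  by rewrite ler_wpM2r ?enorm_ge0// le_max lexx.
rewrite enormB; apply: le_trans (lip1 z x) _.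
by rewrite ler_wpM2r ?enorm_ge0// le_max lexx orbT.
Qed.

End lipschitz_max.

(** * Lower bound in terms of the gauge *)

Section gauge_lower_bound.
Context {R : realType} {D : nat}.
Local Notation V := 'rV[R]_D.
Local Notation mu := (@lebesgue_rV R D).
Variables (O : set V) (c : V) (r p q : R) (i0 : 'I_D).
Hypotheses (oO : open O) (bO : bounded_set O) (vO : convex_set O) (Oc : O c)
  (r0 : 0 < r) (rO : eball c r `<=` O) (D1 : (1 < D)%N)
  (p1 : 1 < p) (pq : p^-1 + q^-1 = 1).
Implicit Types (x y z : V).

Let p0 : 0 < p. Proof. exact: lt_trans p1. Qed.
Let q0 : 0 < q.
Proof. by rewrite -invr_gt0 (_ : q^-1 = 1 - p^-1) ?subr_gt0 ?invf_lt1// -pq; ring. Qed.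
Let q1 : 1 < q.
Proof. by rewrite -[1]invrK -[q]invrK ltf_pV2 ?posrE ?invr_gt0// invr1 -pq ltrDr invr_gt0. Qed.
Let mO : measurable O. Proof. exact: measurable_open_rV. Qed.
Let muO : (mu O < +oo)%E. Proof. exact: bounded_lebesgue_rV_lty. Qed.
Local Notation j := (gauge O c).

Lemma conjugate_expE : p * (q - 1) = q.
Proof.
have p00 : p != 0 by rewrite gt_eqF.
have q00 : q != 0 by rewrite gt_eqF.
have : p * q * (p^-1 + q^-1) = p * q by rewrite pq mulr1.
have -> : p * q * (p^-1 + q^-1) = q + p by field; rewrite p00 q00.
by move=> E; rewrite mulrBr mulr1 -E addrK.
Qed.

Lemma gauge_pow_lip y z :
  j y `^ q - j z `^ q <= q / r * j y `^ (q - 1) * enorm (y - z).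
Proof.
have jy := gauge_ge0 r0 rO y; have jz := gauge_ge0 r0 rO z.
have h : j y - j z <= enorm (y - z) / r by rewrite lerBlDl; exact: gauge_sub.
move: (j y) (j z) (enorm (y - z)) jy jz h => a b e a0 b0 h.
have tg := powR_tangent q1 b0 a0.
have h2 : q * (a `^ (q - 1) * (a - b)) <= q * (a `^ (q - 1) * (e / r)).
  by rewrite ler_pM2l// ler_wpM2l// powR_ge0.
have -> : q / r * a `^ (q - 1) * e = q * (a `^ (q - 1) * (e / r)) by ring.
have E : q * (a `^ (q - 1) * (a - b)) = - (q * (a `^ (q - 1) * (b - a))) by ring.
rewrite E in h2; move: tg h2.
move: (q * _) (q * _) (a `^ q) (b `^ q) => A B C F; lra.
Qed.

Lemma torsion_ge_gauge :
  (r / D%:R) `^ q * \int[mu]_(x in O) (j x `^ q) <= torsional_rigidity p O.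
Proof.
have D0 : 0 < D%:R :> R by rewrite ltr0n ltnW.
pose I := \int[mu]_(x in O) (j x `^ q).
(* The optimal k is y / q = r^q / (q D^(q - 1)), the constant in the torsion function of a ball.
   Then G = (r j / D)^(q - 1), both integrals of the bound equal (r / D)^q I, and 1 - p^-1 = q^-1 of
   it remains. *)
pose y := r * (r / D%:R) `^ (q - 1).
have y0 : 0 < y by rewrite mulr_gt0// powR_gt0// divr_gt0.
pose k := y / q.
have k0 : 0 < k by rewrite divr_gt0.
pose F x := k * Num.max 0 (1 - j x `^ q).
pose G x := k * (q / r) * j x `^ (q - 1).
have cj t : 0 < t -> continuous (fun x => j x `^ t).
  exact: (gauge_pow_continuous vO Oc r0 rO).
have c1 : continuous (fun x => 1 - j x `^ q).
  have -> : (fun x => 1 - j x `^ q) = (fun x => 1 + (-1) * j x `^ q).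
    by apply/funext => z; rewrite mulN1r.
  apply: continuous_addR; first exact: continuous_cstR.
  by apply: continuous_scaleR; exact: cj.
have cF : continuous F.
  apply: continuous_scaleR => x.
  apply: (@continuous_comp _ _ _ (fun x => 1 - j x `^ q) (fun t : R => Num.max 0 t)).
    exact: c1.
  by apply: continuous_max; [exact: cvg_cst|exact: cvg_id].
have cG : continuous G by apply: continuous_scaleR; apply: cj; rewrite subr_gt0.
have FO x : ~ O x -> F x = 0.
  move=> Ox; have g1 : 1 <= j x.
    by rewrite leNgt; apply/negP => /(gauge_in oO vO Oc r0 rO).
  rewrite /F max_l ?mulr0// subr_le0.
  by have := le_powR (ltW q0) ler01 g1; rewrite powR1.
have F0 x : 0 <= F x by rewrite mulr_ge0 ?(ltW k0)// le_max lexx.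
have G0 x : 0 <= G x by rewrite mulr_ge0 ?powR_ge0// mulr_ge0 ?(ltW k0)// divr_ge0 ?(ltW q0) ?(ltW r0).
have lip1 x z : F z - F x <= G x * enorm (x - z).
  have h := gauge_pow_lip x z.
  have h2 : Num.max 0 (1 - j z `^ q) - Num.max 0 (1 - j x `^ q) <=
      q / r * j x `^ (q - 1) * enorm (x - z).
    have g0 : 0 <= q / r * j x `^ (q - 1) * enorm (x - z).
      by rewrite mulr_ge0 ?enorm_ge0// mulr_ge0 ?powR_ge0// divr_ge0 ?(ltW q0) ?(ltW r0).
    rewrite lerBlDr ge_max; apply/andP; split.
      by rewrite addr_ge0// le_max lexx.
    have h3 : 1 - j x `^ q <= Num.max 0 (1 - j x `^ q) by rewrite le_max lexx orbT.
    exact: sub1_le_add h h3.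
  have {}h2 := ler_wpM2l (ltW k0) h2; rewrite /F /G -mulrBr; apply: (le_trans h2).
  by rewrite !mulrA.
have lip := lipschitz_max lip1.
have := torsion_ge_fun i0 oO bO p1 pq cF cG FO F0 G0 lip.
have ij : mu.-integrable O (EFin \o (fun x => j x `^ q)).
  by apply: continuous_integrable_on => //; exact: cj.
have ic : mu.-integrable O (EFin \o (fun=> 1)) by exact: cst_integrableR.
have EF : \int[mu]_(x in O) F x = k * (q / D%:R * I).
  have -> : \int[mu]_(x in O) F x = \int[mu]_(x in O) (k * (1 - j x `^ q)).
    apply: eq_Rintegral => x; rewrite inE => Ox; rewrite /F max_r// subr_ge0.
    have x1 := (gauge_in oO vO Oc r0 rO x).1 Ox.
    by have := le_powR (ltW q0) (gauge_ge0 r0 rO x) (ltW x1); rewrite powR1.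
  rewrite (RintegralZl k mO (integrableBR mO ic ij)) (RintegralB mO ic ij) Rintegral_cst//.
  rewrite mul1r -/I; congr (_ * _).
  have := gauge_moment oO bO vO Oc r0 rO q0 D1; rewrite -/I => E.
  have -> : fine (mu O) = D%:R^-1 * ((D%:R + q) * I) by rewrite E mulrA mulVf ?mul1r// gt_eqF.
  by field; rewrite gt_eqF.
have EG : \int[mu]_(x in O) (G x `^ p) = (k * (q / r)) `^ p * I.
  rewrite -(RintegralZl _ mO ij); apply: eq_Rintegral => x _.
  rewrite /G powRM ?powR_ge0//; last by rewrite mulr_ge0 ?(ltW k0)// divr_ge0 ?(ltW q0) ?(ltW r0).
  by rewrite -powRrM [_ * p]mulrC conjugate_expE.
rewrite EF EG.
have -> : k * (q / r) = (r / D%:R) `^ (q - 1).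
  by rewrite /k /y; field; rewrite !gt_eqF.
rewrite -powRrM [_ * p]mulrC conjugate_expE.
have -> : k * (q / D%:R * I) = (r / D%:R) `^ q * I.
  have -> : k * (q / D%:R * I) = y / D%:R * I by rewrite /k; field; rewrite !gt_eqF.
  rewrite /y -[in RHS](mulr_powRB1 _ q0); last by rewrite divr_ge0// ltW.
  by congr (_ * _); exact: mulrAC.
have -> : (r / D%:R) `^ q * I - p^-1 * ((r / D%:R) `^ q * I) = q^-1 * ((r / D%:R) `^ q * I).
  by rewrite (_ : q^-1 = 1 - p^-1); [ring|rewrite -pq; ring].
by rewrite ler_pM2l ?invr_gt0.
Qed.

End gauge_lower_bound.

(** * Upper bound for convex domains *)

Section log_sum_exp.
Context {R : realType} {D : nat}.
Local Notation V := 'rV[R]_D.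
Local Notation e_ i := (delta_mx ord0 i : V).
Implicit Types (x y v a : V).

Lemma dotrV_delta a i : dotrV a (e_ i) = a ord0 i.
Proof.
rewrite /dotrV (bigD1 i)//= big1 ?addr0 => [|j ji]; rewrite !mxE ?eqxx ?mulr1//.
by rewrite (negbTE ji) mulr0.
Qed.

Lemma is_derive_dotrV a (c : V) x v : is_derive x v (fun y => dotrV a (y - c)) (dotrV a v).
Proof.
apply: is_derive_line0.
have -> : (fun t : R => dotrV a (x + t *: v - c)) = (fun t : R => dotrV a v * t + dotrV a (x - c) * 1).
  apply/funext => t; have -> : x + t *: v - c = (x - c) + t *: v by rewrite addrAC.
  by rewrite dotrVDr dotrVZr mulr1 addrC [t * _]mulrC.
have d1 : is_derive (0 : R) 1 (fun t : R => dotrV a v * t) (dotrV a v).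
  apply: (is_derive_eq (is_deriveZ (dotrV a v) (is_derive_id (0 : R) 1))).
  by rewrite -[RHS]mulr1.
by apply: (is_derive_eq (is_deriveD d1 (is_derive_cst _ _ _))); rewrite addr0.
Qed.

Lemma is_derive_sumR (I : Type) (s : seq I) (h : I -> V -> R) (dh : I -> R) x v :
  (forall i, is_derive x v (h i) (dh i)) ->
  is_derive x v (fun y => \sum_(i <- s) h i y) (\sum_(i <- s) dh i).
Proof.
move=> H; elim: s => [|i s IH].
  by rewrite big_nil; under eq_fun do rewrite big_nil; exact: is_derive_cst.
have -> : (fun y => \sum_(j <- i :: s) h j y) = (fun y => 1 * h i y + 1 * \sum_(j <- s) h j y).
  by apply/funext => y; rewrite big_cons !mul1r.
by apply: (is_derive_eq (is_derive_linR 1 1 (H i) IH)); rewrite big_cons !mul1r.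
Qed.

Lemma is_derive_inv (z : R) : z != 0 -> is_derive z 1 (fun t : R => t^-1) (- z ^- 2).
Proof.
move=> z0; have := @is_deriveV R id z 1 1 z0 (is_derive_id z 1).
by move=> H; apply: (is_derive_eq H); rewrite -[RHS]mulr1.
Qed.

Variables (n : nat) (nu : 'I_n.+1 -> V) (s : 'I_n.+1 -> R) (c : V) (b : R).
Hypotheses (nu1 : forall k, enorm (nu k) = 1) (b0 : 0 < b).

Definition aff k x := s k + dotrV (nu k) (x - c).
Definition expw k x := expR (b * aff k x).
Definition Zsum x := \sum_k expw k x.
(** A soft maximum of the affine functions with sharpness b: it exceeds their maximum by at least
    b^-1 and at most b^-1 (ln (n + 1) + 1). *)
Definition lse x := b^-1 * (ln (Zsum x) + 1).
Definition lse_num i x := \sum_k (nu k ord0 i * expw k x).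
Definition lse_grad i x := lse_num i x * (Zsum x)^-1.

Lemma expw_gt0 k x : 0 < expw k x. Proof. exact: expR_gt0. Qed.

Lemma expw_le_Zsum k x : expw k x <= Zsum x.
Proof. by rewrite /Zsum (bigD1 k)//= lerDl sumr_ge0// => j _; exact/ltW/expw_gt0. Qed.

Lemma Zsum_gt0 x : 0 < Zsum x.
Proof. exact: lt_le_trans (expw_gt0 ord0 x) (expw_le_Zsum ord0 x). Qed.

Lemma is_derive_aff k i x : is_derive x (e_ i) (aff k) (nu k ord0 i).
Proof.
have := is_deriveD (is_derive_cst (s k) x (e_ i)) (is_derive_dotrV (nu k) c x (e_ i)).
by move=> H; apply: (is_derive_eq H); rewrite add0r dotrV_delta.
Qed.

Lemma is_derive_expw k i x : is_derive x (e_ i) (expw k) (b * nu k ord0 i * expw k x).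
Proof.
have d1 : is_derive x (e_ i) (fun y => b * aff k y) (b * nu k ord0 i).
  exact: (is_deriveZ b (is_derive_aff k i x)).
have := is_derive_compR d1 (is_derive_expR (b * aff k x)).
by move=> H; apply: (is_derive_eq H); rewrite mulrC.
Qed.

Lemma is_derive_Zsum i x : is_derive x (e_ i) Zsum (b * lse_num i x).
Proof.
have := is_derive_sumR (index_enum 'I_n.+1) (fun k => is_derive_expw k i x).
move=> H; apply: (is_derive_eq H); rewrite /lse_num mulr_sumr.
by apply: eq_bigr => k _; rewrite mulrA.
Qed.

Lemma is_derive_lse i x : is_derive x (e_ i) lse (lse_grad i x).
Proof.
have d1 := is_derive_compR (is_derive_Zsum i x) (is_derive1_ln (Zsum_gt0 x)).
have d2 := is_derive_linR b^-1 b^-1 d1 (is_derive_cst (1 : R) x (e_ i)).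
have -> : lse = (fun y => b^-1 * ln (Zsum y) + b^-1 * 1).
  by apply/funext => y; rewrite /lse mulrDr.
apply: (is_derive_eq d2); rewrite mulr0 addr0 /lse_grad.
by rewrite [(Zsum x)^-1 * _]mulrC !mulrA mulVf ?gt_eqF// mul1r.
Qed.

(** The second moment of the i-th coordinate of the normals under the softmax weights. Subtracting
    the squared mean [lse_grad i x ^+ 2] gives a variance, which times b is a diagonal entry of the
    Hessian. *)
Definition lse_sq i x := (\sum_k (nu k ord0 i ^+ 2 * expw k x)) * (Zsum x)^-1.

Lemma is_derive_lse_grad i x :
  is_derive x (e_ i) (lse_grad i) (b * (lse_sq i x - lse_grad i x ^+ 2)).
Proof.
have d1 : is_derive x (e_ i) (lse_num i) (b * \sum_k (nu k ord0 i ^+ 2 * expw k x)).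
  have H k := is_deriveZ (nu k ord0 i) (is_derive_expw k i x).
  apply: (is_derive_eq (is_derive_sumR (index_enum 'I_n.+1) H)).
  rewrite mulr_sumr; apply: eq_bigr => k _.
  rewrite -[LHS]/(nu k ord0 i * (b * nu k ord0 i * expw k x)); ring.
have Z0 : Zsum x != 0 by rewrite gt_eqF// Zsum_gt0.
have d2 := is_derive_compR (is_derive_Zsum i x) (is_derive_inv Z0).
have d3 := is_derive_mulR d1 d2.
apply: (is_derive_eq d3); rewrite /lse_sq /lse_grad.
move: (Zsum x) (lse_num i x) (\sum_k _) Z0 => Z N Q Z0.
by field.
Qed.

Lemma aff_continuous k : continuous (aff k).
Proof.
have -> : aff k = (fun x => s k + - dotrV (nu k) c + dotrV (nu k) x).
  by apply/funext => x; rewrite /aff dotrVDr dotrVNr addrA addrAC.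
apply: continuous_addR; first exact: continuous_cstR.
have -> : dotrV (nu k) = (fun x => dotrV x (nu k)).
  by apply/funext => x; rewrite dotrVC.
exact: dotrV_continuous.
Qed.

Lemma expw_continuous k : continuous (expw k).
Proof.
move=> x; apply: (@continuous_comp _ _ _ (fun x => b * aff k x) (@expR R)).
  by apply: continuous_scaleR; exact: aff_continuous.
exact: continuous_expR.
Qed.

Lemma Zsum_continuous : continuous Zsum.
Proof. by apply: continuous_sumR => k; exact: expw_continuous. Qed.

Lemma Zinv_continuous : continuous (fun x => (Zsum x)^-1).
Proof.
move=> x; have z0 : Zsum x != 0 by rewrite gt_eqF// Zsum_gt0.
exact: (cvgV z0 (@Zsum_continuous x)).
Qed.

Lemma lse_continuous : continuous lse.
Proof.
apply: continuous_scaleR; apply: continuous_addR; last exact: continuous_cstR.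
move=> x; apply: (@continuous_comp _ _ _ Zsum (@ln R)); first exact: Zsum_continuous.
exact/continuous_ln/Zsum_gt0.
Qed.

Lemma lse_grad_continuous i : continuous (lse_grad i).
Proof.
apply: continuous_mulR; last exact: Zinv_continuous.
by apply: continuous_sumR => k; apply: continuous_scaleR; exact: expw_continuous.
Qed.

Lemma lse_sq_continuous i : continuous (lse_sq i).
Proof.
apply: continuous_mulR; last exact: Zinv_continuous.
by apply: continuous_sumR => k; apply: continuous_scaleR; exact: expw_continuous.
Qed.

Lemma lse_ge k x : aff k x + b^-1 <= lse x.
Proof.
rewrite /lse mulrDr mulr1 lerD2r ler_pdivlMl// -(expRK (b * aff k x)).
by rewrite ler_ln ?posrE ?expR_gt0 ?Zsum_gt0//; exact: expw_le_Zsum.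
Qed.

Lemma lse_le x (B : R) : (forall k, aff k x <= B) -> lse x <= B + b^-1 * (ln n.+1%:R + 1).
Proof.
move=> H; rewrite /lse.
have h : Zsum x <= n.+1%:R * expR (b * B).
  apply: (@le_trans _ _ (\sum_(k < n.+1) expR (b * B))).
    by apply: ler_sum => k _; rewrite ler_expR ler_pM2l.
  by rewrite sumr_const card_ord mulr_natl.
have : ln (Zsum x) <= ln (n.+1%:R * expR (b * B)).
  by rewrite ler_ln ?posrE ?Zsum_gt0// mulr_gt0 ?expR_gt0.
rewrite lnM ?posrE ?expR_gt0// expRK => h2.
have -> : B + b^-1 * (ln n.+1%:R + 1) = b^-1 * (b * B + ln n.+1%:R + 1).
  by field; rewrite gt_eqF.
by rewrite ler_pM2l ?invr_gt0// lerD2r addrC.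
Qed.

Definition gradv x : V := \row_i lse_grad i x.
Let w k x := expw k x / Zsum x.

Let w_ge0 k x : 0 <= w k x.
Proof. by rewrite divr_ge0// ltW ?expw_gt0 ?Zsum_gt0. Qed.

Let w_sum x : \sum_k w k x = 1.
Proof. by rewrite -mulr_suml mulfV// gt_eqF// Zsum_gt0. Qed.

(** The softmax weights are non-negative with sum 1, so the gradient is an average of unit normals
    and has norm at most 1. *)
Lemma gradvE x : gradv x = \sum_k w k x *: nu k.
Proof.
apply/rowP => i; rewrite !mxE summxE /lse_grad /lse_num mulr_suml.
by apply: eq_bigr => k _; rewrite mxE /w [RHS]mulrC mulrA.
Qed.

Lemma enorm_sum (I : Type) (r : seq I) (f : I -> V) :
  enorm (\sum_(k <- r) f k) <= \sum_(k <- r) enorm (f k).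
Proof.
elim: r => [|k r IH]; first by rewrite !big_nil enorm0.
by rewrite !big_cons (le_trans (ler_enormD _ _))// lerD2l.
Qed.

Lemma enorm_gradv x : enorm (gradv x) <= 1.
Proof.
rewrite gradvE (le_trans (enorm_sum _ _))// -(w_sum x).
by apply: ler_sum => k _; rewrite enormZ nu1 mulr1 ger0_norm.
Qed.

Lemma dotrV_suml (I : Type) (r : seq I) (f : I -> V) y :
  dotrV (\sum_(k <- r) f k) y = \sum_(k <- r) dotrV (f k) y.
Proof.
elim: r => [|k r IH]; first by rewrite !big_nil dotrV0l.
by rewrite !big_cons dotrVDl IH.
Qed.

(** When the affine functions are non-negative at c, each nu k . (x - c) is below [aff k x]. This
    controls the cross term between F grad F and x - c. *)
Lemma gradv_dot_le x : (forall k, 0 <= s k) -> dotrV (gradv x) (x - c) <= lse x.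
Proof.
move=> s0; rewrite gradvE dotrV_suml.
apply: (@le_trans _ _ (\sum_k w k x * lse x)); last by rewrite -mulr_suml w_sum mul1r.
apply: ler_sum => k _; rewrite dotrVZl ler_wpM2l//.
apply: le_trans (lse_ge k x); rewrite /aff.
by rewrite [s k + _]addrC -addrA lerDl addr_ge0 ?s0// invr_ge0 ltW.
Qed.

Lemma sum_lse_sq x : \sum_i lse_sq i x = 1.
Proof.
rewrite -mulr_suml exchange_big /=.
have -> : \sum_k \sum_i nu k ord0 i ^+ 2 * expw k x = Zsum x.
  apply: eq_bigr => k _; rewrite -mulr_suml.
  have -> : \sum_i nu k ord0 i ^+ 2 = dotrV (nu k) (nu k).
    by apply: eq_bigr => i _; rewrite expr2.
  by rewrite -sqr_enorm nu1 expr1n mul1r.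
by rewrite mulfV// gt_eqF// Zsum_gt0.
Qed.

End log_sum_exp.

Section field_real_lemmas.
Context {R : realType}.
Implicit Types (e F B M d m : R).

(** The squared norm of (1 - e) F grad F + k (x - c), with G2 = |grad F|^2, gd = grad F . (x - c)
    and k = e / D. As 2 k <= e, which is D >= 2, the cross term is at most (1 - e) e F^2 and
    completes (1 - e)^2 F^2 to (1 - e) F^2. *)
Lemma lse_field_alg (e k F G2 gd m : R) : 0 <= e -> e <= 1 -> 0 <= k -> 2 * k <= e ->
  0 <= F -> G2 <= 1 -> e = 0 \/ gd <= F ->
  (1 - e) ^+ 2 * F ^+ 2 * G2 + 2 * ((1 - e) * k * (F * gd)) + k ^+ 2 * m <=
  (1 - e) * F ^+ 2 + k ^+ 2 * m.
Proof.
move=> e0 e1 k0 ke F0 G1 H; rewrite lerD2r.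
have e2 : 0 <= 1 - e by rewrite subr_ge0.
have h1 : (1 - e) ^+ 2 * F ^+ 2 * G2 <= (1 - e) ^+ 2 * F ^+ 2.
  by rewrite ler_piMr// mulr_ge0 ?sqr_ge0.
case: H => [E|gF].
  have k00 : k = 0 by rewrite E in ke; lra.
  have -> : 2 * ((1 - e) * k * (F * gd)) = 0 by rewrite k00; ring.
  by rewrite addr0; apply: le_trans h1 _; rewrite E subr0 expr1n.
have h2 : 2 * ((1 - e) * k * (F * gd)) <= (1 - e) * e * F ^+ 2.
  have h3 : (1 - e) * k * (F * gd) <= (1 - e) * k * (F * F).
    by apply: ler_wpM2l; [exact: mulr_ge0|exact: ler_wpM2l].
  have h4 : (1 - e) * (2 * k) * (F * F) <= (1 - e) * e * (F * F).
    by apply: ler_wpM2r; [exact: mulr_ge0|exact: ler_wpM2l].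
  rewrite expr2; apply: le_trans h4.
  have -> : (1 - e) * (2 * k) * (F * F) = 2 * ((1 - e) * k * (F * F)) by ring.
  by rewrite ler_pM2l.
have -> : (1 - e) * F ^+ 2 = (1 - e) ^+ 2 * F ^+ 2 + (1 - e) * e * F ^+ 2 by ring.
exact: lerD.
Qed.

(** As a function of F the root has slope at most sqrt (1 - e) <= 1, so an error d in F costs at
    most d in the norm. *)
Lemma sqrt_shift_le (e F B M d : R) : 0 <= e -> e <= 1 -> 0 <= B -> 0 <= F -> 0 <= M ->
  0 <= d -> F <= B + d ->
  Num.sqrt ((1 - e) * F ^+ 2 + M) <= Num.sqrt ((1 - e) * B ^+ 2 + M) + d.
Proof.
move=> e0 e1 B0 F0 M0 d0 FB; have e2 : 0 <= 1 - e by rewrite subr_ge0.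
have a1 : 0 <= (1 - e) * B ^+ 2 by rewrite mulr_ge0 ?sqr_ge0.
set S := Num.sqrt ((1 - e) * B ^+ 2 + M).
have S0 : 0 <= S by exact: sqrtr_ge0.
have S2 : S ^+ 2 = (1 - e) * B ^+ 2 + M by rewrite sqr_sqrtr// addr_ge0.
have SB : (1 - e) * B <= S.
  have h : (1 - e) * B <= Num.sqrt ((1 - e) * B ^+ 2).
    rewrite -[leLHS]ger0_norm ?mulr_ge0// -sqrtr_sqr ler_wsqrtr// exprMn.
    apply: ler_wpM2r; first exact: sqr_ge0.
    by rewrite expr2 ler_piMr// gerBl.
  by apply: le_trans h _; rewrite ler_wsqrtr// lerDl.
clearbody S.
rewrite -[leRHS]ger0_norm ?addr_ge0// -sqrtr_sqr ler_wsqrtr//.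
have h1 : F ^+ 2 <= (B + d) ^+ 2 by rewrite ler_sqr ?nnegrE ?addr_ge0.
have h2 : (1 - e) * F ^+ 2 <= (1 - e) * (B + d) ^+ 2 by exact: ler_wpM2l.
have h3 : (1 - e) * B * d <= S * d by exact: ler_wpM2r.
have h4 : (1 - e) * d ^+ 2 <= d ^+ 2 by rewrite ler_piMl ?sqr_ge0// gerBl.
have E1 : (S + d) ^+ 2 = S ^+ 2 + 2 * (S * d) + d ^+ 2 by ring.
have E2 : (1 - e) * (B + d) ^+ 2 = (1 - e) * B ^+ 2 + 2 * ((1 - e) * B * d) + (1 - e) * d ^+ 2 by ring.
rewrite E1 S2; rewrite E2 in h2; move: h2 h3 h4.
move: ((1 - e) * F ^+ 2) ((1 - e) * B ^+ 2) ((1 - e) * B * d) ((1 - e) * d ^+ 2) (S * d) (d ^+ 2).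
move=> a b c x y z; lra.
Qed.

Lemma lse_div_alg (e G bL : R) : e <= 1 -> G <= 1 -> 1 <= bL ->
  - (1 - e) * (G + bL * (1 - G)) - e <= -1.
Proof.
move=> e1 G1 b1; have h : 0 <= (1 - e) * ((bL - 1) * (1 - G)).
  by rewrite !mulr_ge0 ?subr_ge0.
have -> : - (1 - e) * (G + bL * (1 - G)) - e = - 1 - (1 - e) * ((bL - 1) * (1 - G)) by ring.
by rewrite gerBl.
Qed.

End field_real_lemmas.

(** * The mixed field *)

Section lse_field.
Context {R : realType} {D : nat}.
Local Notation V := 'rV[R]_D.
Local Notation mu := (@lebesgue_rV R D).
Local Notation e_ i := (delta_mx ord0 i : V).
Variables (O : set V) (p q : R) (i0 : 'I_D).
Hypotheses (oO : open O) (bO : bounded_set O) (D1 : (1 < D)%N)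
  (p1 : 1 < p) (pq : p^-1 + q^-1 = 1).
Variables (n : nat) (nu : 'I_n.+1 -> V) (s : 'I_n.+1 -> R) (c : V) (e d : R) (B : V -> R).
Hypotheses (nu1 : forall k, enorm (nu k) = 1) (e0 : 0 <= e) (e1 : e <= 1) (d0 : 0 < d)
  (cB : continuous B) (B0 : forall x, O x -> 0 <= B x)
  (affB : forall x k, O x -> aff nu s c k x <= B x + d)
  (aff0 : forall x, O x -> exists k, 0 <= aff nu s c k x)
  (es : e = 0 \/ forall k, 0 <= s k).

Let q0 : 0 < q.
Proof. by rewrite -invr_gt0 (_ : q^-1 = 1 - p^-1) ?subr_gt0 ?invf_lt1 ?(lt_trans ltr01)// -pq; ring. Qed.
Let mO : measurable O. Proof. exact: measurable_open_rV. Qed.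

(** The sharpness for which the total excess b^-1 (ln (n + 1) + 1) of the soft maximum is exactly
    d. *)
Let b := d^-1 * (ln n.+1%:R + 1).
Let ln0 : 0 < ln (n.+1%:R : R) + 1.
Proof. by rewrite ltr_wpDl// ln_ge0// ler1n. Qed.
Let b0 : 0 < b. Proof. by rewrite mulr_gt0 ?invr_gt0. Qed.
Let bd : b^-1 * (ln n.+1%:R + 1) = d.
Proof. by rewrite /b invfM invrK -mulrA mulVf ?mulr1// gt_eqF. Qed.

Let F := lse nu s c b.
Let g i := lse_grad nu s c b i.
Let k : R := e / D%:R.
Let W x : V := \row_i ((- (1 - e)) * (F x * g i x) + (- k) * (x ord0 i - c ord0 i)).
Let dW i x := (- (1 - e)) * (g i x * g i x + F x * (b * (lse_sq nu s c b i x - g i x ^+ 2))) + (- k) * 1.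

Let WE i : (fun x => W x ord0 i) =
  (fun x => (- (1 - e)) * (F x * g i x) + (- k) * (x ord0 i - c ord0 i)).
Proof. by apply/funext => x; rewrite mxE. Qed.

Let cF : continuous F. Proof. exact: lse_continuous. Qed.
Let cg i : continuous (g i). Proof. exact: lse_grad_continuous. Qed.

Let ccoord i : continuous (fun x : V => x ord0 i - c ord0 i).
Proof.
by apply: continuous_addR; [exact: continuous_coordR|exact: continuous_cstR].
Qed.

Let cW i : continuous (fun x => W x ord0 i).
Proof.
rewrite WE; apply: continuous_addR; apply: continuous_scaleR; last exact: ccoord.
exact: continuous_mulR.
Qed.

Let cdW i : continuous (dW i).
Proof.
apply: continuous_addR; last exact: continuous_cstR.
apply: continuous_scaleR; apply: continuous_addR.
  exact: (continuous_mulR (@cg i) (@cg i)).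
apply: continuous_mulR; first exact: cF.
apply: continuous_scaleR.
have -> : (fun x => lse_sq nu s c b i x - g i x ^+ 2) =
    (fun x => lse_sq nu s c b i x + (-1) * (g i x * g i x)).
  by apply/funext => x; rewrite mulN1r expr2.
apply: continuous_addR; first exact: lse_sq_continuous.
by apply: continuous_scaleR; exact: (continuous_mulR (@cg i) (@cg i)).
Qed.

Let dWE i x : is_derive x (e_ i) (fun y => W y ord0 i) (dW i x).
Proof.
rewrite WE; apply: is_derive_linR.
  have H1 := is_derive_lse nu s c b0 i x.
  have H2 := is_derive_lse_grad nu s c b i x.
  exact: (is_derive_mulR H1 H2).
have := is_deriveB (is_derive_coord i i x) (is_derive_cst (c ord0 i) x (e_ i)).
by move=> H; apply: (is_derive_eq H); rewrite eqxx subr0.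
Qed.

Let F_ge x : O x -> b^-1 <= F x.
Proof.
move=> Ox; have [l l0] := aff0 Ox; apply: le_trans (lse_ge nu s c b0 l x).
by rewrite lerDr.
Qed.

Let gnorm x : \sum_i g i x ^+ 2 = enorm (gradv nu s c b x) ^+ 2.
Proof. by rewrite sqr_enorm; apply: eq_bigr => i _; rewrite !mxE expr2. Qed.

Let gnorm1 x : enorm (gradv nu s c b x) ^+ 2 <= 1.
Proof. by rewrite expr_le1 ?enorm_ge0// enorm_gradv. Qed.

Let D0 : 0 < D%:R :> R. Proof. by rewrite ltr0n ltnW. Qed.

(* Since the nu k are unit vectors, div (F grad F) = |grad F|^2 + b F (1 - |grad F|^2), which is at least 1
   once b F >= 1; this is the reason for the shift by b^-1 in lse. *)
Let divW x : O x -> \sum_i dW i x <= -1.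
Proof.
move=> Ox.
have -> : \sum_i dW i x = - (1 - e) *
    (enorm (gradv nu s c b x) ^+ 2 + b * F x * (1 - enorm (gradv nu s c b x) ^+ 2)) - e.
  rewrite /dW big_split /= -mulr_sumr big_split /= -mulr_sumr -mulr_sumr sumrB.
  rewrite (sum_lse_sq s c b nu1) gnorm sumr_const card_ord.
  have -> : - k * 1 *+ D = - e.
    by rewrite mulr1 mulNrn -mulr_natr /k divfK// gt_eqF.
  by congr (- (1 - e) * (_ + _) + _); rewrite mulrA [F x * b]mulrC.
apply: lse_div_alg => //.
have h := F_ge Ox; rewrite -(ler_pM2l b0) in h; apply: le_trans h.
by rewrite divff// gt_eqF.
Qed.

(** The limiting bound for the norm of the mixed field, with B in place of F; the coefficient 1 - e,
    and not its square, accounts for the absorbed cross term. *)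
Definition mix_norm x := Num.sqrt ((1 - e) * B x ^+ 2 + (e / D%:R) ^+ 2 * enorm (x - c) ^+ 2).

Let Wnorm x : O x -> enorm (W x) <= mix_norm x + 2 * d.
Proof.
move=> Ox; have F0 : 0 <= F x by apply: le_trans (F_ge Ox); rewrite invr_ge0 ltW.
have k0 : 0 <= k by rewrite divr_ge0// ltW.
have ke : 2 * k <= e.
  by rewrite /k mulrCA ler_piMr// ler_pdivrMr// mul1r ler_nat.
have WE2 : W x = - ((1 - e) * F x) *: gradv nu s c b x + (- k) *: (x - c).
  by apply/rowP => i; rewrite !mxE -/(g i x); ring.
have FB : F x <= B x + 2 * d.
  apply: (@le_trans _ _ (B x + d + d)); last by rewrite mulr_natl mulr2n addrA.
  rewrite -{2}bd; apply: (lse_le b0) => l; exact: affB.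
apply: (@le_trans _ _ (Num.sqrt ((1 - e) * F x ^+ 2 + k ^+ 2 * enorm (x - c) ^+ 2))); last first.
  apply: sqrt_shift_le => //; first exact: B0.
    by rewrite mulr_ge0 ?sqr_ge0.
  by rewrite mulr_ge0// ltW.
have gd : e = 0 \/ dotrV (gradv nu s c b x) (x - c) <= F x.
  by case: es => [->|s0]; [left|right; exact: gradv_dot_le].
have := lse_field_alg (enorm (x - c) ^+ 2) e0 e1 k0 ke F0 (gnorm1 x) gd.
have <- : enorm (W x) ^+ 2 = (1 - e) ^+ 2 * F x ^+ 2 * enorm (gradv nu s c b x) ^+ 2 +
    2 * ((1 - e) * k * (F x * dotrV (gradv nu s c b x) (x - c))) + k ^+ 2 * enorm (x - c) ^+ 2.
  rewrite !sqr_enorm WE2; move: (gradv nu s c b x) (x - c) (F x) => G y f.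
  rewrite !(dotrVDl, dotrVDr, dotrVZl, dotrVZr) (dotrVC y G); ring.
move=> h; rewrite -[enorm (W x)]ger0_norm ?enorm_ge0// -sqrtr_sqr.
exact: ler_wsqrtr.
Qed.

Lemma mix_norm_continuous : continuous mix_norm.
Proof.
move=> x.
apply: (@continuous_comp _ _ _ (fun x => (1 - e) * B x ^+ 2 + (e / D%:R) ^+ 2 * enorm (x - c) ^+ 2)
  (Num.sqrt : R -> R)); last exact: sqrt_continuous.
apply: (@continuous_addR _ _ (fun x => (1 - e) * B x ^+ 2) (fun x => (e / D%:R) ^+ 2 * enorm (x - c) ^+ 2)).
  by apply: continuous_scaleR; apply: (continuous_mulR cB cB).
apply: continuous_scaleR.
have ce : continuous (fun x : V => enorm (x - c)).
  apply: continuous_enorm_field => i.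
  have -> : (fun x : V => (x - c) ord0 i) = (fun x => x ord0 i - c ord0 i).
    by apply/funext => y; rewrite !mxE.
  exact: ccoord.
exact: (continuous_mulR ce ce).
Qed.

Lemma torsion_le_lse : torsional_rigidity p O <= \int[mu]_(x in O) ((mix_norm x + 2 * d) `^ q).
Proof.
apply: le_trans (torsion_le_field oO bO p1 pq cW cdW dWE divW i0) _.
have cm : continuous (fun x => mix_norm x + 2 * d).
  by apply: continuous_addR; [exact: mix_norm_continuous|exact: continuous_cstR].
have im : mu.-integrable O (EFin \o (fun x => (mix_norm x + 2 * d) `^ q)).
  apply: continuous_integrable_on => // x.
  have -> : (fun x => (mix_norm x + 2 * d) `^ q) = (fun x => `|mix_norm x + 2 * d| `^ q).
    by apply/funext => y; rewrite ger0_norm// addr_ge0 ?sqrtr_ge0// mulr_ge0// ltW.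
  apply: (@continuous_comp _ _ _ (fun x => mix_norm x + 2 * d) (fun t : R => `|t| `^ q)).
    exact: cm.
  exact: powR_norm_continuous.
apply: (le_Rintegral mO (field_pow_integrable oO bO p1 pq cW) im) => x Ox.
by apply: le_powR; [exact: ltW|exact: enorm_ge0|exact: Wnorm].
Qed.

End lse_field.

Section strict_integral.
Context {R : realType} {D : nat}.
Local Notation V := 'rV[R]_D.
Local Notation mu := (@lebesgue_rV R D).
Variables (O : set V).
Hypotheses (oO : open O) (bO : bounded_set O).

Let mO : measurable O. Proof. exact: measurable_open_rV. Qed.
Let muO : (mu O < +oo)%E. Proof. exact: bounded_lebesgue_rV_lty. Qed.

Lemma Rintegral_gt0 (f : V -> R) x0 : continuous f -> (forall x, O x -> 0 <= f x) -> O x0 ->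
  0 < f x0 -> 0 < \int[mu]_(x in O) f x.
Proof.
move=> cf f0 Ox0 fx0; pose U := O `&` [set x | f x0 / 2 < f x].
have e0 : 0 < f x0 / 2 by rewrite divr_gt0.
have oU : open U.
  apply: openI => //; have -> : [set x | f x0 / 2 < f x] = f @^-1` [set t | f x0 / 2 < t] by [].
  by apply: open_comp; [move=> x _; exact: cf|exact: open_gt].
have mU := measurable_open_rV oU.
have UO : U `<=` O by move=> x [].
have U0 : (0 < mu U)%E.
  by apply: open_lebesgue_rV_gt0 => //; exists x0; split => //=; rewrite ltr_pdivrMr// ltr_pMr// ltr1n.
have Uoo : (mu U < +oo)%E by apply: le_lt_trans muO; apply: le_measure; rewrite ?inE.
have if_ : mu.-integrable O (EFin \o f) by exact: continuous_integrable_on.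
pose o := (cst (f x0 / 2)) \_ U.
have OU : O `&` U = U by rewrite setIC; apply/setIidPl.
have io : \int[mu]_(x in O) o x = f x0 / 2 * fine (mu U).
  by rewrite -Rintegral_cst// -[in RHS]OU Rintegral_mkcondr.
have oi : mu.-integrable O (EFin \o o).
  apply: (le_integrableR mO _ _ (cst_integrableR mO (f x0 / 2) muO)).
    by apply/measurable_restrict => //; exact: measurable_cst.
  move=> x _; have [Ux|Ux] := pselect (U x).
    by rewrite /o (restrict_in _ Ux) /= gtr0_norm.
  by rewrite /o (restrict_out _ Ux) normr0 ltW.
apply: (@lt_le_trans _ _ (\int[mu]_(x in O) o x)).
  by rewrite io mulr_gt0// fine_gt0// U0.
apply: (le_Rintegral mO oi if_) => x Ox; have [Ux|Ux] := pselect (U x).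
  by rewrite /o (restrict_in _ Ux) /= ltW//; case: Ux.
by rewrite /o (restrict_out _ Ux) f0.
Qed.

Lemma lt_Rintegral_continuous (f g : V -> R) x0 : continuous f -> continuous g ->
  (forall x, O x -> f x <= g x) -> O x0 -> f x0 < g x0 ->
  \int[mu]_(x in O) f x < \int[mu]_(x in O) g x.
Proof.
move=> cf cg fg Ox0 lt.
have if_ : mu.-integrable O (EFin \o f) by exact: continuous_integrable_on.
have ig : mu.-integrable O (EFin \o g) by exact: continuous_integrable_on.
rewrite -subr_gt0 -(RintegralB mO ig if_).
apply: (@Rintegral_gt0 _ x0) => //.
- have -> : (fun x => g x - f x) = (fun x => g x + (-1) * f x).
    by apply/funext => x; rewrite mulN1r.
  by apply: continuous_addR => //; exact: continuous_scaleR.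
- by move=> x Ox; rewrite subr_ge0 fg.
- by rewrite subr_gt0.
Qed.

Lemma continuous_powR (H : V -> R) q : 0 < q -> continuous H -> (forall x, 0 <= H x) ->
  continuous (fun x => H x `^ q).
Proof.
move=> q0 cH H0 x.
have -> : (fun x => H x `^ q) = (fun x => `|H x| `^ q).
  by apply/funext => y; rewrite ger0_norm.
by apply: (@continuous_comp _ _ _ H (fun s : R => `|s| `^ q)); [exact: cH|exact: powR_norm_continuous].
Qed.

Lemma Rintegral_powR_shift_le (H : V -> R) q (T : R) : 1 < q -> continuous H ->
  (forall x, 0 <= H x) ->
  (forall e, 0 < e -> T <= \int[mu]_(x in O) ((H x + e) `^ q)) ->
  T <= \int[mu]_(x in O) (H x `^ q).
Proof.
move=> q1 cH H0 HT; have q0 : 0 < q by exact: lt_trans q1.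
pose e n : R := n.+1%:R^-1.
have e0 n : 0 < e n by rewrite invr_gt0.
have e1 n : e n <= 1 by rewrite /e invf_le1 ?ler1n.
have pH := continuous_pint oO bO q1 cH.
have pHe n : pint mu O q (fun x => H x + e n).
  apply: (continuous_pint oO bO q1); apply: continuous_addR => //; exact: continuous_cstR.
have pe n : pint mu O q (fun=> e n) by apply: (continuous_pint oO bO q1); exact: continuous_cstR.
have c1 : e n * fine (mu O) @[n --> \oo] --> 0 * fine (mu O).
  by apply: cvgMr_tmp; exact: cvg_harmonic.
have c2 : npow mu O q (fun x => H x + e n) @[n --> \oo] --> npow mu O q H.
  apply: (@npow_cvg _ _ _ mu O q mO q1 _ _ (fun n => fun=> e n)) => //.
    by move=> n x _; rewrite addrAC subrr add0r.
  apply: (@squeeze_cvgr _ _ _ _ (fun=> 0) (fun n => e n * fine (mu O))).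
  - apply: nearW => n; rewrite npow_ge0 /= /npow Rintegral_cst//.
    rewrite ler_wpM2r ?fine_ge0// (ger0_norm (ltW (e0 n))).
    by rewrite -{2}(powRr1 (ltW (e0 n))) ger_powR ?e0 ?e1//= ltW.
  - exact: cvg_cst.
  - by move: c1; rewrite mul0r.
have E : npow mu O q H = \int[mu]_(x in O) (H x `^ q).
  by apply: eq_Rintegral => x _; rewrite ger0_norm.
rewrite -E; apply: (cvgr_to_ge c2); apply: nearW => n.
have -> : npow mu O q (fun x => H x + e n) = \int[mu]_(x in O) ((H x + e n) `^ q).
  by apply: eq_Rintegral => x _; rewrite ger0_norm// addr_ge0// ltW.
exact: HT.
Qed.

(** The closure of O is compact and is covered by the d-balls around points of O, so the net can be
    chosen inside O. *)
Lemma finite_net x0 (d : R) : O x0 -> 0 < d -> exists n (X : 'I_n.+1 -> V),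
  (forall k, O (X k)) /\ forall y, O y -> exists k, enorm (y - X k) < d.
Proof.
move=> Ox0 d0.
have [M M0 HM] := bounded_normP bO.
have cB : compact [set x : V | `|0 - x| <= M] by exact: closed_norm_ball_compact.
have cO : compact (closure O).
  apply: (subclosed_compact (@closed_closure _ O) cB).
  have -> : [set x : V | `|0 - x| <= M] = closure [set x : V | `|0 - x| <= M].
    by apply/closure_id; exact: (compact_closed (@norm_hausdorff _ _) cB).
  by apply: closure_subset => x /HM; rewrite /= sub0r normrN.
pose f (x : V) : set V := [set y : V | enorm (y - x) < d].
have of_ (x : V) : open (f x).
  have -> : f x = (fun y : V => enorm (x - y)) @^-1` [set t | t < d].
    by apply/seteqP; split => y /=; rewrite /f /= enormB.
  apply: open_comp; last exact: open_lt.
  move=> y _; apply: (@continuous_comp _ _ _ (fun y : V => x - y) (enorm : V -> R)).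
    exact: continuous_subl.
  exact: enorm_continuous.
have : cover_compact (closure O) by rewrite -compact_cover.
move=> /(_ V O f (fun x _ => of_ x)) [].
  move=> y cy; have [|x [Ox xy]] := cy (f y).
    by apply: open_nbhs_nbhs; split => //; rewrite /f /= subrr enorm0.
  by exists x => //; rewrite /f /= enormB.
move=> D' sD HD.
(* Putting x0 at the head makes the list nonempty of length n + 1, as the index type demands. *)
exists (size (finmap.enum_fset D')), (fun k => nth x0 (x0 :: finmap.enum_fset D') k); split.
  move=> k; have : nth x0 (x0 :: finmap.enum_fset D') k \in x0 :: finmap.enum_fset D' by rewrite mem_nth//= ltn_ord.
  rewrite in_cons => /orP[/eqP ->//|kD].
  by have := sD _ kD; rewrite inE.
move=> y Oy; have [x /= xD fx] := HD _ (subset_closure Oy).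
have lt : (index x (x0 :: finmap.enum_fset D') < (size (finmap.enum_fset D')).+1)%N.
  by rewrite index_mem in_cons [X in _ || X]xD orbT.
exists (Ordinal lt); rewrite /= -[if _ then _ else _]/(index x (x0 :: finmap.enum_fset D')) nth_index//.
by rewrite in_cons [X in _ || X]xD orbT.
Qed.

End strict_integral.

(** * Strict upper bound in terms of the gauge *)

Section convex_upper_bound.
Context {R : realType} {D : nat}.
Local Notation V := 'rV[R]_D.
Local Notation mu := (@lebesgue_rV R D).
Variables (O : set V) (c : V) (r p q : R) (i0 : 'I_D).
Hypotheses (oO : open O) (bO : bounded_set O) (vO : convex_set O) (Oc : O c)
  (rc : cdist O c = r) (rmax : forall x, cdist O x <= r) (D1 : (1 < D)%N)
  (p1 : 1 < p) (pq : p^-1 + q^-1 = 1).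
Implicit Types (x y z nu : V).

Let p0 : 0 < p. Proof. exact: lt_trans p1. Qed.
Let q0 : 0 < q.
Proof. by rewrite -invr_gt0 (_ : q^-1 = 1 - p^-1) ?subr_gt0 ?invf_lt1// -pq; ring. Qed.
Let q1 : 1 < q.
Proof. by rewrite -[1]invrK -[q]invrK ltf_pV2 ?posrE ?invr_gt0// invr1 -pq ltrDr invr_gt0. Qed.
Let r0 : 0 < r. Proof. by rewrite -rc; apply: cdist_gt0. Qed.
Let rO : eball c r `<=` O.
Proof. by move=> y yr; apply: (cdist_ball (x := c)); rewrite rc. Qed.
Let D0 : 0 < D%:R :> R. Proof. by rewrite ltr0n ltnW. Qed.
Local Notation j := (gauge O c).
Let B x := r - cdist O x.

(** O lies in the half-space with outer unit normal nu whose boundary is at distance [cdist O x]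
    from x. *)
Definition supports x nu := enorm nu = 1 /\ forall z, O z -> dotrV nu (z - x) <= cdist O x.

Let cB : continuous B.
Proof.
have -> : B = (fun x => r + (-1) * cdist O x) by apply/funext => x; rewrite mulN1r.
apply: continuous_addR; first exact: continuous_cstR.
by apply: continuous_scaleR; exact: cdist_continuous.
Qed.

Let B0 x : 0 <= B x. Proof. by rewrite subr_ge0. Qed.

(** The half-space contains the whole ball of radius [cdist O z] about z, so z may be pushed along
    nu by almost that radius. Hence r minus the distance to the hyperplane is at most r -
    [cdist O z]. *)
Lemma supports_le x nu z : supports x nu -> O z ->
  dotrV nu (z - x) + cdist O z <= cdist O x.
Proof.
move=> [nu1 Hnu] Oz; apply/ler_addgt0Pr => e e0.
have d0 := cdist_gt0 i0 oO bO Oz.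
pose t := Num.max 0 (cdist O z - e).
have t0 : 0 <= t by rewrite le_max lexx.
have td : t < cdist O z by rewrite gt_max d0 gtrBl e0.
have te : cdist O z - e <= t by rewrite le_max lexx orbT.
clearbody t.
have Ozt : O (z + t *: nu).
  apply: (cdist_ball (x := z)); rewrite addrAC subrr add0r enormZ nu1 mulr1.
  by rewrite ger0_norm.
have := Hnu _ Ozt; have -> : z + t *: nu - x = (z - x) + t *: nu by rewrite addrAC.
rewrite dotrVDr dotrVZr -sqr_enorm nu1 expr1n mulr1.
move: (dotrV _ _) (cdist O z) (cdist O x) te => a b d te; lra.
Qed.

(** Half-spaces supporting O at a finite net suffice up to an error, which [Rintegral_powR_shift_le]
    removes. The second alternative says that every such half-space is tangent to the inscribed
    ball; it makes the affine functions non-negative at c, as mixing requires. *)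
Lemma torsion_le_mix e : 0 <= e -> e <= 1 ->
  e = 0 \/ (forall x nu, O x -> supports x nu -> cdist O x + dotrV nu (x - c) <= r) ->
  torsional_rigidity p O <= \int[mu]_(x in O) (mix_norm c e B x `^ q).
Proof.
move=> e0 e1 He; apply: (Rintegral_powR_shift_le oO bO q1).
- exact: mix_norm_continuous.
- by move=> x; exact: sqrtr_ge0.
move=> d2 d20; pose d := d2 / 2.
have d0 : 0 < d by rewrite divr_gt0.
have [n [X [OX HX]]] := finite_net bO Oc d0.
have /choice[nu Hnu] : forall k, exists nu, supports (X k) nu.
  by move=> k; have [nu nu1 H] := supporting_half_space i0 oO bO vO (OX k); exists nu.
(* With this value at c, [aff k x] is r + d minus the distance from x to the k-th hyperplane; the
   extra d keeps it non-negative for x within d of X k. *)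
pose s k := r + d - cdist O (X k) - dotrV (nu k) (X k - c).
have affE k x : aff nu s c k x = r + d - cdist O (X k) + dotrV (nu k) (x - X k).
  rewrite /aff /s (_ : x - c = (x - X k) + (X k - c)); last by rewrite addrA subrK.
  by rewrite (dotrVDr (x - X k) (X k - c)); ring.
have -> : d2 = 2 * d by rewrite /d mulrCA divff ?mulr1.
apply: (torsion_le_lse i0 oO bO D1 p1 pq (nu := nu) (s := s)) => //.
- by move=> k; case: (Hnu k).
- move=> x k Ox; rewrite affE /B.
  have := supports_le (Hnu k) Ox.
  by move: (dotrV _ _) (cdist O x) (cdist O (X k)) => a b t; lra.
- move=> x Ox; have [k xk] := HX x Ox; exists k; rewrite affE.
  have h1 := rmax (X k).
  have h2 : `|dotrV (nu k) (x - X k)| <= d.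
    apply: le_trans (norm_dotrV _ _) _; have [-> _] := Hnu k.
    by rewrite mul1r ltW.
  move: h2; rewrite ler_norml => /andP[h2 _]; move: h1 h2.
  by move: (dotrV _ _) (cdist O (X k)) => a b; lra.
- case: He => [->|H]; [by left|right => k].
  have := H _ _ (OX k) (Hnu k); rewrite /s.
  by move: (dotrV _ _) (cdist O (X k)) => a b; move: d0; lra.
Qed.

Let cj : continuous (fun x => j x `^ q).
Proof. exact: (gauge_pow_continuous vO Oc r0 rO). Qed.

Let Bj x : B x <= r * j x. Proof. exact: (gauge_cdist oO bO vO Oc r0 rO i0). Qed.

Let j0 x : 0 <= j x. Proof. exact: (gauge_ge0 r0 rO). Qed.

Let crj : continuous (fun x => (r * j x) `^ q).
Proof.
apply: continuous_powR => //; last by move=> x; rewrite mulr_ge0 ?(ltW r0).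
by apply: continuous_scaleR; exact: (gauge_continuous vO Oc r0 rO).
Qed.

Lemma gauge_moment_gt0 : 0 < \int[mu]_(x in O) (j x `^ q).
Proof.
have E := gauge_moment oO bO vO Oc r0 rO q0 D1.
have Dq : 0 < D%:R + q by rewrite addr_gt0.
rewrite -(pmulr_rgt0 _ Dq) E mulr_gt0// fine_gt0// open_lebesgue_rV_gt0//=; last by exists c.
by apply: bounded_lebesgue_rV_lty => //; exact: measurable_open_rV.
Qed.

Let int_rj : \int[mu]_(x in O) ((r * j x) `^ q) = r `^ q * \int[mu]_(x in O) (j x `^ q).
Proof.
have ij : mu.-integrable O (EFin \o (fun x => j x `^ q)) by exact: continuous_integrable_on.
rewrite -(RintegralZl _ (measurable_open_rV oO) ij).
by apply: eq_Rintegral => x _; rewrite powRM ?(ltW r0).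
Qed.

(* If some nearest half-space is not tangent to the inscribed ball then r - cdist < r j near the
   corresponding point; otherwise mixing the field with x / D reduces its norm everywhere. *)
Lemma torsion_lt_gauge :
  torsional_rigidity p O < r `^ q * \int[mu]_(x in O) (j x `^ q).
Proof.
have [H|] := pselect (forall x nu, O x -> supports x nu -> cdist O x + dotrV nu (x - c) <= r).
  have [M M0 HM] : exists2 M : R, 0 < M & forall y, O y -> enorm (y - c) <= M.
    have ce : continuous (fun y : V => enorm (c - y)).
      move=> y; apply: (@continuous_comp _ _ _ (fun y : V => c - y) (enorm : V -> R)).
        exact: continuous_subl.
      exact: enorm_continuous.
    have [K K0 HK] := continuous_bounded_on bO ce; exists (K + 1); first by rewrite ltr_wpDl.
    by move=> y Oy; have := HK y Oy; rewrite ger0_norm ?enorm_ge0// enormB => /le_trans; apply; rewrite lerDl.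
  have Mj x : enorm (x - c) <= M * j x.
    apply: (gauge_homogeneous_le vO Oc r0 rO (f := enorm)) => //; last exact: ltW.
    by move=> t v t0; rewrite enormZ gtr0_norm.
  pose C := (M / (D%:R * r)) ^+ 2.
  have C0 : 0 < C by rewrite exprn_gt0// divr_gt0// mulr_gt0.
  (* In units of (r j)^2, mixing removes e from the squared norm and adds at most e (e C) <= e / 2
     through x / D, which leaves the factor th^2 = 1 - e / 2. *)
  pose e := Num.min 1 (2 * C)^-1.
  have e0 : 0 < e by rewrite lt_min ltr01 invr_gt0 mulr_gt0.
  have e1 : e <= 1 by rewrite ge_min lexx.
  have eC : e * C <= 2^-1.
    have h : e <= (2 * C)^-1 by rewrite ge_min lexx orbT.
    have := ler_wpM2r (ltW C0) h; rewrite invfM -mulrA mulVf ?mulr1//.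
    by rewrite gt_eqF.
  pose th := Num.sqrt (1 - e / 2).
  have th1 : th < 1.
    rewrite -[ltRHS]sqrtr1 ltr_sqrt ?ltr01//.
    by rewrite gtrBl divr_gt0.
  have th0 : 0 <= th by exact: sqrtr_ge0.
  have mixle x : mix_norm c e B x <= th * (r * j x).
    have rj0 : 0 <= r * j x by rewrite mulr_ge0 ?(ltW r0).
    rewrite -[r * j x]ger0_norm// -sqrtr_sqr -sqrtrM; last first.
      by rewrite subr_ge0 ler_pdivrMr// mul1r (le_trans e1)// ler1n.
    rewrite ler_wsqrtr//.
    have h1 : (1 - e) * B x ^+ 2 <= (1 - e) * (r * j x) ^+ 2.
      by rewrite ler_wpM2l ?subr_ge0// ler_sqr ?nnegrE.
    have h2 : (e / D%:R) ^+ 2 * enorm (x - c) ^+ 2 <= e * 2^-1 * (r * j x) ^+ 2.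
      apply: (@le_trans _ _ ((e / D%:R) ^+ 2 * (M * j x) ^+ 2)).
        by rewrite ler_wpM2l ?sqr_ge0// ler_sqr ?nnegrE ?enorm_ge0// mulr_ge0 ?(ltW M0).
      have -> : (e / D%:R) ^+ 2 * (M * j x) ^+ 2 = e * (e * C) * (r * j x) ^+ 2.
        by rewrite /C; field; rewrite !gt_eqF.
      by rewrite ler_wpM2r ?sqr_ge0// ler_wpM2l ?(ltW e0).
    apply: (le_trans (lerD h1 h2)).
    by rewrite -mulrDl le_eqVlt; apply/orP; left; apply/eqP; congr (_ * _); field.
  apply: (@le_lt_trans _ _ (th `^ q * (r `^ q * \int[mu]_(x in O) (j x `^ q)))).
    apply: le_trans (torsion_le_mix (ltW e0) e1 (or_intror H)) _.
    have irj : mu.-integrable O (EFin \o (fun x => (r * j x) `^ q)) by exact: continuous_integrable_on.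
    rewrite -int_rj -(RintegralZl _ (measurable_open_rV oO) irj).
    apply: le_Rintegral => //.
    - exact: measurable_open_rV.
    - apply: continuous_integrable_on => //; apply: continuous_powR => //.
        exact: mix_norm_continuous.
      by move=> x; exact: sqrtr_ge0.
    - exact: (integrableZR (measurable_open_rV oO) _ irj).
    move=> x _; rewrite -powRM ?mulr_ge0 ?(ltW r0)//.
    by apply: le_powR; [exact: ltW|exact: sqrtr_ge0|exact: mixle].
  rewrite -[ltRHS]mul1r ltr_pM2r; last by rewrite mulr_gt0 ?powR_gt0 ?gauge_moment_gt0.
  have <- : 1 `^ q = 1 :> R by rewrite powR1.
  by rewrite gt0_ltr_powR// nnegrE.
move=> /existsNP[x /existsNP[nu /not_implyP[Ox /not_implyP[[nu1 Hnu] /negP]]]].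
rewrite -ltNge; set h := cdist O x + dotrV nu (x - c) => rh.
have hj : dotrV nu (x - c) <= h * j x.
  apply: (gauge_homogeneous_le vO Oc r0 rO (f := dotrV nu)).
  - by move=> t v t0; rewrite dotrVZr.
  - by rewrite (le_trans (ltW r0))// ltW.
  move=> y Oy; rewrite /h (_ : y - c = (y - x) + (x - c)); last by rewrite addrA subrK.
  by rewrite dotrVDr lerD2r; exact: Hnu.
have x1 := (gauge_in oO vO Oc r0 rO x).1 Ox.
(* Here h > r is the distance from c to the hyperplane. From B x = r - h + nu . (x - c) <= r - h + h
   j x, the gap to r j x is at least (h - r) (1 - j x) > 0. *)
have Blt : B x < r * j x.
  rewrite /B; have : 0 < (h - r) * (1 - j x) by rewrite mulr_gt0 ?subr_gt0.
  have -> : cdist O x = h - dotrV nu (x - c) by rewrite /h addrK.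
  have -> : (h - r) * (1 - j x) = h - r - h * j x + r * j x by ring.
  move: hj; move: (dotrV nu _) (h * j x) (r * j x) => a b t; lra.
apply: (@le_lt_trans _ _ (\int[mu]_(y in O) (B y `^ q))).
  apply: le_trans (torsion_le_mix (lexx 0) ler01 (or_introl erefl)) _.
  rewrite le_eqVlt; apply/orP; left; apply/eqP; apply: eq_Rintegral => y _.
  by rewrite /mix_norm subr0 mul1r mul0r expr0n /= mul0r addr0 sqrtr_sqr ger0_norm.
rewrite -int_rj; apply: (@lt_Rintegral_continuous _ _ _ oO bO _ _ x) => //.
- exact: continuous_powR.
- by move=> y _; apply: le_powR => //; exact: ltW.
- by rewrite gt0_ltr_powR// nnegrE// mulr_ge0 ?(ltW r0).
Qed.

End convex_upper_bound.

(** * Balls and slabs *)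

Section slab_constants.
Context {R : realType}.
Implicit Types (X a tau z : R).

Lemma exists_expr_gt z (M : R) : 1 < z -> exists n, M < z ^+ n.
Proof.
move=> z1; have z0 : 0 < z - 1 by rewrite subr_gt0.
exists (Num.bound (`|M| / (z - 1))).
set n := Num.bound _.
have h : `|M| / (z - 1) < n%:R by apply: archi_boundP; rewrite divr_ge0// ltW.
have h2 : 1 + (z - 1) *+ n <= z ^+ n.
  elim: n {h} => [|n IH]; first by rewrite mulr0n addr0 expr0.
  rewrite exprS mulrSr.
  apply: (@le_trans _ _ (z * (1 + (z - 1) *+ n))); last by rewrite ler_wpM2l// (le_trans ler01)// ltW.
  have m0 : 0 <= (z - 1) *+ n by rewrite mulrn_wge0// ltW.
  have : 0 <= (z - 1) * ((z - 1) *+ n) by rewrite mulr_ge0// ltW.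
  have -> : z * (1 + (z - 1) *+ n) = 1 + ((z - 1) *+ n + (z - 1)) + (z - 1) * ((z - 1) *+ n) by ring.
  by rewrite lerDl.
apply: lt_le_trans h2; apply: le_lt_trans (ler_norm M) _.
move: h; rewrite ltr_pdivrMr// mulr_natl => /lt_trans; apply.
by rewrite ltrDr.
Qed.

Lemma bernoulli_le (n : nat) (e : R) : 0 <= e -> e <= 1 -> 1 - n%:R * e <= (1 - e) ^+ n.
Proof.
move=> e0 e1; elim: n => [|n IH]; first by rewrite mul0r subr0 expr0.
rewrite exprS; apply: (@le_trans _ _ ((1 - e) * (1 - n%:R * e))); last by rewrite ler_wpM2l// subr_ge0.
have h : 0 <= n%:R * e * e by rewrite !mulr_ge0.
rewrite -natr1 (_ : (1 - e) * (1 - n%:R * e) = 1 - (n%:R + 1) * e + n%:R * e * e); last by ring.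
by rewrite lerDl.
Qed.

(* The bracket without w is k tau^D - p^-1 (1 - sg) (k u)^p, whose maximum over k is q^-1 (1 - sg) z^q with
   z = tau^D / ((1 - sg) u); for tau, sg close to 1 in a suitable ratio z > X, then q large beats the
   factor 1 - sg, and w is small by continuity. *)
Lemma slab_constants (D : nat) X a : (2 <= D)%N -> 0 < X -> X < a ->
  exists p q tau sg k w : R, [/\ 1 < p, p^-1 + q^-1 = 1,
    [&& 0 < sg, sg < tau & tau < 1], (0 < k) && (0 < w) &
    let u := (a * (1 - tau))^-1 in
    q^-1 * X `^ q < k * tau ^+ D - p^-1 * ((1 - sg) * (k * (u + w)) `^ p + (k * w) `^ p)].
Proof.
move=> D2 X0 Xa; have a0 : 0 < a by exact: lt_trans Xa.
have DR : 2 <= D%:R :> R by rewrite (ler_nat _ 2).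
have D0 : 0 < D%:R :> R by apply: lt_le_trans DR.
(* Chosen so that a (1 - D eta) is the midpoint Y0 of X and a; Bernoulli's inequality gives tau^D a
   >= Y0. *)
pose eta := (a - X) / (2 * a * D%:R).
have eta0 : 0 < eta by rewrite divr_gt0 ?subr_gt0 ?mulr_gt0.
have eta4 : eta <= 4^-1.
  rewrite /eta ler_pdivrMr ?mulr_gt0//.
  have h : a * 2 <= a * D%:R by rewrite ler_pM2l.
  have -> : 4^-1 * (2 * a * D%:R) = (a * D%:R) / 2 by field.
  by rewrite ler_pdivlMr//; lra.
pose tau := 1 - eta.
pose Y0 := (a + X) / 2.
have Y0X : X < Y0 by rewrite /Y0; lra.
have Y00 : 0 < Y0 by exact: lt_trans Y0X.
have tau0 : 0 < tau by rewrite /tau; lra.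
have tau1 : tau < 1 by rewrite /tau; lra.
have tauY : Y0 <= tau ^+ D * a.
  have eta1 : eta <= 1 by apply: le_trans eta4 _; rewrite invf_le1// ler1n.
  have := bernoulli_le D (ltW eta0) eta1; rewrite -(ler_pM2r a0); apply: le_trans.
  by rewrite le_eqVlt; apply/orP; left; apply/eqP; rewrite /eta /Y0; field; rewrite !gt_eqF.
clearbody Y0.
have etau : 1 - tau = eta by rewrite /tau; ring.
clearbody eta.
(* rho is the ratio (1 - tau) / (1 - sg). Then z = tau^D a rho is at least Y0 rho, the midpoint of X
   and Y0, hence z > X; and rho > 1 / 2 with eta <= 1 / 4 keeps sg positive. *)
pose rho := (Y0 + X) / (2 * Y0).
have rho0 : 0 < rho by apply: divr_gt0; [exact: addr_gt0|exact: mulr_gt0].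
have rho1 : rho < 1 by rewrite ltr_pdivrMr ?mulr_gt0//; lra.
have rho2 : 2^-1 < rho.
  rewrite /rho ltr_pdivlMr ?mulr_gt0//; have -> : 2^-1 * (2 * Y0) = Y0 by field.
  by rewrite ltrDl.
pose sg := 1 - eta / rho.
have esg : 1 - sg = eta / rho by rewrite /sg; ring.
have er0 : 0 < eta / rho by rewrite divr_gt0.
have sg0 : 0 < sg.
  rewrite subr_gt0 ltr_pdivrMr// mul1r; lra.
have sgt : sg < tau.
  rewrite /sg /tau ltrD2l ltrN2 ltr_pdivlMr//.
  by rewrite gtr_pMr.
pose u := (a * (1 - tau))^-1.
have u0 : 0 < u by rewrite invr_gt0 mulr_gt0// subr_gt0.
pose z := tau ^+ D / ((1 - sg) * u).
have s0 : 0 < 1 - sg by rewrite esg.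
have zX : X < z.
  apply: (@lt_le_trans _ _ (Y0 * rho)).
    have -> : Y0 * rho = (Y0 + X) / 2 by rewrite /rho; field; rewrite gt_eqF.
    lra.
  have -> : z = tau ^+ D * a * rho.
    rewrite /z esg /u etau.
    by field; rewrite !gt_eqF.
  by rewrite ler_pM2r.
have z0 : 0 < z by exact: lt_trans zX.
have zX1 : 1 < z / X by rewrite ltr_pdivlMr// mul1r.
(* A power of z / X that beats 1 / (1 - sg); q is taken as n + 2 so that it also exceeds 1. *)
have [n Hn] := exists_expr_gt (1 - sg)^-1 zX1.
have uE : u = (a * (1 - tau))^-1 by [].
have zE : z * ((1 - sg) * u) = tau ^+ D by rewrite /z divfK// gt_eqF// mulr_gt0.
clearbody z u sg tau.
pose q : R := n.+2%:R.
have q1 : 1 < q by rewrite ltr1n.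
have q0 : 0 < q by exact: lt_trans q1.
have zq : X `^ q < (1 - sg) * z `^ q.
  rewrite !powR_mulrn ?ltW//.
  have h1 : (z / X) ^+ n <= (z / X) ^+ n.+2.
    apply: ler_weXn2l; last by rewrite leqW.
    by rewrite ler_pdivlMr// mul1r ltW.
  have := lt_le_trans Hn h1; rewrite expr_div_n ltr_pdivlMr ?exprn_gt0//.
  by rewrite ltr_pdivrMl.
pose p := q / (q - 1).
have q10 : 0 < q - 1 by rewrite subr_gt0.
have p1 : 1 < p by rewrite ltr_pdivlMr// mul1r gtrBl.
have p0 : 0 < p by exact: lt_trans p1.
have pq : p^-1 + q^-1 = 1 by rewrite /p invf_div; field; rewrite gt_eqF.
(* The maximizer: (k u)^p = z^q and k tau^D = (1 - sg) z^q, so the bracket at w = 0 equals q^-1 (1 -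
   sg) z^q. *)
pose k := z `^ (q - 1) / u.
have k0 : 0 < k by rewrite divr_gt0 ?powR_gt0.
have ku : k * u = z `^ (q - 1) by rewrite /k divfK// gt_eqF.
have kup : (k * u) `^ p = z `^ q.
  by rewrite ku -powRrM /p mulrCA mulfV ?mulr1// gt_eqF.
have kt : k * tau ^+ D = (1 - sg) * z `^ q.
  rewrite -zE.
  have <- := mulr_powRB1 (ltW z0) q0.
  by rewrite -ku; ring.
pose h w := (1 - sg) * `|k * (u + w)| `^ p + `|k * w| `^ p.
have ch : h w @[w --> (0 : R)] --> h 0.
  have c1 (v : R) : `|k * (v + w)| `^ p @[w --> (0 : R)] --> `|k * (v + 0)| `^ p.
    have c2 : k * (v + w) @[w --> (0 : R)] --> k * (v + 0).
      by apply: cvgMl_tmp; apply: cvgD; [exact: cvg_cst|exact: cvg_id].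
    exact: (cvg_comp _ _ c2 (@powR_norm_continuous R p p0 (k * (v + 0)))).
  rewrite /h; apply: cvgD; first by apply: cvgMl_tmp; exact: c1.
  have := c1 0; rewrite add0r.
  by under [X in X @ _ --> _ -> _]eq_fun do rewrite add0r.
have h0 : h 0 = (1 - sg) * z `^ q.
  have e1 : `|k * (u + 0)| = k * u by rewrite addr0 gtr0_norm// mulr_gt0.
  have e2 : `|k * 0| `^ p = 0 by rewrite mulr0 normr0 powR0// gt_eqF.
  by rewrite /h e1 e2 kup addr0.
have gap : 0 < (1 - sg) * z `^ q - X `^ q by rewrite subr_gt0.
pose e := p * (q^-1 * ((1 - sg) * z `^ q - X `^ q)).
have e0 : 0 < e by rewrite !mulr_gt0 ?invr_gt0.
move/(@cvgrPdist_lt _ _ _ (nbhs (0:R)))/(_ e e0)/nbhs_ballP : ch => [d /= d0 Hd].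
pose w := d / 2.
have w0 : 0 < w by rewrite divr_gt0.
have hw : h w < h 0 + e.
  have : ball 0 d w.
    by rewrite -ball_normE /= sub0r normrN gtr0_norm// ltr_pdivrMr// ltr_pMr// ltr1n.
  move=> /Hd; rewrite ltr_norml => /andP[+ _]; rewrite ltrBrDr; lra.
exists p, q, tau, sg, k, w; split => //; [by rewrite sg0 sgt tau1|by rewrite k0 w0|].
rewrite -uE /=.
have -> : (1 - sg) * (k * (u + w)) `^ p + (k * w) `^ p = h w.
  have e1 : `|k * (u + w)| = k * (u + w) by rewrite gtr0_norm// mulr_gt0// addr_gt0.
  have e2 : `|k * w| = k * w by rewrite gtr0_norm// mulr_gt0.
  by rewrite /h e1 e2.
rewrite kt; have : p^-1 * h w < p^-1 * (h 0 + e) by rewrite ltr_pM2l ?invr_gt0.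
have -> : p^-1 * (h 0 + e) = p^-1 * h 0 + q^-1 * ((1 - sg) * z `^ q - X `^ q).
  by rewrite mulrDr /e [p^-1 * (p * _)]mulrA mulVf ?mul1r// gt_eqF.
rewrite h0; have -> : q^-1 = 1 - p^-1 by rewrite -pq; ring.
move: (p^-1 * h w) ((1 - sg) * z `^ q) (X `^ q) (p^-1) => A B C E; lra.
Qed.

End slab_constants.

(** * Comparison of normalized rigidities *)

Section comparison.
Context {R : realType} {D : nat}.
Local Notation V := 'rV[R]_D.
Local Notation mu := (@lebesgue_rV R D).
Implicit Types (O : set V) (p q r : R).

Lemma volume_gt0 O : convex_domain O -> 0 < fine (mu O).
Proof.
move=> [nO oO bO vO]; rewrite fine_gt0// open_lebesgue_rV_gt0//=.
by apply: bounded_lebesgue_rV_lty => //; exact: measurable_open_rV.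
Qed.

(** The normalized rigidity is (|O| / T)^(p - 1), a decreasing function of T / |O|. *)
Lemma normalized_lt O1 O2 p : 1 < p -> 0 < fine (mu O1) -> 0 < fine (mu O2) ->
  0 < torsional_rigidity p O1 -> 0 < torsional_rigidity p O2 ->
  torsional_rigidity p O1 * fine (mu O2) < torsional_rigidity p O2 * fine (mu O1) ->
  normalized_torsional_rigidity p O2 < normalized_torsional_rigidity p O1.
Proof.
rewrite /normalized_torsional_rigidity.
move: (torsional_rigidity p O1) (torsional_rigidity p O2) (fine (mu O1)) (fine (mu O2)).
move=> t1 t2 v1 v2 p1 v10 v20 t10 t20 lt.
have p10 : 0 < p - 1 by rewrite subr_gt0.
have e : 1 - p = - (p - 1) by ring.
rewrite e !powRN ltr_pdivrMr ?powR_gt0// mulrAC ltr_pdivlMr ?powR_gt0//.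
rewrite -!powRM ?(ltW v10) ?(ltW v20) ?(ltW t10) ?(ltW t20)//.
apply: gt0_ltr_powR => //; rewrite ?nnegrE ?mulr_ge0 ?(ltW v10) ?(ltW v20) ?(ltW t10) ?(ltW t20)//.
by rewrite mulrC [ltRHS]mulrC.
Qed.

Lemma conjugate_exists p : 1 < p -> exists2 q, 1 < q & p^-1 + q^-1 = 1.
Proof.
move=> p1; have p10 : 0 < p - 1 by rewrite subr_gt0.
exists (p / (p - 1)); first by rewrite ltr_pdivlMr// mul1r gtrBl.
by rewrite invf_div; field; rewrite gt_eqF// (lt_trans ltr01).
Qed.

(** Eliminating the moment leaves only volume and inradius; the common factor D + q then drops out
    of any comparison. Only the upper estimate is strict. *)
Lemma torsion_bounds O p q : (2 <= D)%N -> convex_domain O -> 1 < p -> 0 < q -> p^-1 + q^-1 = 1 ->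
  [/\ 0 < inradius O, 0 < torsional_rigidity p O,
    (inradius O / D%:R) `^ q * (D%:R * fine (mu O)) <= (D%:R + q) * torsional_rigidity p O &
    (D%:R + q) * torsional_rigidity p O < inradius O `^ q * (D%:R * fine (mu O))].
Proof.
move=> D2 [nO oO bO vO] p1 q0 pq.
have D1 : (0 < D)%N by exact: leq_trans D2.
pose i0 := Ordinal D1.
have [c [Oc cr rmax]] := incenter i0 oO bO nO.
have r0 : 0 < inradius O by rewrite -cr; apply: cdist_gt0.
have rO : eball c (inradius O) `<=` O.
  by move=> y yr; apply: (cdist_ball (x := c)); rewrite cr.
have up := torsion_lt_gauge i0 oO bO vO Oc cr rmax D2 p1 pq.
have lo := torsion_ge_gauge i0 oO bO vO Oc r0 rO D2 p1 pq.
have m0 := gauge_moment_gt0 i0 oO bO vO Oc cr D2 p1 pq.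
have E := gauge_moment oO bO vO Oc r0 rO q0 D2.
have Dq : 0 < D%:R + q by rewrite ltr_wpDl.
have D0 : 0 < D%:R :> R by rewrite ltr0n.
split => //.
- apply: lt_le_trans lo; rewrite mulr_gt0// powR_gt0// divr_gt0//.
- by rewrite -E mulrCA ler_pM2l.
- by rewrite -E mulrCA ltr_pM2l.
Qed.

Lemma normalized_torsional_rigidity_anti (a b : R) O1 O2 p : (2 <= D)%N -> 1 < p ->
  a <= D%:R^-1 * b -> convex_domain_inradius a O1 -> convex_domain_inradius b O2 ->
  normalized_torsional_rigidity p O2 < normalized_torsional_rigidity p O1.
Proof.
move=> D2 p1 ab [d1 r1] [d2 r2].
have [q q1 pq] := conjugate_exists p1; have q0 : 0 < q by exact: lt_trans q1.
have [a0 t10 _ up] := torsion_bounds D2 d1 p1 q0 pq.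
have [b0 t20 lo _] := torsion_bounds D2 d2 p1 q0 pq.
have v10 := volume_gt0 d1; have v20 := volume_gt0 d2.
apply: normalized_lt => //.
have abq : inradius O1 `^ q <= (inradius O2 / D%:R) `^ q.
  apply: le_powR => //; rewrite ?(ltW a0) ?(ltW q0)//.
  by rewrite r1 r2 mulrC.
have Dq : 0 < D%:R + q by rewrite ltr_wpDl.
rewrite -(ltr_pM2l Dq) !mulrA.
apply: (@lt_le_trans _ _ (inradius O1 `^ q * (D%:R * fine (mu O1)) * fine (mu O2))).
  by rewrite ltr_pM2r.
apply: (@le_trans _ _ ((inradius O2 / D%:R) `^ q * (D%:R * fine (mu O2)) * fine (mu O1))).
  have -> : (inradius O2 / D%:R) `^ q * (D%:R * fine (mu O2)) * fine (mu O1) =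
      (inradius O2 / D%:R) `^ q * (D%:R * fine (mu O1)) * fine (mu O2) by ring.
  by rewrite ler_pM2r// ler_wpM2r// mulr_ge0// ltW.
by rewrite ler_pM2r.
Qed.

End comparison.

Section ball.
Context {R : realType} {D : nat}.
Local Notation V := 'rV[R]_D.
Local Notation mu := (@lebesgue_rV R D).
Local Notation e_ i := (delta_mx ord0 i : V).
Implicit Types (p q r b : R).

Lemma enorm_delta (i : 'I_D) : enorm (e_ i) = 1.
Proof.
rewrite /enorm /dotrV (bigD1 i)//= big1 => [|j ji]; last first.
  by rewrite mxE (negbTE ji) andbF mul0r.
by rewrite mxE !eqxx mulr1 addr0 sqrtr1.
Qed.

(** A ball of radius larger than b would contain x + b e and x - b e for e the i0-th unit vector,
    and the hypothesis on B forbids this for t = b. B is the Euclidean norm for the ball and |x_i0|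
    for the box. *)
Lemma eball_subset_radius (i0 : 'I_D) (O : set V) (B : V -> R) b r x : 0 < b ->
  (forall t : R, B (x + t *: e_ i0) < b -> B (x - t *: e_ i0) < b -> t < b) ->
  (forall y, O y -> B y < b) -> eball x r `<=` O -> r <= b.
Proof.
move=> b0 HB OB rO; rewrite leNgt; apply/negP => br.
suff : b < b by rewrite ltxx.
apply: HB; apply: OB; apply: rO; rewrite /eball /=.
  by rewrite addrAC subrr add0r enormZ enorm_delta mulr1 gtr0_norm.
by rewrite addrAC subrr add0r enormN enormZ enorm_delta mulr1 gtr0_norm.
Qed.

Lemma inradius_eq (O : set V) b : 0 < b -> (exists x, eball x b `<=` O) ->
  (forall x r, eball x r `<=` O -> r <= b) -> inradius O = b.
Proof.
move=> b0 xO ub; apply/eqP; rewrite eq_le; apply/andP; split.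
  by apply: ge_sup; [exists b|move=> r [_ [x /ub]]].
by apply: ub_le_sup => //; exists b => r [_ [x /ub]].
Qed.

Lemma convex_set_intro (O : set V) :
  (forall x y (t : R), 0 <= t <= 1 -> O x -> O y -> O (t *: x + (1 - t) *: y)) -> convex_set O.
Proof.
move=> H x y t; rewrite !inE => Ox Oy.
by have := H x y t%:num _ Ox Oy; apply; rewrite ge0 le1.
Qed.

Lemma open_eball r : open (eball (0 : V) r).
Proof.
have -> : eball (0 : V) r = enorm @^-1` [set s : R | s < r].
  by apply/seteqP; split => x; rewrite /eball /= subr0.
by apply: open_comp; [move=> x _; exact: enorm_continuous|exact: open_lt].
Qed.

Lemma bounded_eball r : bounded_set (eball (0 : V) r).
Proof.
exists r; split; first exact: num_real.
move=> M rM x; rewrite /eball /= subr0 => xr.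
by rewrite (le_trans (norm_ler_enorm x))// (le_trans (ltW xr))// ltW.
Qed.

Lemma eball_convex_domain b (i0 : 'I_D) : 0 < b -> convex_domain_inradius b (eball (0 : V) b).
Proof.
move=> b0; split; last first.
  apply: inradius_eq => //; first by exists 0.
  move=> x r; apply: (@eball_subset_radius i0 _ enorm) => //; last first.
    by move=> y; rewrite /eball /= subr0.
  move=> t h1 h2; have : enorm (2 * t *: e_ i0) < 2 * b.
    have -> : 2 * t *: e_ i0 = (x + t *: e_ i0) + - (x - t *: e_ i0).
      by apply/rowP => i; rewrite !mxE; ring.
    by apply: le_lt_trans (ler_enormD _ _) _; rewrite enormN; lra.
  rewrite enormZ enorm_delta mulr1 => h; rewrite -(@ltr_pM2l _ 2)//.
  exact: le_lt_trans (ler_norm _) h.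
split.
- by exists 0; rewrite /eball /= subr0 enorm0.
- exact: open_eball.
- exact: bounded_eball.
- apply: convex_set_intro => x y t /andP[t0 t1]; rewrite /eball /= !subr0 => hx hy.
  apply: le_lt_trans (ler_enormD _ _) _; rewrite !enormZ !ger0_norm ?subr_ge0//.
  have [->|tn] := eqVneq t 0; first by rewrite mul0r add0r subr0 mul1r.
  have tp : 0 < t by rewrite lt0r tn.
  have -> : b = t * b + (1 - t) * b by ring.
  by rewrite ltr_leD ?ltr_pM2l// ler_wpM2l ?subr_ge0// ltW.
Qed.

Lemma ball_torsion_le b p q (i0 : 'I_D) : 1 < p -> p^-1 + q^-1 = 1 -> 0 < q -> 0 < b ->
  torsional_rigidity p (eball (0 : V) b) <= (D%:R^-1 * b) `^ q * fine (mu (eball (0 : V) b)).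
Proof.
move=> p1 pq q0 b0; set O := eball (0 : V) b.
have oO : open O by exact: open_eball.
have bO : bounded_set O by exact: bounded_eball.
have mO := measurable_open_rV oO.
have muO : (mu O < +oo)%E by exact: bounded_lebesgue_rV_lty.
have D0 : 0 < D%:R :> R by rewrite ltr0n (leq_ltn_trans _ (ltn_ord i0)).
pose k : R := - D%:R^-1.
have cW i : continuous (fun x : V => (k *: x) ord0 i).
  under eq_fun do rewrite mxE.
  by apply: continuous_scaleR; exact: continuous_coordR.
have cdW : forall i : 'I_D, continuous (fun _ : V => k) by move=> i; exact: continuous_cstR.
have dWE i x : is_derive x (e_ i) (fun y : V => (k *: y) ord0 i) k.
  under [X in is_derive _ _ X _]eq_fun do rewrite mxE.
  have := is_deriveZ k (is_derive_coord i i x); rewrite eqxx /GRing.scale /= mulr1.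
  by [].
have divW x : O x -> \sum_(i < D) k <= -1.
  by move=> _; rewrite sumr_const card_ord -mulr_natl /k mulrN mulfV// gt_eqF.
have := torsion_le_field oO bO p1 pq cW cdW dWE divW i0.
move=> /le_trans; apply.
have e : \int[mu]_(x in O) (D%:R^-1 * b) `^ q = (D%:R^-1 * b) `^ q * fine (mu O).
  exact: (Rintegral_cst mu mO).
rewrite -e; apply: (le_Rintegral mO).
- exact: (field_pow_integrable oO bO p1 pq cW).
- by apply: cst_integrableR.
move=> x Ox; apply: le_powR; rewrite ?enorm_ge0 ?(ltW q0)//.
rewrite enormZ /k normrN gtr0_norm ?invr_gt0// ler_pM2l ?invr_gt0//.
by move: Ox; rewrite /O /eball /= subr0 => /ltW.
Qed.

End ball.

Section box.
Context {R : realType} {D : nat}.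
Local Notation V := 'rV[R]_D.
Local Notation mu := (@lebesgue_rV R D).
Local Notation e_ i := (delta_mx ord0 i : V).
Implicit Types (a b L : R) (s : 'I_D -> R).

Definition box s : set V := [set x | forall i, `|x ord0 i| < s i].

Lemma box_volume s : (forall i, 0 <= s i) -> fine (mu (box s)) = \prod_(i < D) (2 * s i).
Proof.
move=> s0.
have -> : box s = rbox (fun i => `]- s i, s i[%classic).
  by apply/seteqP; split => x H i; have := H i; rewrite /= in_itv /= ltr_norml.
rewrite lebesgue_rbox; last by move=> i; exact: measurable_itv.
have -> : (\prod_(i < D) lebesgue_measure `](- s i)%R, (s i)[%classic)%E = (\prod_(i < D) (2 * s i))%:E.
  rewrite -prodEFin; apply: eq_bigr => i _; rewrite lebesgue_measure_itv /= lte_fin.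
  case: ltP => h; first by rewrite -EFinB; congr (_%:E); ring.
  by have := s0 i; move=> h0; congr (_%:E); lra.
by [].
Qed.

Lemma open_box s : open (box s).
Proof.
rewrite openE => x xs; apply: (@filter_forall _ _ (fun i (y : V) => `|y ord0 i| < s i) (nbhs x)) => i.
have ci : continuous (fun y : V => `|y ord0 i|).
  move=> y; apply: (@continuous_comp _ _ _ (fun y : V => y ord0 i) Num.norm).
    exact: continuous_coordR.
  exact: norm_continuous.
have : nbhs `|x ord0 i| [set t : R | t < s i] by apply: open_nbhs_nbhs; split; [exact: open_lt|exact: xs].
exact: ci.
Qed.

Lemma bounded_box s : (forall i, 0 <= s i) -> bounded_set (box s).
Proof.
move=> s0; exists (\sum_i s i); split; first exact: num_real.
move=> M sM x xs; apply: (@le_trans _ _ (\sum_i s i)); last exact: ltW.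
apply: rV_norm_ler; first by apply: sumr_ge0.
move=> i; apply: (le_trans (ltW (xs i))).
by rewrite (bigD1 i)//= lerDl sumr_ge0.
Qed.

Lemma convex_box s : convex_set (box s).
Proof.
apply: convex_set_intro => x y t /andP[t0 t1] xs ys i; rewrite !mxE.
apply: le_lt_trans (ler_normD _ _) _; rewrite !normrM (ger0_norm t0) (ger0_norm (_ : 0 <= 1 - t)) ?subr_ge0//.
have [->|tn] := eqVneq t 0; first by rewrite mul0r add0r subr0 mul1r.
have tp : 0 < t by rewrite lt0r tn.
have -> : s i = t * s i + (1 - t) * s i by ring.
by rewrite ltr_leD ?ltr_pM2l ?xs// ler_wpM2l ?subr_ge0// ltW ?ys.
Qed.

Lemma box_convex_domain s (i0 : 'I_D) : (forall i, 0 < s i) -> (forall i, s i0 <= s i) ->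
  convex_domain_inradius (s i0) (box s).
Proof.
move=> s0 smin; have s0' i : 0 <= s i by exact: ltW.
split; last first.
  apply: inradius_eq => //.
    exists 0 => y; rewrite /eball /= subr0 => h i.
    exact: le_lt_trans (coord_ler_enorm y i) (lt_le_trans h (smin i)).
  move=> x r; apply: (@eball_subset_radius _ _ i0 _ (fun y => `|y ord0 i0|)) => //.
  move=> t; rewrite !mxE !eqxx mulr1 !ltr_norml => /andP[_ h1] /andP[h2 _].
  by move: (x ord0 i0) (s i0) h1 h2 => y u h1 h2; lra.
split.
- by exists 0 => i; rewrite mxE normr0.
- exact: open_box.
- exact: bounded_box.
- exact: convex_box.
Qed.

Lemma step_integral (O A : set V) (k l : R) :
  measurable O -> measurable A -> A `<=` O -> (mu O < +oo)%E ->
  mu.-integrable O (EFin \o (fun x => k + l * \1_A x)) /\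
  \int[mu]_(x in O) (k + l * \1_A x) = k * fine (mu O) + l * fine (mu A).
Proof.
move=> mO mA AO muO.
have i1 : mu.-integrable O (EFin \o (fun=> k)) by exact: cst_integrableR.
have i2 : mu.-integrable O (EFin \o \1_A).
  apply: (le_integrableR mO _ _ (cst_integrableR mO 1 muO)); first exact: measurable_indic.
  by move=> x _ /=; rewrite indicE; case: (_ \in _); rewrite ?normr1 ?normr0.
have i3 := integrableZR mO l i2.
split; first exact: (integrableDR mO i1 i3).
rewrite (RintegralD mO i1 i3) (RintegralZl l mO i2); congr (_ + _ * _).
  exact: (Rintegral_cst mu mO).
rewrite /Rintegral integral_indic//; congr (fine (mu _)).
exact/setIidPl.
Qed.

End box.

(** * Profiles for the test function on the slab *)

Section cutoffs.
Context {R : realType}.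
Variables (tau sg : R).
Hypotheses (st : sg < tau) (t1 : tau < 1).
Implicit Types (t : R).

(** Equal to 1 up to tau and affine afterwards, with zero at 1. It goes on below 0; the positive
    part is taken once, after all sides have been combined. *)
Definition cutoff t := Num.min 1 ((1 - t) / (1 - tau)).
(** A continuous majorant of the indicator of t > tau, where [cutoff] has slope. The slope itself
    jumps at tau, whereas [torsion_ge_fun] wants a continuous bound; the transition from sg to tau
    is the price. *)
Definition ramp t := Num.min 1 (Num.max 0 ((t - sg) / (tau - sg))).

Let t10 : 0 < 1 - tau. Proof. by rewrite subr_gt0. Qed.

Lemma cutoff_le1 t : cutoff t <= 1. Proof. by rewrite ge_min lexx. Qed.

Lemma cutoff_eq1 t : t <= tau -> cutoff t = 1.
Proof. by move=> h; apply/min_idPl; rewrite ler_pdivlMr// mul1r lerD2l lerN2. Qed.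

Lemma cutoff_le0 t : 1 <= t -> cutoff t <= 0.
Proof. by move=> h; rewrite ge_min pmulr_lle0 ?invr_gt0// subr_le0 h orbT. Qed.

Lemma cutoff_lip t u : cutoff t - cutoff u <= `|t - u| / (1 - tau).
Proof.
have h : (1 - t) / (1 - tau) <= (1 - u) / (1 - tau) + `|t - u| / (1 - tau).
  rewrite -mulrDl ler_pM2r ?invr_gt0//.
  by have := ler_norm (u - t); rewrite distrC; lra.
have n0 : 0 <= `|t - u| / (1 - tau) by rewrite divr_ge0// ltW.
rewrite /cutoff lerBlDr; move: h n0.
move: ((1 - t) / _) ((1 - u) / _) (`|t - u| / _) => x y e h n0.
by rewrite !minEle; do 2 case: ifP; lra.
Qed.

Lemma ramp_ge0 t : 0 <= ramp t.
Proof. by rewrite le_min ler01 le_max lexx. Qed.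

Lemma ramp_le1 t : ramp t <= 1. Proof. by rewrite ge_min lexx. Qed.

Lemma ramp_eq0 t : t <= sg -> ramp t = 0.
Proof.
move=> h; rewrite /ramp max_l ?min_r//.
by rewrite pmulr_lle0 ?invr_gt0 ?subr_gt0// subr_le0.
Qed.

Lemma ramp_eq1 t : tau <= t -> ramp t = 1.
Proof.
move=> h; apply/min_idPl; rewrite le_max; apply/orP; right.
by rewrite ler_pdivlMr ?subr_gt0// mul1r lerD2r.
Qed.

(** For t <= tau the value at t is already maximal, so an increase is possible only where [ramp] is
    1. Such one-sided bounds are what [lipschitz_max] takes. *)
Lemma cutoff_lip_ramp t u : cutoff u - cutoff t <= ramp t * (`|t - u| / (1 - tau)).
Proof.
have [h|h] := leP t tau.
  rewrite (cutoff_eq1 h); apply: (@le_trans _ _ 0); first by rewrite subr_le0 cutoff_le1.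
  by rewrite mulr_ge0 ?ramp_ge0// divr_ge0// ltW.
by rewrite (ramp_eq1 (ltW h)) mul1r distrC; exact: cutoff_lip.
Qed.

Lemma cutoff_continuous : continuous cutoff.
Proof.
move=> t; apply: (@continuous_min _ _ (cst 1) (fun t => (1 - t) / (1 - tau))); first exact: cst_continuous.
by apply: cvgMr_tmp; apply: cvgB; [exact: cvg_cst|exact: cvg_id].
Qed.

Lemma ramp_continuous : continuous ramp.
Proof.
move=> t; apply: (@continuous_min _ _ (cst 1) (fun t => Num.max 0 ((t - sg) / (tau - sg)))); first exact: cst_continuous.
apply: (@continuous_max _ _ (cst 0) (fun t => (t - sg) / (tau - sg))); first exact: cst_continuous.
by apply: cvgMr_tmp; apply: cvgB; [exact: cvg_id|exact: cvg_cst].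
Qed.

End cutoffs.

Section slab.
Context {R : realType} {D : nat}.
Local Notation V := 'rV[R]_D.
Local Notation mu := (@lebesgue_rV R D).
Variables (s : 'I_D -> R) (i0 : 'I_D) (p q tau sg k w : R).
Hypotheses (p1 : 1 < p) (pq : p^-1 + q^-1 = 1) (s0 : forall i, 0 < s i)
  (sg0 : 0 < sg) (st : sg < tau) (t1 : tau < 1) (k0 : 0 < k) (w0 : 0 < w)
  (sw : forall i, i != i0 -> D%:R * ((1 - tau) * s i)^-1 <= w).
Implicit Types (x y z : V) (i : 'I_D).

Let u := (s i0 * (1 - tau))^-1.
Let t10 : 0 < 1 - tau. Proof. by rewrite subr_gt0. Qed.
Let u0 : 0 < u. Proof. by rewrite invr_gt0 mulr_gt0. Qed.
Let c i x := `|x ord0 i| / s i.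
Local Notation g := (cutoff tau).
(* The profile g in the short direction, truncated near the far faces with slope at most w. *)
Let m x := g (c i0 x) - \sum_(i | i != i0) (1 - g (c i x)).
Let F x := k * Num.max 0 (m x).
Let G x := k * (u * ramp tau sg (c i0 x) + w).
Local Notation O := (box s).

Let c_lip i x z : `|c i x - c i z| <= (s i)^-1 * enorm (x - z).
Proof.
rewrite /c -mulrBl normrM mulrC gtr0_norm ?invr_gt0// ler_pM2l ?invr_gt0//.
apply: le_trans (coord_ler_enorm _ i); rewrite !mxE.
exact: ler_dist_dist.
Qed.

Let m_lip x z : m z - m x <= (u * ramp tau sg (c i0 x) + w) * enorm (x - z).
Proof.
have e0 : 0 <= enorm (x - z) by exact: enorm_ge0.
have h1 : g (c i0 z) - g (c i0 x) <= u * ramp tau sg (c i0 x) * enorm (x - z).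
  apply: le_trans (cutoff_lip_ramp st t1 _ _) _.
  have -> : u * ramp tau sg (c i0 x) * enorm (x - z) =
      ramp tau sg (c i0 x) * ((s i0)^-1 * enorm (x - z) / (1 - tau)).
    by rewrite /u invfM; ring.
  by rewrite ler_wpM2l ?ramp_ge0// ler_pM2r ?invr_gt0.
have h2 : \sum_(i | i != i0) (1 - g (c i x)) - \sum_(i | i != i0) (1 - g (c i z)) <= w * enorm (x - z).
  (* Each long side contributes at most the share w / D of the slope w, by [sw]. *)
  rewrite -sumrB; apply: (@le_trans _ _ (\sum_(i | i != i0) (D%:R^-1 * w * enorm (x - z)))).
    apply: ler_sum => i ii0.
    have -> : 1 - g (c i x) - (1 - g (c i z)) = g (c i z) - g (c i x) by ring.
    apply: le_trans (cutoff_lip t1 _ _) _; rewrite distrC.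
    have D0 : 0 < D%:R :> R by rewrite ltr0n (leq_ltn_trans _ (ltn_ord i0)).
    apply: (@le_trans _ _ (((1 - tau) * s i)^-1 * enorm (x - z))).
      by rewrite invfM mulrC -mulrA ler_pM2l ?invr_gt0.
    by apply: ler_wpM2r => //; rewrite ler_pdivlMl//; exact: sw.
  apply: (@le_trans _ _ (\sum_(i < D) (D%:R^-1 * w * enorm (x - z)))).
    by rewrite [leRHS](bigD1 i0)//= lerDr !mulr_ge0// ?(ltW w0)// invr_ge0.
  rewrite sumr_const card_ord -[leLHS]mulr_natl !mulrA mulfV ?mul1r// gt_eqF//.
  by rewrite ltr0n (leq_ltn_trans _ (ltn_ord i0)).
move: h1 h2; rewrite /m mulrDl; lra.
Qed.

Let F_lip x z : F z - F x <= G x * enorm (x - z).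
Proof.
rewrite /F /G -mulrBr -mulrA ler_pM2l//.
have e0 : 0 <= (u * ramp tau sg (c i0 x) + w) * enorm (x - z).
  by rewrite mulr_ge0 ?enorm_ge0// addr_ge0 ?(ltW w0)// mulr_ge0 ?ramp_ge0// ltW.
have := m_lip x z; move: e0; move: (_ * enorm _) (m x) (m z) => e a b.
by rewrite !maxEle; do 2 case: ifP; lra.
Qed.

Let c_cont i : continuous (c i).
Proof.
apply: (@lipschitz_continuousR _ _ _ ((s i)^-1 * D%:R)); first by rewrite mulr_ge0// invr_ge0 ltW.
move=> x y; apply: le_trans (c_lip i x y) _.
by rewrite -mulrA ler_pM2l ?invr_gt0// enorm_ler_norm.
Qed.

Let gc_cont i : continuous (fun x => g (c i x)).
Proof. by move=> x; apply: (@continuous_comp _ _ _ (c i) g); [exact: c_cont|exact: cutoff_continuous]. Qed.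

Let m_cont : continuous m.
Proof.
have cs : continuous (fun x => \sum_(i <- index_enum 'I_D) (if i != i0 then 1 - g (c i x) else 0)).
  apply: continuous_sumR => i; case: (i != i0); last exact: continuous_cstR.
  have -> : (fun x => 1 - g (c i x)) = (fun x => 1 + (-1) * g (c i x)).
    by apply/funext => x; rewrite mulN1r.
  by apply: continuous_addR; [exact: continuous_cstR|apply: continuous_scaleR; exact: gc_cont].
have -> : m = (fun x => g (c i0 x) + (-1) * (\sum_(i <- index_enum 'I_D) (if i != i0 then 1 - g (c i x) else 0))).
  by apply/funext => x; rewrite mulN1r /m big_mkcond.
by apply: continuous_addR; [exact: gc_cont|exact: continuous_scaleR].
Qed.

Let F_cont : continuous F.
Proof.
apply: continuous_scaleR => x; apply: (@continuous_max _ _ (cst 0) m); first exact: cst_continuous.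
exact: m_cont.
Qed.

Let G_cont : continuous G.
Proof.
apply: continuous_scaleR; apply: continuous_addR; last exact: continuous_cstR.
apply: continuous_scaleR => x; apply: (@continuous_comp _ _ _ (c i0) (ramp tau sg)); first exact: c_cont.
exact: ramp_continuous.
Qed.

Let sum_ge0 (P : pred 'I_D) x : 0 <= \sum_(i | P i) (1 - g (c i x)).
Proof. by apply: sumr_ge0 => i _; rewrite subr_ge0 cutoff_le1. Qed.

Let F_out x : ~ O x -> F x = 0.
Proof.
move=> /existsNP[i /negP]; rewrite -leNgt => si.
have ci : 1 <= c i x by rewrite ler_pdivlMr// mul1r.
have gi := cutoff_le0 t1 ci.
rewrite /F max_l ?mulr0// /m subr_le0.
have [E|ii0] := eqVneq i i0; first by rewrite -E (le_trans gi)// sum_ge0.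
rewrite (bigD1 i)//=; apply: (le_trans (cutoff_le1 _ _)).
have := sum_ge0 (fun j => (j != i0) && (j != i)) x.
by move: (\sum_(_ | _) _) gi => S gi; lra.
Qed.

Let F_in x : box (fun i => tau * s i) x -> F x = k.
Proof.
move=> xs; have ci i : c i x <= tau by rewrite ler_pdivrMr// ltW.
rewrite /F /m (cutoff_eq1 t1 (ci i0)) big1 => [|i _]; last by rewrite (cutoff_eq1 t1 (ci i)) subrr.
by rewrite subr0 max_r ?mulr1// ler01.
Qed.

(** F equals k on the box shrunk by tau, which has the fraction tau^D of the volume. The slope is at
    most k w where |x_i0| < sg s_i0, a fraction sg of the volume, and at most k (u + w) elsewhere;
    the term in k w is charged on all of O. *)
Lemma slab_torsion_ge : fine (mu O) *
    (k * tau ^+ D - p^-1 * ((1 - sg) * (k * (u + w)) `^ p + (k * w) `^ p)) <=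
  q^-1 * torsional_rigidity p O.
Proof.
have s0' i : 0 <= s i by exact: ltW.
have p0 : 0 < p by exact: lt_trans p1.
have tau0 : 0 < tau by exact: lt_trans st.
have oO : open O by exact: open_box.
have bO : bounded_set O by exact: bounded_box.
have mO := measurable_open_rV oO.
have muO : (mu O < +oo)%E by exact: bounded_lebesgue_rV_lty.
have F0 x : 0 <= F x by rewrite mulr_ge0 ?(ltW k0)// le_max lexx.
have G0 x : 0 <= G x.
  by rewrite mulr_ge0 ?(ltW k0)// addr_ge0 ?(ltW w0)// mulr_ge0 ?ramp_ge0// ltW.
apply: le_trans (torsion_ge_fun i0 oO bO p1 pq F_cont G_cont F_out F0 G0 (lipschitz_max F_lip)).
have intF : k * tau ^+ D * fine (mu O) <= \int[mu]_(x in O) F x.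
  pose A := box (fun i => tau * s i).
  have mA : measurable A by apply: measurable_open_rV; exact: open_box.
  have AO : A `<=` O by move=> x xA i; apply: lt_trans (xA i) _; rewrite gtr_pMl.
  have vA : fine (mu A) = tau ^+ D * fine (mu O).
    rewrite !box_volume//; last by move=> i; rewrite mulr_ge0// ltW.
    rewrite -[D in tau ^+ D]card_ord -prodr_const -big_split /=; apply: eq_bigr => i _; ring.
  have [iA EA] := step_integral 0 k mO mA AO muO.
  apply: (@le_trans _ _ (\int[mu]_(x in O) (0 + k * \1_A x))).
    by rewrite EA mul0r add0r vA mulrA.
  apply: (le_Rintegral mO iA (continuous_integrable_on oO bO F_cont)) => x Ox.
  rewrite add0r indicE; case: (boolP (x \in A)) => [|_]; last by rewrite mulr0.
  by rewrite inE => /F_in ->; rewrite mulr1.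
have intG : \int[mu]_(x in O) (G x `^ p) <= ((1 - sg) * (k * (u + w)) `^ p + (k * w) `^ p) * fine (mu O).
  pose A := box (fun i => if i == i0 then sg * s i else s i).
  have mA : measurable A by apply: measurable_open_rV; exact: open_box.
  have sg1 : sg < 1 by exact: lt_trans t1.
  have AO : A `<=` O.
    move=> x xA i; apply: lt_le_trans (xA i) _; case: ifP => // _.
    by rewrite ger_pMl// ltW.
  have vA : fine (mu A) = sg * fine (mu O).
    rewrite !box_volume//; last by move=> i; case: ifP => // _; rewrite mulr_ge0// ltW.
    rewrite (bigD1 i0)//= [in RHS](bigD1 i0)//= eqxx !mulrA; congr (_ * _); first by ring.
    by apply: eq_bigr => i /negbTE ->.
  pose c1 := (k * (u + w)) `^ p; pose c2 := (k * w) `^ p.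
  have [iA EA] := step_integral (c1 + c2) (- c1) mO mA AO muO.
  apply: (@le_trans _ _ (\int[mu]_(x in O) (c1 + c2 + - c1 * \1_A x))); last first.
    by rewrite EA vA -/c1 -/c2 le_eqVlt; apply/orP; left; apply/eqP; ring.
  have cGp : continuous (fun x => G x `^ p) by apply: continuous_powR.
  apply: (le_Rintegral mO (continuous_integrable_on oO bO cGp) iA) => x Ox.
  have c10 : 0 <= c1 by exact: powR_ge0.
  have c20 : 0 <= c2 by exact: powR_ge0.
  rewrite indicE; case: (boolP (x \in A)) => [|_]; last first.
    rewrite mulr0 addr0; apply: (@le_trans _ _ c1); last by rewrite lerDl.
    apply: le_powR => //; first exact: ltW.
    by rewrite ler_pM2l// lerD2r ler_piMr ?ramp_le1// ltW.
  rewrite inE => xA; rewrite mulr1 addrAC subrr add0r; apply: le_powR => //; first exact: ltW.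
  rewrite ler_pM2l// ramp_eq0 ?mulr0 ?add0r//.
  by have := xA i0; rewrite eqxx => h; rewrite ler_pdivrMr// ltW.
have := ler_wpM2l (_ : 0 <= p^-1) intG; rewrite invr_ge0 => /(_ (ltW p0)).
move: intF; move: (\int[mu]_(x in O) F x) (\int[mu]_(x in O) (G x `^ p)) (fine (mu O)) => IF IG v.
move: (k * tau ^+ D) ((1 - sg) * _ + _) => A B h1 h2.
have -> : v * (A - p^-1 * B) = A * v - p^-1 * (B * v) by ring.
exact: lerB.
Qed.

End slab.

Theorem corollary2 (R : realType) (D : nat) (hD : (2 <= D)%N) (a b : R)
    (ha : 0 < a) (hab : a < b) :
  (D%:R^-1 * b < a ->
    exists (pD : R) (Oa Ob : set 'rV[R]_D),
      [/\ 1 < pD, convex_domain_inradius a Oa, convex_domain_inradius b Ob &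
        normalized_torsional_rigidity pD Oa
          < normalized_torsional_rigidity pD Ob]) /\
  (a <= D%:R^-1 * b ->
    forall Oa Ob : set 'rV[R]_D,
      convex_domain_inradius a Oa -> convex_domain_inradius b Ob ->
      forall p : R, 1 < p ->
        normalized_torsional_rigidity p Ob < normalized_torsional_rigidity p Oa).
Proof.
split => [Xa|ab Oa Ob dOa dOb p p1]; last exact: (normalized_torsional_rigidity_anti hD p1 ab dOa dOb).
have b0 : 0 < b by exact: lt_trans hab.
have D0 : 0 < D%:R :> R by rewrite ltr0n (leq_trans _ hD).
have D1 : (0 < D)%N by exact: leq_trans hD.
pose i0 := Ordinal D1.
have X0 : 0 < D%:R^-1 * b by rewrite mulr_gt0// invr_gt0.
(* X = b / D itself: the constants give a strict inequality for the slab, and the bound of the ball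
   is exactly X^q times its volume. *)
have [p [q [tau [sg [k [w [p1 pq /and3P[sg0 st t1] /andP[k0 w0]]]]]]]] := slab_constants hD X0 Xa.
set u := (a * (1 - tau))^-1 => /= Hlt.
have q0 : 0 < q.
  rewrite -invr_gt0 -[q^-1](addKr p^-1) pq addrC subr_gt0 invf_lt1//.
  exact: lt_trans p1.
have t10 : 0 < 1 - tau by rewrite subr_gt0.
(* At least a, so that the short side determines the inradius, and long enough for the slope at a
   far face to be at most w / D. *)
pose L := Num.max a (D%:R / ((1 - tau) * w)).
have aL : a <= L by rewrite le_max lexx.
have L0 : 0 < L by exact: lt_le_trans aL.
have wL : D%:R * ((1 - tau) * L)^-1 <= w.
  rewrite ler_pdivrMr ?mulr_gt0// mulrCA mulrA -ler_pdivrMl ?mulr_gt0// mulrC.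
  by rewrite le_max lexx orbT.
clearbody L.
pose s i := if i == i0 then a else L.
have s0 i : 0 < s i by rewrite /s; case: ifP.
have si0 : s i0 = a by rewrite /s eqxx.
have smin i : s i0 <= s i by rewrite si0 /s; case: ifP.
have sw i : i != i0 -> D%:R * ((1 - tau) * s i)^-1 <= w by rewrite /s => /negbTE ->.
have dOa := box_convex_domain s0 smin; rewrite si0 in dOa.
have dOb := eball_convex_domain i0 b0.
exists p, (box s), (eball 0 b); split => //.
have lo := slab_torsion_ge p1 pq s0 sg0 st t1 k0 w0 sw; rewrite si0 -/u in lo.
have up := ball_torsion_le i0 p1 pq q0 b0.
have va := volume_gt0 dOa.1; have vb := volume_gt0 dOb.1.
have [_ ta _ _] := torsion_bounds hD dOa.1 p1 q0 pq.
have [_ tb _ _] := torsion_bounds hD dOb.1 p1 q0 pq.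
apply: normalized_lt => //.
have lt : (D%:R^-1 * b) `^ q * fine (lebesgue_rV D (box s)) < torsional_rigidity p (box s).
  rewrite -(@ltr_pM2l _ q^-1) ?invr_gt0//; apply: lt_le_trans lo.
  by rewrite mulrA [ltRHS]mulrC ltr_pM2r.
apply: le_lt_trans (ler_wpM2r (ltW va) up) _.
by rewrite mulrAC ltr_pM2r.
Qed.
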